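(* Let $R$ be a commutative ring. If a weakly Tannakian $R$-linear category $\mathscr{A}$ admits a neutral fiber functor, then $\mathscr{A}$ is equivalent to the category of finitely presentable representations of a flat affine group scheme over $R$.
   Context: Let $R$ be a commutative ring, $B$ a commutative $R$-algebra, and $\mathscr{A}$ an (essentially small) symmetric monoidal abelian $R$-linear category. A strong symmetric monoidal $R$-linear functor $w\colon \mathscr{A}\to \mathbf{Mod}_B$ is a fiber functor if it is faithful and exact; it is neutral if $B=R$. $\mathscr{A}$ is weakly Tannakian if (i) there exists a fiber functor $w\colon \mathscr{A}\to\mathbf{Mod}_B$ for some commutative $R$-algebra $B$; (ii) for every object $A\in\mathscr{A}$ there is an epimorphism $A'\to A$ such that $A'$ has a dual. A flat affine group scheme over $R$ is the same as a flat commutative Hopf algebra $\Gamma$ over $R$; its representations are the $\Gamma$-comodules. A representation is finitely presentable if it is a finitely presentable object of the category of representations (homs out of it preserve filtered colimits), equivalently if its underlying $R$-module is finitely presentable. *)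

(* Defs.v *)
From HB Require Import structures.
From mathcomp Require Import all_boot all_algebra.
From mathcomp Require Import boolp.

Set Implicit Arguments.
Unset Strict Implicit.
Unset Printing Implicit Defensive.

Import GRing.Theory.
Local Open Scope ring_scope.
Local Open Scope quotient_scope.

(* Rings are [comPzRingType]s throughout, so that the zero ring is allowed. *)

Definition mklin (B : pzRingType) (M N : lmodType B) (f : M -> N)
    (fl : linear f) : {linear M -> N} :=
  HB.pack f (GRing.isLinear.Build B M N *:%R f fl).

Lemma linext (B : pzRingType) (M N : lmodType B) (f g : {linear M -> N}) :
  f =1 g -> f = g.
Proof.
case: f g => [f [[f1] [f2]]] [g [[g1] [g2]]] /= /funext efg.
by case: _ / efg g1 g2 => g1 g2; rewrite (Prop_irrelevance f1 g1) (Prop_irrelevance f2 g2).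
Qed.

Section Tensor.
Variables (B : comPzRingType) (M N : lmodType B).

(* A list of pairs stands for the formal sum of the m (x) n; [tens_rel] is the
   smallest congruence defining the tensor product. *)
Inductive tens_rel : seq (M * N) -> seq (M * N) -> Prop :=
| tens_refl s : tens_rel s s
| tens_sym s t : tens_rel s t -> tens_rel t s
| tens_trans s t u : tens_rel s t -> tens_rel t u -> tens_rel s u
| tens_cat s s' t t' :
    tens_rel s s' -> tens_rel t t' -> tens_rel (s ++ t) (s' ++ t')
| tens_comm s t : tens_rel (s ++ t) (t ++ s)
| tens_addl m m' n : tens_rel [:: (m + m', n)] [:: (m, n); (m', n)]
| tens_addr m n n' : tens_rel [:: (m, n + n')] [:: (m, n); (m, n')]
| tens_scal a m n : tens_rel [:: (a *: m, n)] [:: (m, a *: n)]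
| tens_0 n : tens_rel [:: (0, n)] [::].

Definition tens_eqb (s t : seq (M * N)) : bool := `[< tens_rel s t >].

Lemma tens_eqb_equiv : equiv_class_of tens_eqb.
Proof.
split=> [s|s t|t s u]; first by apply/asboolP; apply: tens_refl.
  by apply/asboolP/asboolP => /tens_sym.
by move=> /asboolP st /asboolP tu; apply/asboolP; apply: tens_trans st tu.
Qed.

Canonical tens_equiv := EquivRelPack tens_eqb_equiv.

Definition tensor_carrier : Type := {eq_quot tens_eqb}.
HB.instance Definition _ := Choice.on tensor_carrier.

Definition tcls (s : seq (M * N)) : tensor_carrier := \pi_({eq_quot tens_eqb}) s.

Lemma tclsP s t : tens_rel s t <-> tcls s = tcls t.
Proof.
split=> [st|/eqmodP/asboolP//]; by apply/eqmodP/asboolP.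
Qed.

Lemma tcls_surj (x : tensor_carrier) : exists s, x = tcls s.
Proof. by exists (repr x); rewrite /tcls reprK. Qed.

Definition trepr (x : tensor_carrier) : seq (M * N) := repr x.
Lemma treprK x : tcls (trepr x) = x. Proof. by rewrite /tcls /trepr reprK. Qed.

Definition tadd (x y : tensor_carrier) : tensor_carrier := tcls (trepr x ++ trepr y).
Lemma taddE s t : tadd (tcls s) (tcls t) = tcls (s ++ t).
Proof. by apply/tclsP/tens_cat; apply/tclsP; rewrite treprK. Qed.

Definition sscale (a : B) (s : seq (M * N)) := [seq (a *: p.1, p.2) | p <- s].

Lemma sscale_rel a s t : tens_rel s t -> tens_rel (sscale a s) (sscale a t).
Proof.
elim=> {s t} [s|s t _ IH|s t u _ IH1 _ IH2|s s' t t' _ IH1 _ IH2|s t|m m' n|m n n'|b m n|n] /=.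
- exact: tens_refl.
- exact: tens_sym.
- exact: tens_trans IH1 IH2.
- by rewrite /sscale !map_cat; apply: tens_cat.
- by rewrite /sscale !map_cat; apply: tens_comm.
- by rewrite scalerDr; apply: tens_addl.
- exact: tens_addr.
- rewrite scalerA mulrC -scalerA; exact: tens_scal.
- by rewrite scaler0; apply: tens_0.
Qed.

Definition tscale (a : B) (x : tensor_carrier) : tensor_carrier := tcls (sscale a (trepr x)).
Lemma tscaleE a s : tscale a (tcls s) = tcls (sscale a s).
Proof. by apply/tclsP/sscale_rel; apply/tclsP; rewrite treprK. Qed.

Lemma taddA : associative tadd.
Proof.
move=> x y z; have [[[s ->] [t ->]] [u ->]] := (tcls_surj x, tcls_surj y, tcls_surj z).
by rewrite !taddE catA.
Qed.
Lemma taddC : commutative tadd.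
Proof.
move=> x y; have [[s ->] [t ->]] := (tcls_surj x, tcls_surj y).
by rewrite !taddE; apply/tclsP/tens_comm.
Qed.
Lemma tadd0 : left_id (tcls [::]) tadd.
Proof. by move=> x; have [s ->] := tcls_surj x; rewrite taddE. Qed.

Lemma tens_0s (s : seq (M * N)) : tens_rel [seq (0, p.2) | p <- s] [::].
Proof.
elim: s => [|p s IH]; first exact: tens_refl.
by rewrite /= -cat1s -[[::]]cats0; apply: tens_cat => //; apply: tens_0.
Qed.

Lemma tscaleDl x a b : tscale (a + b) x = tadd (tscale a x) (tscale b x).
Proof.
have [s ->] := tcls_surj x; rewrite !tscaleE taddE; apply/tclsP.
elim: s => [|p s IH] /=; first exact: tens_refl.
rewrite -cat1s scalerDl.
apply: tens_trans (tens_cat (tens_addl _ _ _) IH) _ => /=.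
rewrite -[(a *: p.1, p.2) :: _]cat1s -[(a *: p.1, p.2) :: _ ++ _]cat1s.
apply: tens_cat; first exact: tens_refl.
rewrite -[(b *: p.1, p.2) :: sscale b s]cat1s -cat1s !catA.
by apply: tens_cat; [apply: tens_comm | apply: tens_refl].
Qed.

Lemma tscale0 x : tscale 0 x = tcls [::].
Proof.
have [s ->] := tcls_surj x; rewrite tscaleE; apply/tclsP.
rewrite (_ : sscale 0 s = [seq (0, p.2) | p <- s]); first exact: tens_0s.
by apply: eq_map => p; rewrite scale0r.
Qed.

Lemma tscale1 : left_id 1 tscale.
Proof.
move=> x; have [s ->] := tcls_surj x; rewrite tscaleE; congr tcls.
by rewrite -[RHS]map_id; apply: eq_map => -[m n]; rewrite scale1r.
Qed.

Definition topp (x : tensor_carrier) : tensor_carrier := tscale (-1) x.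
Lemma taddN : left_inverse (tcls [::]) topp tadd.
Proof.
by move=> x; rewrite /topp -[X in tadd _ X]tscale1 -tscaleDl addNr tscale0.
Qed.

Lemma tscaleA a b x : tscale a (tscale b x) = tscale (a * b) x.
Proof.
have [s ->] := tcls_surj x; rewrite !tscaleE /sscale -map_comp; congr tcls.
by apply: eq_map => p /=; rewrite scalerA.
Qed.
Lemma tscaleDr : right_distributive tscale tadd.
Proof.
move=> a x y; have [[s ->] [t ->]] := (tcls_surj x, tcls_surj y).
by rewrite taddE !tscaleE taddE /sscale map_cat.
Qed.

HB.instance Definition _ :=
  GRing.isZmodule.Build tensor_carrier taddA taddC tadd0 taddN.
HB.instance Definition _ :=
  GRing.Zmodule_isLmodule.Build B tensor_carrier tscaleA tscale1 tscaleDr tscaleDl.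

Definition tensor : lmodType B := GRing.Lmodule.clone B tensor_carrier _.

Definition pure (m : M) (n : N) : tensor := tcls [:: (m, n)].

Lemma tens_ind (P : tensor -> Prop) :
  P 0 -> (forall m n, P (pure m n)) ->
  (forall x y, P x -> P y -> P (x + y)) -> forall x, P x.
Proof.
move=> P0 Pp PD x; have [s ->] := tcls_surj x.
elim: s => [//|[m n] s IH]; rewrite -cat1s -taddE.
by apply: (PD (pure m n) (tcls s)).
Qed.

Lemma pureDl m m' n : pure (m + m') n = pure m n + pure m' n.
Proof. by rewrite [RHS]taddE; apply/tclsP/tens_addl. Qed.
Lemma pureDr m n n' : pure m (n + n') = pure m n + pure m n'.
Proof. by rewrite [RHS]taddE; apply/tclsP/tens_addr. Qed.
Lemma pureZl a m n : pure (a *: m) n = a *: pure m n.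
Proof. by rewrite [RHS]tscaleE. Qed.
Lemma pureZr a m n : pure m (a *: n) = a *: pure m n.
Proof. by rewrite -pureZl; apply/esym/tclsP/tens_scal. Qed.
Lemma pure0l n : pure 0 n = 0.
Proof. by rewrite -(scale0r 0) pureZl scale0r. Qed.
Lemma pure0r m : pure m 0 = 0.
Proof. by rewrite -(scale0r 0) pureZr scale0r. Qed.

Section Lift.
Variables (P : lmodType B) (b : M -> N -> P).
Definition bilinear_map :=
  (forall n, linear (b ^~ n)) /\ (forall m, linear (b m)).
Hypothesis hb : bilinear_map.

Definition ssum (s : seq (M * N)) : P := \sum_(p <- s) b p.1 p.2.

Lemma ssum_rel s t : tens_rel s t -> ssum s = ssum t.
Proof.
case: hb => bl br; rewrite /ssum.
elim=> {s t} [s//|//|s t u _ -> _ //|s s' t t' _ IH1 _ IH2|s t|m m' n|m n n'|a m n|n].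
- by rewrite !big_cat /= IH1 IH2.
- by rewrite !big_cat /= addrC.
- by rewrite !big_cons !big_nil /= !addr0 -[m]scale1r bl !scale1r.
- by rewrite !big_cons !big_nil /= !addr0 -[n]scale1r br !scale1r.
- rewrite !big_cons !big_nil /= !addr0.
  have /= -> := GRing.scalable_linear (bl n) a m.
  by have /= -> := GRing.scalable_linear (br m) a n.
- rewrite !big_cons !big_nil /= !addr0; exact: (linear0 (mklin (bl n))).
Qed.

Definition tlift_fun (x : tensor) : P := ssum (trepr x).
Lemma tlift_cls s : tlift_fun (tcls s) = ssum s.
Proof. by apply: ssum_rel; apply/tclsP; rewrite treprK. Qed.

Lemma tlift_linear : linear tlift_fun.
Proof.
move=> a x y; have [[s ->] [t ->]] := (tcls_surj x, tcls_surj y).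
rewrite (_ : a *: tcls s + tcls t = tcls (sscale a s ++ t)); last first.
  by rewrite -taddE -tscaleE.
rewrite !tlift_cls /ssum big_cat /= big_map scaler_sumr; congr (_ + _).
by apply: eq_bigr => p _; apply: (GRing.scalable_linear (hb.1 p.2)).
Qed.

Lemma tlift_subproof :
  {f : {linear tensor -> P} | forall m n, f (pure m n) = b m n}.
Proof.
by exists (mklin tlift_linear) => m n /=; rewrite tlift_cls /ssum big_seq1.
Qed.

(* The factorization of b through the tensor product, unique by [tens_ind]. *)
Definition tlift : {linear tensor -> P} := sval tlift_subproof.

Lemma tliftE m n : tlift (pure m n) = b m n.
Proof. exact: (svalP tlift_subproof). Qed.

End Lift.
End Tensor.

Arguments pure {B M N}.

Section TensorMaps.
Variable B : comPzRingType.

Definition lid (M : lmodType B) : {linear M -> M} := mklin (f := fun m => m) (fun _ _ _ => erefl).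
Lemma lidE (M : lmodType B) x : lid M x = x. Proof. by []. Qed.
Lemma lcomp_linear (M N P : lmodType B) (g : {linear N -> P})
  (f : {linear M -> N}) : linear (g \o f).
Proof. by move=> a x y /=; rewrite !linearP. Qed.
Definition lcomp (M N P : lmodType B) (g : {linear N -> P})
  (f : {linear M -> N}) : {linear M -> P} := mklin (lcomp_linear g f).

Lemma lcompE (M N P : lmodType B) (g : {linear N -> P}) (f : {linear M -> N}) x :
  lcomp g f x = g (f x).
Proof. by []. Qed.

Lemma tmap_bil (M M' N N' : lmodType B) (f : {linear M -> M'})
  (g : {linear N -> N'}) : bilinear_map (fun m n => pure (f m) (g n)).
Proof.
by split=> ? a x y; rewrite linearP (pureDl, pureDr) (pureZl, pureZr).
Qed.
Definition tmap (M M' N N' : lmodType B) (f : {linear M -> M'})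
  (g : {linear N -> N'}) : {linear tensor M N -> tensor M' N'} :=
  tlift (tmap_bil f g).
Lemma tmapE (M M' N N' : lmodType B) (f : {linear M -> M'})
  (g : {linear N -> N'}) m n : tmap f g (pure m n) = pure (f m) (g n).
Proof. exact: tliftE. Qed.

Lemma swap_bil (M N : lmodType B) : bilinear_map (fun m n => @pure B N M n m).
Proof. by split=> ? a x y; rewrite (pureDl, pureDr) (pureZl, pureZr). Qed.
Definition tswap (M N : lmodType B) : {linear tensor M N -> tensor N M} :=
  tlift (@swap_bil M N).
Lemma tswapE (M N : lmodType B) (m : M) (n : N) :
  tswap M N (pure m n) = pure n m.
Proof. exact: tliftE. Qed.

Section Assoc.
Variables M N P : lmodType B.
Lemma assoc_bil1 (p : P) :
  bilinear_map (fun (m : M) (n : N) => pure m (pure n p)).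
Proof. by split=> ? a x y; rewrite ?(pureDl, pureDr, pureZl, pureZr). Qed.
Lemma assoc_bil : bilinear_map (fun x p => tlift (assoc_bil1 p) x).
Proof.
split=> [p|x] a y z; first by rewrite linearP.
elim/tens_ind: x => [|m n|x x' /= IH IH'] /=.
- by rewrite !linear0 addr0.
- by rewrite !tliftE !(pureDl, pureDr, pureZl, pureZr).
- by rewrite !linearD IH IH' addrACA.
Qed.
Definition tassoc :
  {linear tensor (tensor M N) P -> tensor M (tensor N P)} := tlift assoc_bil.
Lemma tassocE m n p : tassoc (pure (pure m n) p) = pure m (pure n p).
Proof. by rewrite /tassoc !tliftE. Qed.

Lemma assocV_bil1 (m : M) :
  bilinear_map (fun (n : N) (p : P) => pure (pure m n) p).
Proof. by split=> ? a x y; rewrite ?(pureDl, pureDr, pureZl, pureZr). Qed.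
Lemma assocV_bil : bilinear_map (fun m x => tlift (assocV_bil1 m) x).
Proof.
split=> [x|m] a y z; last by rewrite linearP.
elim/tens_ind: x => [|n p|x x' /= IH IH'] /=.
- by rewrite !linear0 addr0.
- by rewrite !tliftE !(pureDl, pureDr, pureZl, pureZr).
- by rewrite !linearD IH IH' addrACA.
Qed.
Definition tassocV :
  {linear tensor M (tensor N P) -> tensor (tensor M N) P} := tlift assocV_bil.
Lemma tassocVE m n p : tassocV (pure m (pure n p)) = pure (pure m n) p.
Proof. by rewrite /tassocV !tliftE. Qed.
End Assoc.

Definition regmod : lmodType B := GRing.Lmodule.clone B B^o _.

Lemma lunit_bil (M : lmodType B) : bilinear_map (fun (a : regmod) (m : M) => (a : B) *: m).
Proof.
split=> ? a x y; first by rewrite scalerDl scalerA.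
by rewrite scalerDr !scalerA mulrC.
Qed.
Definition tlunit (M : lmodType B) : {linear tensor regmod M -> M} :=
  tlift (@lunit_bil M).
Lemma tlunitE (M : lmodType B) (a : B) (m : M) : tlunit M (@pure B regmod M a m) = a *: m.
Proof. exact: tliftE. Qed.
Lemma runit_bil (M : lmodType B) : bilinear_map (fun (m : M) (a : regmod) => (a : B) *: m).
Proof. by have [l r] := lunit_bil M; split. Qed.
Definition trunit (M : lmodType B) : {linear tensor M regmod -> M} :=
  tlift (@runit_bil M).
Lemma trunitE (M : lmodType B) (a : B) (m : M) : trunit M (@pure B M regmod m a) = a *: m.
Proof. exact: tliftE. Qed.

Lemma tlunitV_linear (M : lmodType B) : linear (fun m : M => @pure B regmod M (1 : B) m).
Proof. by move=> a x y; rewrite pureDr pureZr. Qed.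
Definition tlunitV (M : lmodType B) : {linear M -> tensor regmod M} :=
  mklin (@tlunitV_linear M).
Definition trunitV (M : lmodType B) : {linear M -> tensor M regmod} :=
  lcomp (tswap regmod M) (tlunitV M).

Definition tmid (M N P Q : lmodType B) :
  {linear tensor (tensor M N) (tensor P Q) -> tensor (tensor M P) (tensor N Q)} :=
  lcomp (tassocV M P (tensor N Q))
   (lcomp (tmap (lid M)
      (lcomp (tassoc P N Q)
        (lcomp (tmap (tswap N P) (lid Q)) (tassocV N P Q))))
     (tassoc M N (tensor P Q))).
Lemma tmidE (M N P Q : lmodType B) (m : M) (n : N) (p : P) (q : Q) :
  tmid M N P Q (pure (pure m n) (pure p q)) = pure (pure m p) (pure n q).
Proof.
by rewrite /= tassocE tmapE /= tassocVE tmapE /= tswapE tassocE tassocVE.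
Qed.

End TensorMaps.

(* The B-linear maps, on which R acts through phi. *)
Definition linhom (R B : comPzRingType) (phi : {rmorphism R -> B})
  (M N : lmodType B) : Type := {linear M -> N}.

Section Hom.
Variables (R B : comPzRingType) (phi : {rmorphism R -> B}) (M N : lmodType B).

Local Notation hom := (linhom phi M N).
Definition hfun (f : hom) : M -> N := (f : {linear M -> N}).
HB.instance Definition _ := gen_eqMixin hom.
HB.instance Definition _ := gen_choiceMixin hom.

Lemma hzero_linear : linear (fun _ : M => 0 : N).
Proof. by move=> a x y; rewrite scaler0 addr0. Qed.
Lemma hadd_linear (f g : hom) : linear (fun x => hfun f x + hfun g x).
Proof. by move=> a x y; rewrite /hfun !linearP scalerDr addrACA. Qed.
Lemma hopp_linear (f : hom) : linear (fun x => - hfun f x).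
Proof. by move=> a x y; rewrite /hfun linearP opprD scalerN. Qed.
Lemma hscale_linear r (f : hom) : linear (fun x => phi r *: hfun f x).
Proof.
by move=> a x y; rewrite /hfun linearP scalerDr !scalerA [_ * a]mulrC.
Qed.
Definition hzero : hom := mklin hzero_linear.
Definition hadd f g : hom := mklin (hadd_linear f g).
Definition hopp f : hom := mklin (hopp_linear f).
Definition hscale r f : hom := mklin (hscale_linear r f).

Lemma haddA : associative hadd.
Proof. by move=> f g h; apply: linext => x; exact: addrA. Qed.
Lemma haddC : commutative hadd.
Proof. by move=> f g; apply: linext => x; exact: addrC. Qed.
Lemma hadd0 : left_id hzero hadd.
Proof. by move=> f; apply: linext => x; exact: add0r. Qed.
Lemma haddN : left_inverse hzero hopp hadd.
Proof. by move=> f; apply: linext => x; exact: addNr. Qed.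
HB.instance Definition _ := GRing.isZmodule.Build hom haddA haddC hadd0 haddN.

Lemma hscaleA a b f : hscale a (hscale b f) = hscale (a * b) f.
Proof. by apply: linext => x /=; rewrite /hfun /= rmorphM scalerA. Qed.
Lemma hscale1 : left_id 1 hscale.
Proof. by move=> f; apply: linext => x /=; rewrite rmorph1 scale1r. Qed.
Lemma hscaleDr : right_distributive hscale +%R.
Proof. by move=> a f g; apply: linext => x; exact: scalerDr. Qed.
Lemma hscaleDl f : {morph hscale^~ f : a b / a + b}.
Proof. by move=> a b; apply: linext => x /=; rewrite rmorphD; exact: scalerDl. Qed.
HB.instance Definition _ :=
  GRing.Zmodule_isLmodule.Build R hom hscaleA hscale1 hscaleDr hscaleDl.

End Hom.

(* The universe of the carriers of rings and modules. The objects of a category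
   may live in a larger universe; its sets of morphisms may not. *)
Notation SmallType := Type@{Choice.axioms_.u0}.

Declare Scope cat_scope.
Delimit Scope cat_scope with cat.

Record Category : Type := {
  Ob :> Type;
  Hom : Ob -> Ob -> SmallType;
  idm : forall X, Hom X X;
  ccomp : forall X Y Z, Hom Y Z -> Hom X Y -> Hom X Z;
  ccomp1m : forall X Y (f : Hom X Y), ccomp (idm Y) f = f;
  ccompm1 : forall X Y (f : Hom X Y), ccomp f (idm X) = f;
  ccompA : forall X Y Z W (h : Hom Z W) (g : Hom Y Z) (f : Hom X Y),
    ccomp h (ccomp g f) = ccomp (ccomp h g) f
}.
Arguments Hom {_} _ _.
Arguments idm {_} _.
Arguments ccomp {_ _ _ _} _ _.
Notation "g ∘ f" := (ccomp g f) (at level 40, left associativity) : cat_scope.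
Local Open Scope cat_scope.

Section Basics.
Variable C : Category.

Definition is_iso (X Y : C) (f : Hom X Y) : Prop :=
  exists g : Hom Y X, g ∘ f = idm X /\ f ∘ g = idm Y.
Definition isomorphic (X Y : C) : Prop := exists f : Hom X Y, is_iso f.
Definition monic (X Y : C) (f : Hom X Y) : Prop :=
  forall Z (g h : Hom Z X), f ∘ g = f ∘ h -> g = h.
Definition epic (X Y : C) (f : Hom X Y) : Prop :=
  forall Z (g h : Hom Y Z), g ∘ f = h ∘ f -> g = h.

Definition essentially_small : Prop :=
  exists (I : SmallType) (s : I -> C), forall X : C, exists i, isomorphic X (s i).
End Basics.

Record Functor (C D : Category) : Type := {
  fobj :> C -> D;
  fmap : forall X Y : C, Hom X Y -> Hom (fobj X) (fobj Y);
  fmap1 : forall X, fmap (idm X) = idm (fobj X);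
  fmapD : forall X Y Z (g : Hom Y Z) (f : Hom X Y),
    fmap (g ∘ f) = fmap g ∘ fmap f
}.
Arguments fmap {C D} _ {X Y} _.

Program Definition idF (C : Category) : Functor C C :=
  {| fobj := fun X => X; fmap := fun _ _ f => f |}.
Program Definition compF (C D E : Category) (G : Functor D E) (F : Functor C D) :
  Functor C E := {| fobj := fun X => G (F X); fmap := fun _ _ f => fmap G (fmap F f) |}.
Next Obligation. by rewrite !fmap1. Qed.
Next Obligation. by rewrite !fmapD. Qed.

Definition naturally_isomorphic (C D : Category) (F G : Functor C D) : Prop :=
  exists a : forall X, Hom (F X) (G X),
    (forall X, is_iso (a X)) /\
    forall X Y (f : Hom X Y), a Y ∘ fmap F f = fmap G f ∘ a X.

Definition is_equivalence (C D : Category) (F : Functor C D) : Prop :=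
  exists G : Functor D C,
    naturally_isomorphic (compF G F) (idF C) /\
    naturally_isomorphic (compF F G) (idF D).

Definition faithful (C D : Category) (F : Functor C D) : Prop :=
  forall X Y, injective (@fmap C D F X Y).

Program Definition full_subcategory (C : Category) (P : C -> Prop) : Category :=
  {| Ob := {X : C | P X}; Hom := fun X Y => Hom (sval X) (sval Y);
     idm := fun X => idm (sval X); ccomp := fun _ _ _ g f => g ∘ f |}.
Next Obligation. exact: ccomp1m. Qed.
Next Obligation. exact: ccompm1. Qed.
Next Obligation. exact: ccompA. Qed.

Program Definition inclusion (C : Category) (P : C -> Prop) :
  Functor (full_subcategory P) C :=
  {| fobj := fun X => sval X; fmap := fun _ _ f => f |}.

Record cocone (J C : Category) (D : Functor J C) (L : C) : Type := {
  leg :> forall j : J, Hom (D j) L;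
  leg_nat : forall i j (u : Hom i j), leg j ∘ fmap D u = leg i
}.

Definition is_colimit (J C : Category) (D : Functor J C) (L : C)
    (c : cocone D L) : Prop :=
  forall (T : C) (d : cocone D T),
    exists! h : Hom L T, forall j, h ∘ c j = d j.

Program Definition fmap_cocone (J C E : Category) (F : Functor C E)
    (D : Functor J C) (L : C) (c : cocone D L) : cocone (compF F D) (F L) :=
  {| leg := fun j => fmap F (c j) |}.
Next Obligation. by rewrite -fmapD leg_nat. Qed.

Definition filtered (J : Category) : Prop :=
  [/\ inhabited J,
      forall i j : J, exists k (u : Hom i k) (v : Hom j k), True &
      forall (i j : J) (u v : Hom i j), exists k (w : Hom j k), w ∘ u = w ∘ v].

Program Definition SetCat : Category :=
  {| Ob := SmallType; Hom := fun X Y => X -> Y; idm := fun X x => x;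
     ccomp := fun _ _ _ g f x => g (f x) |}.

Program Definition hom_functor (C : Category) (X : C) : Functor C SetCat :=
  {| fobj := fun Y => Hom X Y; fmap := fun _ _ f g => f ∘ g |}.
Next Obligation. by apply/funext => f; rewrite ccomp1m. Qed.
Next Obligation. by apply/funext => h; rewrite ccompA. Qed.

Definition finitely_presentable (C : Category) (X : C) : Prop :=
  forall (J : Category) (D : Functor J C) (L : C) (c : cocone D L),
    essentially_small J -> filtered J -> is_colimit c ->
    is_colimit (fmap_cocone (hom_functor X) c).

Record SymMonoidal (C : Category) : Type := {
  tens : C -> C -> C;
  tensm : forall X X' Y Y' : C,
    Hom X X' -> Hom Y Y' -> Hom (tens X Y) (tens X' Y');
  munit : C;
  tensm1 : forall X Y, tensm (idm X) (idm Y) = idm (tens X Y);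
  tensmD : forall X X' X'' Y Y' Y'' (f' : Hom X' X'') (f : Hom X X')
      (g' : Hom Y' Y'') (g : Hom Y Y'),
    tensm (f' ∘ f) (g' ∘ g) = tensm f' g' ∘ tensm f g;
  assoc : forall X Y Z, Hom (tens (tens X Y) Z) (tens X (tens Y Z));
  assocV : forall X Y Z, Hom (tens X (tens Y Z)) (tens (tens X Y) Z);
  lunit : forall X, Hom (tens munit X) X;
  runit : forall X, Hom (tens X munit) X;
  braid : forall X Y, Hom (tens X Y) (tens Y X);
  assocK : forall X Y Z, assocV X Y Z ∘ assoc X Y Z = idm _;
  assocVK : forall X Y Z, assoc X Y Z ∘ assocV X Y Z = idm _;
  lunit_iso : forall X, is_iso (lunit X);
  runit_iso : forall X, is_iso (runit X);
  assoc_nat : forall X X' Y Y' Z Z' (f : Hom X X') (g : Hom Y Y') (h : Hom Z Z'),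
    assoc X' Y' Z' ∘ tensm (tensm f g) h = tensm f (tensm g h) ∘ assoc X Y Z;
  lunit_nat : forall X X' (f : Hom X X'),
    lunit X' ∘ tensm (idm munit) f = f ∘ lunit X;
  runit_nat : forall X X' (f : Hom X X'),
    runit X' ∘ tensm f (idm munit) = f ∘ runit X;
  braid_nat : forall X X' Y Y' (f : Hom X X') (g : Hom Y Y'),
    braid X' Y' ∘ tensm f g = tensm g f ∘ braid X Y;
  pentagon : forall X Y Z W,
    assoc X Y (tens Z W) ∘ assoc (tens X Y) Z W =
    tensm (idm X) (assoc Y Z W) ∘ assoc X (tens Y Z) W
      ∘ tensm (assoc X Y Z) (idm W);
  triangle : forall X Y,
    tensm (idm X) (lunit Y) ∘ assoc X munit Y = tensm (runit X) (idm Y);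
  hexagon : forall X Y Z,
    assoc Y Z X ∘ braid X (tens Y Z) ∘ assoc X Y Z =
    tensm (idm Y) (braid X Z) ∘ assoc Y X Z ∘ tensm (braid X Y) (idm Z);
  braidK : forall X Y, braid Y X ∘ braid X Y = idm (tens X Y)
}.
Arguments tens {C _} _ _.
Arguments tensm {C _ X X' Y Y'} _ _.
Arguments munit {C _}.
Arguments assoc {C _} _ _ _.
Arguments assocV {C _} _ _ _.
Arguments lunit {C _} _.
Arguments runit {C _} _.
Arguments braid {C _} _ _.

(* The triangle identities are precomposed with a unitor, so that no inverse of
   a unitor is needed. *)
Definition has_dual (C : Category) (S : SymMonoidal C) (X : C) : Prop :=
  exists (Xd : C) (ev : Hom (tens (s:=S) Xd X) munit)
         (coev : Hom munit (tens (s:=S) X Xd)),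
    runit X ∘ tensm (idm X) ev ∘ assoc X Xd X ∘ tensm coev (idm X) = lunit X /\
    lunit Xd ∘ tensm ev (idm Xd) ∘ assocV Xd X Xd ∘ tensm (idm Xd) coev = runit Xd.

Record StrongSymMonoidal (C D : Category) (SC : SymMonoidal C)
    (SD : SymMonoidal D) (F : Functor C D) : Type := {
  fmul : forall X Y : C, Hom (tens (s:=SD) (F X) (F Y)) (F (tens (s:=SC) X Y));
  funit : Hom (munit (s:=SD)) (F (munit (s:=SC)));
  fmul_iso : forall X Y, is_iso (fmul X Y);
  funit_iso : is_iso funit;
  fmul_nat : forall X X' Y Y' (f : Hom X X') (g : Hom Y Y'),
    fmul X' Y' ∘ tensm (fmap F f) (fmap F g) = fmap F (tensm f g) ∘ fmul X Y;
  fmul_assoc : forall X Y Z,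
    fmap F (assoc X Y Z) ∘ fmul (tens X Y) Z ∘ tensm (fmul X Y) (idm (F Z)) =
    fmul X (tens Y Z) ∘ tensm (idm (F X)) (fmul Y Z) ∘ assoc (F X) (F Y) (F Z);
  fmul_lunit : forall X,
    fmap F (lunit X) ∘ fmul munit X ∘ tensm funit (idm (F X)) = lunit (F X);
  fmul_runit : forall X,
    fmap F (runit X) ∘ fmul X munit ∘ tensm (idm (F X)) funit = runit (F X);
  fmul_braid : forall X Y,
    fmap F (braid X Y) ∘ fmul X Y = fmul Y X ∘ braid (F X) (F Y)
}.

Record LinearCategory (R : comPzRingType) : Type := {
  lob : Type;
  lhom : lob -> lob -> lmodType R;
  lidm : forall X, lhom X X;
  lccomp : forall X Y Z, lhom Y Z -> lhom X Y -> lhom X Z;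
  lccomp1m : forall X Y (f : lhom X Y), lccomp (lidm Y) f = f;
  lccompm1 : forall X Y (f : lhom X Y), lccomp f (lidm X) = f;
  lccompA : forall X Y Z W (h : lhom Z W) (g : lhom Y Z) (f : lhom X Y),
    lccomp h (lccomp g f) = lccomp (lccomp h g) f;
  lccomp_linearl : forall X Y Z (f : lhom X Y),
    linear (fun g : lhom Y Z => lccomp g f);
  lccomp_linearr : forall X Y Z (g : lhom Y Z),
    linear (fun f : lhom X Y => lccomp g f)
}.
Arguments lhom {R _} _ _.
Arguments lidm {R _} _.
Arguments lccomp {R _ _ _ _} _ _.
Notation "g ∙ f" := (lccomp g f) (at level 40, left associativity) : cat_scope.

Definition category_of (R : comPzRingType) (A : LinearCategory R) : Category :=
  {| ccomp1m := @lccomp1m R A; ccompm1 := @lccompm1 R A;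
     ccompA := @lccompA R A |}.
Coercion category_of : LinearCategory >-> Category.

Section Linear.
Variables (R : comPzRingType) (A : LinearCategory R).
Implicit Types X Y Z K Q : A.

Definition zero_object Z : Prop :=
  (forall X (f : lhom X Z), f = 0) /\ (forall X (f : lhom Z X), f = 0).

Definition is_biproduct X Y P (i1 : lhom X P) (i2 : lhom Y P)
    (p1 : lhom P X) (p2 : lhom P Y) : Prop :=
  [/\ p1 ∙ i1 = lidm X, p2 ∙ i2 = lidm Y, p2 ∙ i1 = 0,
      p1 ∙ i2 = 0 &
      i1 ∙ p1 + i2 ∙ p2 = lidm P].

Definition is_kernel K X Y (k : lhom K X) (f : lhom X Y) : Prop :=
  f ∙ k = 0 /\
  forall T (t : lhom T X), f ∙ t = 0 ->
    exists! u : lhom T K, k ∙ u = t.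

Definition is_cokernel X Y Q (q : lhom Y Q) (f : lhom X Y) : Prop :=
  q ∙ f = 0 /\
  forall T (t : lhom Y T), t ∙ f = 0 ->
    exists! u : lhom Q T, u ∙ q = t.

Record abelian : Prop := {
  ab_zero : exists Z, zero_object Z;
  ab_biproduct : forall X Y, exists P (i1 : lhom X P) (i2 : lhom Y P)
    (p1 : lhom P X) (p2 : lhom P Y), is_biproduct i1 i2 p1 p2;
  ab_kernel : forall X Y (f : lhom X Y), exists K (k : lhom K X), is_kernel k f;
  ab_cokernel : forall X Y (f : lhom X Y), exists Q (q : lhom Y Q), is_cokernel q f;
  ab_monic : forall X Y (f : lhom X Y), monic (C := A) f ->
    exists Z (g : lhom Y Z), is_kernel f g;
  ab_epic : forall X Y (f : lhom X Y), epic (C := A) f ->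
    exists Z (g : lhom Z X), is_cokernel f g
}.

Definition short_exact X Y Z (f : lhom X Y) (g : lhom Y Z) : Prop :=
  is_kernel f g /\ is_cokernel g f.
End Linear.

Definition linear_functor (R : comPzRingType) (A B : LinearCategory R)
    (F : Functor A B) : Prop :=
  forall X Y : A, linear (fmap F : lhom X Y -> lhom (F X) (F Y)).

Definition exact_functor (R : comPzRingType) (A B : LinearCategory R)
    (F : Functor A B) : Prop :=
  forall (X Y Z : A) (f : lhom X Y) (g : lhom Y Z),
    short_exact f g ->
    short_exact (fmap F f : lhom (F X) (F Y)) (fmap F g : lhom (F Y) (F Z)).

(* A symmetric monoidal R-linear category: the tensor product is R-bilinear on
   morphisms. *)
Record TensorCategory (R : comPzRingType) : Type := {
  tcat :> LinearCategory R;
  tmon :> SymMonoidal tcat;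
  tensm_linearl : forall (X X' Y Y' : tcat) (g : lhom Y Y'),
    linear (fun f : lhom X X' =>
      tensm (s := tmon) f g : lhom (tens X Y) (tens X' Y'));
  tensm_linearr : forall (X X' Y Y' : tcat) (f : lhom X X'),
    linear (fun g : lhom Y Y' =>
      tensm (s := tmon) f g : lhom (tens X Y) (tens X' Y'))
}.

Section TensorLaws.
Variable B : comPzRingType.
Implicit Types M N P Q S : lmodType B.

Lemma linext_pure M N P (f g : {linear tensor M N -> P}) :
  (forall m n, f (pure m n) = g (pure m n)) -> f = g.
Proof.
move=> e; apply: linext; elim/tens_ind => // [|x y ex ey].
  by rewrite !linear0.
by rewrite !linearD ex ey.
Qed.

Lemma linext_pure3 M N P Q (f g : {linear tensor (tensor M N) P -> Q}) :
  (forall m n p, f (pure (pure m n) p) = g (pure (pure m n) p)) -> f = g.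
Proof.
move=> e; apply: linext_pure; elim/tens_ind => [p|//|x y ex ey p].
  by rewrite pure0l !linear0.
by rewrite pureDl !linearD ex ey.
Qed.

Lemma linext_pure4 M N P Q S
    (f g : {linear tensor (tensor (tensor M N) P) Q -> S}) :
  (forall m n p q, f (pure (pure (pure m n) p) q) =
                   g (pure (pure (pure m n) p) q)) -> f = g.
Proof.
move=> e; apply: linext_pure3; elim/tens_ind => [p q|//|x y ex ey p q].
  by rewrite !pure0l !linear0.
by rewrite !pureDl !linearD ex ey.
Qed.

Lemma tmap1 M N : tmap (lid M) (lid N) = lid (tensor M N).
Proof. by apply: linext_pure => m n; rewrite tmapE. Qed.
Lemma tmapD M M' M'' N N' N'' (f' : {linear M' -> M''}) (f : {linear M -> M'})
    (g' : {linear N' -> N''}) (g : {linear N -> N'}) :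
  tmap (lcomp f' f) (lcomp g' g) = lcomp (tmap f' g') (tmap f g).
Proof. by apply: linext_pure => m n; rewrite /= !tmapE. Qed.
Lemma tassocK M N P : lcomp (tassocV M N P) (tassoc M N P) = lid _.
Proof. by apply: linext_pure3 => m n p; rewrite /= tassocE tassocVE. Qed.
Lemma tassocVK M N P : lcomp (tassoc M N P) (tassocV M N P) = lid _.
Proof.
apply: linext_pure => m; elim/tens_ind => [|n p|x y ex ey].
- by rewrite pure0r !linear0.
- by rewrite /= tassocVE tassocE.
- by rewrite pureDr !linearD ex ey.
Qed.
Lemma tlunitK M : lcomp (tlunitV M) (tlunit M) = lid _.
Proof.
by apply: linext_pure => a m; rewrite /= tlunitE pureZr -pureZl /GRing.scale /= mulr1.
Qed.
Lemma tlunitVK M : lcomp (tlunit M) (tlunitV M) = lid _.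
Proof. by apply: linext => m; rewrite /= tlunitE scale1r. Qed.
Lemma tswapK M N : lcomp (tswap N M) (tswap M N) = lid _.
Proof. by apply: linext_pure => m n; rewrite /= !tswapE. Qed.
Lemma trunitK M : lcomp (trunitV M) (trunit M) = lid _.
Proof.
apply: linext_pure => m a.
by rewrite /= trunitE tswapE pureZl -pureZr /GRing.scale /= mulr1.
Qed.
Lemma trunitVK M : lcomp (trunit M) (trunitV M) = lid _.
Proof. by apply: linext => m; rewrite /= tswapE trunitE scale1r. Qed.
Lemma tassoc_nat M M' N N' P P' (f : {linear M -> M'}) (g : {linear N -> N'})
    (h : {linear P -> P'}) :
  lcomp (tassoc M' N' P') (tmap (tmap f g) h) =
  lcomp (tmap f (tmap g h)) (tassoc M N P).
Proof. by apply: linext_pure3 => m n p; rewrite /= !(tassocE, tmapE). Qed.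
Lemma tlunit_nat M M' (f : {linear M -> M'}) :
  lcomp (tlunit M') (tmap (lid (regmod B)) f) = lcomp f (tlunit M).
Proof. by apply: linext_pure => a m; rewrite /= tmapE !tlunitE linearZ. Qed.
Lemma trunit_nat M M' (f : {linear M -> M'}) :
  lcomp (trunit M') (tmap f (lid (regmod B))) = lcomp f (trunit M).
Proof.
by apply: linext_pure => m a; rewrite /= tmapE !trunitE linearZ.
Qed.
Lemma tswap_nat M M' N N' (f : {linear M -> M'}) (g : {linear N -> N'}) :
  lcomp (tswap M' N') (tmap f g) = lcomp (tmap g f) (tswap M N).
Proof. by apply: linext_pure => m n; rewrite /= !(tmapE, tswapE). Qed.
Lemma tpentagon M N P Q :
  lcomp (tassoc M N (tensor P Q)) (tassoc (tensor M N) P Q) =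
  lcomp (lcomp (tmap (lid M) (tassoc N P Q)) (tassoc M (tensor N P) Q))
    (tmap (tassoc M N P) (lid Q)).
Proof. by apply: linext_pure4 => m n p q; rewrite /= !(tassocE, tmapE). Qed.
Lemma ttriangle M N :
  lcomp (tmap (lid M) (tlunit N)) (tassoc M (regmod B) N) = tmap (trunit M) (lid N).
Proof.
apply: linext_pure3 => m a n.
by rewrite /= !(tassocE, tmapE) tlunitE trunitE pureZl pureZr.
Qed.
Lemma thexagon M N P :
  lcomp (lcomp (tassoc N P M) (tswap M (tensor N P))) (tassoc M N P) =
  lcomp (lcomp (tmap (lid N) (tswap M P)) (tassoc N M P))
    (tmap (tswap M N) (lid P)).
Proof. by apply: linext_pure3 => m n p; rewrite /= !(tassocE, tmapE, tswapE). Qed.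

End TensorLaws.

Section Mod.
Variables (R B : comPzRingType) (phi : {rmorphism R -> B}).

Program Definition ModLin : LinearCategory R :=
  {| lob := lmodType B; lhom := fun M N => linhom phi M N;
     lidm := fun M => @lid B M;
     lccomp := fun M N P g f => @lcomp B M N P g f |}.
Next Obligation. exact: linext. Qed.
Next Obligation. exact: linext. Qed.
Next Obligation. exact: linext. Qed.
Next Obligation. by move=> a g h; apply: linext => x. Qed.
Next Obligation.
by move=> a f h; apply: linext => x /=; rewrite linearD linearZ.
Qed.

Program Definition ModMon : SymMonoidal ModLin :=
  {| tens := fun M N : lmodType B => tensor M N : lmodType B;
     tensm := fun M M' N N' f g => @tmap B M M' N N' f g;
     munit := regmod B;
     assoc := @tassoc B; assocV := @tassocV B;
     lunit := @tlunit B; runit := @trunit B; braid := @tswap B |}.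
Next Obligation. exact: tmap1. Qed.
Next Obligation. exact: tmapD. Qed.
Next Obligation. exact: tassocK. Qed.
Next Obligation. exact: tassocVK. Qed.
Next Obligation. by exists (tlunitV X); split; [exact: tlunitK|exact: tlunitVK]. Qed.
Next Obligation. by exists (trunitV X); split; [exact: trunitK|exact: trunitVK]. Qed.
Next Obligation. exact: tassoc_nat. Qed.
Next Obligation. exact: tlunit_nat. Qed.
Next Obligation. exact: trunit_nat. Qed.
Next Obligation. exact: tswap_nat. Qed.
Next Obligation. exact: tpentagon. Qed.
Next Obligation. exact: ttriangle. Qed.
Next Obligation. exact: thexagon. Qed.
Next Obligation. exact: tswapK. Qed.

Program Definition Mod : TensorCategory R := {| tcat := ModLin; tmon := ModMon |}.
Next Obligation.
move=> a f h; apply: linext_pure => m n.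
by rewrite /= /hfun !tmapE /= /hfun pureDl pureZl.
Qed.
Next Obligation.
move=> a g h; apply: linext_pure => m n.
by rewrite /= /hfun !tmapE /= /hfun pureDr pureZr.
Qed.

End Mod.

Record FiberFunctor (R B : comPzRingType) (phi : {rmorphism R -> B})
    (A : TensorCategory R) : Type := {
  ff_fun :> Functor A (Mod phi);
  ff_linear : linear_functor ff_fun;
  ff_monoidal : StrongSymMonoidal A (Mod phi) ff_fun;
  ff_faithful : faithful ff_fun;
  ff_exact : exact_functor ff_fun
}.

Definition NeutralFiberFunctor (R : comPzRingType) (A : TensorCategory R) : Type :=
  FiberFunctor (idfun : {rmorphism R -> R}) A.

Record weakly_Tannakian (R : comPzRingType) (A : TensorCategory R) : Prop := {
  wT_small : essentially_small A;
  wT_abelian : abelian A;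
  wT_fiber : exists (B : comPzRingType) (phi : {rmorphism R -> B}),
    inhabited (FiberFunctor phi A);
  wT_dual : forall X : A, exists (X' : A) (p : lhom X' X),
    epic (C := A) p /\ has_dual A X'
}.

Section Algmod.
Variables (R G : comPzRingType) (eta : {rmorphism R -> G}).
Definition algmod_carrier : Type := let _ := eta in G.
HB.instance Definition _ := GRing.Zmodule.on algmod_carrier.
Definition amscale (a : R) (x : algmod_carrier) : algmod_carrier := eta a * (x : G).
Lemma amscaleA a b x : amscale a (amscale b x) = amscale (a * b) x.
Proof. by rewrite /amscale rmorphM mulrA. Qed.
Lemma amscale1 : left_id 1 amscale.
Proof. by move=> x; rewrite /amscale rmorph1 mul1r. Qed.
Lemma amscaleDr : right_distributive amscale +%R.
Proof. by move=> a x y; exact: mulrDr. Qed.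
Lemma amscaleDl x : {morph amscale^~ x : a b / a + b}.
Proof. by move=> a b; rewrite /amscale rmorphD; exact: mulrDl. Qed.
HB.instance Definition _ :=
  GRing.Zmodule_isLmodule.Build R algmod_carrier amscaleA amscale1 amscaleDr amscaleDl.

(* The R-algebra eta : R -> G, seen as an R-module. *)
Definition algmod : lmodType R := GRing.Lmodule.clone R algmod_carrier _.

Lemma amul_bil : bilinear_map (fun x y : algmod => (x : G) * (y : G) : algmod).
Proof.
split=> x a y z; rewrite [in RHS]/GRing.scale /= /amscale.
  by rewrite [LHS]mulrDl mulrA.
by rewrite [LHS]mulrDr mulrCA.
Qed.
Definition amul : {linear tensor algmod algmod -> algmod} := tlift amul_bil.
Lemma amulE (x y : algmod) : amul (pure x y) = (x : G) * (y : G) :> algmod.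
Proof. exact: (tliftE amul_bil x y). Qed.
End Algmod.

(* The commutative Hopf R-algebra of functions on an affine group scheme over R.
   [tmap mul mul \o tmid] is the product of the algebra H (x) H, so that the
   comultiplication and the counit are morphisms of R-algebras. *)
Record HopfAlgebra (R : comPzRingType) : Type := {
  hring : comPzRingType;
  hstruct : {rmorphism R -> hring};
  hmod : lmodType R := algmod hstruct;
  hcomul : {linear hmod -> tensor hmod hmod};
  hcounit : {linear hmod -> regmod R};
  hantipode : {linear hmod -> hmod};
  hcoassoc :
    lcomp (tassoc hmod hmod hmod) (lcomp (tmap hcomul (lid hmod)) hcomul) =
    lcomp (tmap (lid hmod) hcomul) hcomul;
  hcounitl : lcomp (tlunit hmod) (lcomp (tmap hcounit (lid hmod)) hcomul) = lid hmod;
  hcounitr : lcomp (trunit hmod) (lcomp (tmap (lid hmod) hcounit) hcomul) = lid hmod;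
  hcomul1 : hcomul (1 : hring) = @pure R hmod hmod (1 : hring) (1 : hring);
  hcomulM : forall x y : hring,
    hcomul (x * y) =
    tmap (amul hstruct) (amul hstruct)
      (tmid hmod hmod hmod hmod (pure (hcomul x) (hcomul y)));
  hcounit1 : hcounit (1 : hring) = 1;
  hcounitM : forall x y : hring, hcounit (x * y) = hcounit x * hcounit y;
  hantipodel : forall x : hmod,
    amul hstruct (tmap hantipode (lid hmod) (hcomul x)) = hstruct (hcounit x);
  hantipoder : forall x : hmod,
    amul hstruct (tmap (lid hmod) hantipode (hcomul x)) = hstruct (hcounit x)
}.

Definition flat (R : comPzRingType) (F : lmodType R) : Prop :=
  forall (N N' : lmodType R) (f : {linear N -> N'}),
    injective f -> injective (tmap f (lid F)).

Section Comodules.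
Variables (R : comPzRingType) (H : HopfAlgebra R).
Local Notation G := (hmod H).
Local Notation D := (hcomul H).
Local Notation eps := (hcounit H).
Local Notation mul := (amul (hstruct H)).

Let hmul (g h : G) : G := (g : hring H) * (h : hring H).

Let hmulA : associative hmul. Proof. exact: (@mulrA (hring H)). Qed.
Let hmulC : commutative hmul. Proof. exact: (@mulrC (hring H)). Qed.
Let hmul1 : left_id (1 : hring H) hmul. Proof. exact: (@mul1r (hring H)). Qed.

(* Right comodules, that is, representations of the group scheme. *)
Record comodule : Type := {
  cmod :> lmodType R;
  coact : {linear cmod -> tensor cmod G};
  coact_assoc :
    lcomp (tassoc cmod G G) (lcomp (tmap coact (lid G)) coact) =
    lcomp (tmap (lid cmod) D) coact;
  coact_counit : lcomp (trunit cmod) (lcomp (tmap (lid cmod) eps) coact) = lid cmod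
}.

Section ComoduleMaps.
Variables M N : comodule.
Local Notation hom := (linhom (idfun : {rmorphism R -> R}) M N).

Definition is_comodule_map (f : hom) : Prop :=
  lcomp (coact N) f = lcomp (tmap f (lid G)) (coact M).

Definition comodule_map_pred : {pred hom} := fun f => `[< is_comodule_map f >].

Lemma comodule_map_submod : submod_closed comodule_map_pred.
Proof.
split=> [|a f g /asboolP fM /asboolP gM]; apply/asboolP; apply: linext => x /=.
  elim/tens_ind: (coact M x) => [|m h|u v eu ev]; rewrite ?linear0 ?linearD //.
    by rewrite tmapE pure0l.
  by rewrite -eu -ev linear0 addr0.
have {}fM := congr1 (fun u : {linear _ -> _} => u x) fM.
have {}gM := congr1 (fun u : {linear _ -> _} => u x) gM.
rewrite /= in fM gM; rewrite linearD linearZ /= /hfun fM gM.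
elim/tens_ind: (coact M x) => [|m h|u v eu ev].
- by rewrite !linear0 addr0.
- by rewrite !tmapE pureDl pureZl.
- by rewrite !linearD addrACA eu ev.
Qed.
HB.instance Definition _ :=
  GRing.isSubmodClosed.Build R hom comodule_map_pred comodule_map_submod.

Record comodule_map : Type :=
  ComoduleMap { cmap :> hom; cmapP : cmap \in comodule_map_pred }.
HB.instance Definition _ := [isSub for cmap].
HB.instance Definition _ := [Choice of comodule_map by <:].
HB.instance Definition _ := [SubChoice_isSubLmodule of comodule_map by <:].
End ComoduleMaps.

Lemma cmapE (M N : comodule) (f : comodule_map M N) x :
  coact N ((cmap f : {linear _ -> _}) x) = tmap (cmap f) (lid G) (coact M x).
Proof.
by have /asboolP /(congr1 (fun u : {linear _ -> _} => u x)) := cmapP f.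
Qed.

Lemma cmap_inj (M N : comodule) (f g : comodule_map M N) :
  cmap f = cmap g -> f = g.
Proof. exact: val_inj. Qed.

Lemma mkcmap_subproof (M N : comodule) (f : {linear M -> N}) :
  lcomp (coact N) f = lcomp (tmap f (lid G)) (coact M) ->
  (f : linhom idfun M N) \in @comodule_map_pred M N.
Proof. by move=> fM; apply/asboolP. Qed.
Definition mkcmap (M N : comodule) (f : {linear M -> N})
    (fM : lcomp (coact N) f = lcomp (tmap f (lid G)) (coact M)) :
  comodule_map M N := ComoduleMap (mkcmap_subproof fM).

Lemma cid_subproof (M : comodule) :
  lcomp (coact M) (lid M) = lcomp (tmap (lid M) (lid G)) (coact M).
Proof. by rewrite tmap1; apply: linext. Qed.
Definition cid M := mkcmap (cid_subproof M).

Lemma ccmp_subproof (M N P : comodule) (g : comodule_map N P)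
    (f : comodule_map M N) :
  lcomp (coact P) (lcomp (cmap g) (cmap f)) =
  lcomp (tmap (lcomp (cmap g) (cmap f)) (lid G)) (coact M).
Proof.
apply: linext => x /=; rewrite !cmapE.
elim/tens_ind: (coact M x) => [|m h|u v eu ev].
- by rewrite !linear0.
- by rewrite !tmapE.
- by rewrite !linearD eu ev.
Qed.
Definition ccmp (M N P : comodule) (g : comodule_map N P) (f : comodule_map M N) :
  comodule_map M P := mkcmap (ccmp_subproof g f).

Program Definition RepLin : LinearCategory R :=
  {| lob := comodule; lhom := fun M N => comodule_map M N;
     lidm := cid; lccomp := ccmp |}.
Next Obligation. by apply: cmap_inj; apply: linext. Qed.
Next Obligation. by apply: cmap_inj; apply: linext. Qed.
Next Obligation. by apply: cmap_inj; apply: linext. Qed.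
Next Obligation. by move=> a g h; apply: cmap_inj; apply: linext => x. Qed.
Next Obligation.
move=> a f h; apply: cmap_inj; apply: linext => x /=.
by rewrite linearD linearZ.
Qed.

Definition cojoin (M N : lmodType R) :
  {linear tensor (tensor M G) (tensor N G) -> tensor (tensor M N) G} :=
  lcomp (tmap (lid (tensor M N)) mul) (tmid M G N G).
Lemma cojoinE (M N : lmodType R) (m : M) (n : N) (g h : G) :
  cojoin M N (pure (pure m g) (pure n h)) =
  pure (pure m n) (hmul g h).
Proof. by rewrite /cojoin lcompE tmidE tmapE amulE. Qed.

Lemma tens_coact_bil (M N : comodule) :
  bilinear_map (fun m n => cojoin M N (pure (coact M m) (coact N n))).
Proof.
by split=> ? a x y; rewrite linearP (pureDl, pureDr) (pureZl, pureZr) linearP.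
Qed.
Definition tens_coact (M N : comodule) :
  {linear tensor M N -> tensor (tensor M N) G} := tlift (tens_coact_bil M N).
Lemma tens_coactE (M N : comodule) m n :
  tens_coact M N (pure m n) = cojoin M N (pure (coact M m) (coact N n)).
Proof. exact: tliftE. Qed.

Local Definition lin0 := (linear0, pure0l, pure0r).
Local Definition linD := (linearD, pureDl, pureDr).

Section TensorComodule.
Variables M N : comodule.

Let K (u : tensor (tensor M G) G) (v : tensor (tensor N G) G) :=
  tmap (cojoin M N) (lid G) (cojoin (tensor M G) (tensor N G) (pure u v)).

Lemma tens_coact_step1 x y :
  tmap (tens_coact M N) (lid G) (cojoin M N (pure x y)) =
  K (tmap (coact M) (lid G) x) (tmap (coact N) (lid G) y).
Proof.
elim/tens_ind: x => [|m g|u v eu ev]; first by rewrite /K !lin0.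
  elim/tens_ind: y => [|n h|u v eu ev]; first by rewrite /K !lin0.
    by rewrite cojoinE /K !tmapE !lidE cojoinE tmapE tens_coactE.
  by move: eu ev; rewrite /K !linD => -> ->.
by move: eu ev; rewrite /K !linD => -> ->.
Qed.

Lemma tens_coact_step2 m n (d e : tensor G G) :
  tassoc (tensor M N) G G
    (K (tassocV M G G (pure m d)) (tassocV N G G (pure n e))) =
  pure (pure m n) (tmap mul mul (tmid G G G G (pure d e))).
Proof.
elim/tens_ind: d => [|d1 d2|u v eu ev]; first by rewrite /K !lin0.
  elim/tens_ind: e => [|e1 e2|u v eu ev]; first by rewrite /K !lin0.
    by rewrite /K !tassocVE cojoinE tmapE cojoinE tassocE tmidE tmapE !amulE.
  by move: eu ev; rewrite /K !linD => -> ->.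
by move: eu ev; rewrite /K !linD => -> ->.
Qed.

Lemma tens_coact_step3 x y :
  tassoc (tensor M N) G G
    (K (tassocV M G G (tmap (lid M) D x)) (tassocV N G G (tmap (lid N) D y))) =
  tmap (lid (tensor M N)) D (cojoin M N (pure x y)).
Proof.
elim/tens_ind: x => [|m g|u v eu ev]; first by rewrite /K !lin0.
  elim/tens_ind: y => [|n h|u v eu ev]; first by rewrite /K !lin0.
    by rewrite !tmapE tens_coact_step2 cojoinE tmapE hcomulM.
  by move: eu ev; rewrite /K !linD => -> ->.
by move: eu ev; rewrite /K !linD => -> ->.
Qed.

Lemma coactA (P : comodule) p :
  tmap (coact P) (lid G) (coact P p) =
  tassocV P G G (tmap (lid P) D (coact P p)).
Proof.
have := congr1 (fun u : {linear _ -> _} => u p) (coact_assoc P).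
rewrite !lcompE => <-.
by have := congr1 (fun u : {linear _ -> _} => u (tmap (coact P) (lid G) (coact P p)))
  (tassocK P G G); rewrite lcompE => ->.
Qed.

Lemma coact1 (P : comodule) p :
  trunit P (tmap (lid P) eps (coact P p)) = p.
Proof.
by have := congr1 (fun u : {linear _ -> _} => u p) (coact_counit P).
Qed.

Lemma tens_coact_assoc :
  lcomp (tassoc (tensor M N) G G)
    (lcomp (tmap (tens_coact M N) (lid G)) (tens_coact M N)) =
  lcomp (tmap (lid (tensor M N)) D) (tens_coact M N).
Proof.
apply: linext_pure => m n.
by rewrite !lcompE tens_coactE tens_coact_step1 !coactA tens_coact_step3.
Qed.

Lemma tens_coact_step4 x y :
  trunit (tensor M N) (tmap (lid (tensor M N)) eps (cojoin M N (pure x y))) =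
  pure (trunit M (tmap (lid M) eps x)) (trunit N (tmap (lid N) eps y)).
Proof.
elim/tens_ind: x => [|m g|u v eu ev]; first by rewrite !lin0.
  elim/tens_ind: y => [|n h|u v eu ev]; first by rewrite !lin0.
    by rewrite cojoinE !tmapE !trunitE hcounitM pureZl pureZr scalerA.
  by move: eu ev; rewrite !linD => -> ->.
by move: eu ev; rewrite !linD => -> ->.
Qed.

Lemma tens_coact_counit :
  lcomp (trunit (tensor M N))
    (lcomp (tmap (lid (tensor M N)) eps) (tens_coact M N)) = lid (tensor M N).
Proof.
apply: linext_pure => m n.
by rewrite !lcompE tens_coactE tens_coact_step4 !coact1.
Qed.

Definition tens_comodule : comodule :=
  {| coact_assoc := tens_coact_assoc; coact_counit := tens_coact_counit |}.
End TensorComodule.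

Lemma tens_comoduleE (M N : comodule) m n :
  coact (tens_comodule M N) (pure m n) = cojoin M N (pure (coact M m) (coact N n)).
Proof. exact: tens_coactE. Qed.

Lemma unit_coact_linear : linear (fun a : regmod R => @pure R (regmod R) G a (1 : hring H)).
Proof. by move=> a x y; rewrite pureDl pureZl. Qed.
Definition unit_coact : {linear regmod R -> tensor (regmod R) G} := mklin unit_coact_linear.
Lemma unit_coact_assoc :
  lcomp (tassoc (regmod R) G G) (lcomp (tmap unit_coact (lid G)) unit_coact) =
  lcomp (tmap (lid (regmod R)) D) unit_coact.
Proof.
by apply: linext => a; rewrite /= !tmapE /= tassocE hcomul1.
Qed.
Lemma unit_coact_counit :
  lcomp (trunit (regmod R)) (lcomp (tmap (lid (regmod R)) eps) unit_coact) = lid (regmod R).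
Proof.
by apply: linext => a; rewrite !lcompE [unit_coact _]/= tmapE trunitE hcounit1 scale1r.
Qed.
Definition unit_comodule : comodule :=
  {| coact_assoc := unit_coact_assoc; coact_counit := unit_coact_counit |}.

Lemma cojoin_nat (M M' N N' : lmodType R) (f : {linear M -> M'})
    (g : {linear N -> N'}) x y :
  cojoin M' N' (pure (tmap f (lid G) x) (tmap g (lid G) y)) =
  tmap (tmap f g) (lid G) (cojoin M N (pure x y)).
Proof.
elim/tens_ind: x => [|m a|u v eu ev]; first by rewrite !lin0.
  elim/tens_ind: y => [|n b|u v eu ev]; first by rewrite !lin0.
    by rewrite !tmapE !cojoinE !tmapE.
  by move: eu ev; rewrite !linD => -> ->.
by move: eu ev; rewrite !linD => -> ->.
Qed.

Lemma tensm_comod (M M' N N' : comodule) (f : comodule_map M M')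
    (g : comodule_map N N') :
  lcomp (coact (tens_comodule M' N')) (tmap (cmap f) (cmap g)) =
  lcomp (tmap (tmap (cmap f) (cmap g)) (lid G)) (coact (tens_comodule M N)).
Proof.
apply: linext_pure => m n.
by rewrite !lcompE tmapE !tens_comoduleE !cmapE cojoin_nat.
Qed.

Lemma cojoinA (M N P : lmodType R) x y z :
  tmap (tassoc M N P) (lid G) (cojoin (tensor M N) P (pure (cojoin M N (pure x y)) z)) =
  cojoin M (tensor N P) (pure x (cojoin N P (pure y z))).
Proof.
elim/tens_ind: x => [|m a|u v eu ev]; first by rewrite !lin0.
  elim/tens_ind: y => [|n b|u v eu ev]; first by rewrite !lin0.
    elim/tens_ind: z => [|p c|u v eu ev]; first by rewrite !lin0.
      by rewrite !cojoinE tmapE tassocE lidE hmulA.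
    by move: eu ev; rewrite !linD => -> ->.
  by move: eu ev; rewrite !linD => -> ->.
by move: eu ev; rewrite !linD => -> ->.
Qed.

Lemma assoc_comod (M N P : comodule) :
  lcomp (coact (tens_comodule M (tens_comodule N P))) (tassoc M N P) =
  lcomp (tmap (tassoc M N P) (lid G))
    (coact (tens_comodule (tens_comodule M N) P)).
Proof.
apply: linext_pure3 => m n p.
by rewrite !lcompE tassocE !tens_comoduleE cojoinA.
Qed.

Lemma transport_comod (M N : comodule) (f : {linear M -> N}) (g : {linear N -> M}) :
  lcomp g f = lid M -> lcomp f g = lid N ->
  lcomp (coact N) f = lcomp (tmap f (lid G)) (coact M) ->
  lcomp (coact M) g = lcomp (tmap g (lid G)) (coact N).
Proof.
move=> gf fg fM; apply: linext => x; rewrite !lcompE.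
have fgx : f (g x) = x by rewrite -lcompE fg.
rewrite -[in RHS]fgx.
have := congr1 (fun u : {linear _ -> _} => u (g x)) fM; rewrite !lcompE => ->.
elim/tens_ind: (coact M (g x)) => [|m h|u v eu ev].
- by rewrite !linear0.
- by rewrite !tmapE -[g _]lcompE gf.
- by rewrite !linearD -eu -ev.
Qed.

Lemma cojoin_unit (M : lmodType R) (a : regmod R) y :
  tmap (tlunit M) (lid G)
    (cojoin (regmod R) M (pure (@pure R (regmod R) G a (1 : hring H)) y)) = a *: y.
Proof.
elim/tens_ind: y => [|n b|u v eu ev]; first by rewrite !lin0.
  by rewrite cojoinE tmapE tlunitE hmul1 lidE pureZl.
by move: eu ev; rewrite !linD => -> ->.
Qed.

Lemma lunit_comod (M : comodule) :
  lcomp (coact M) (tlunit M) =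
  lcomp (tmap (tlunit M) (lid G)) (coact (tens_comodule unit_comodule M)).
Proof.
apply: linext_pure => a m.
by rewrite !lcompE tlunitE tens_comoduleE cojoin_unit linearZ.
Qed.

Lemma cojoinC (M N : lmodType R) x y :
  tmap (tswap M N) (lid G) (cojoin M N (pure x y)) = cojoin N M (pure y x).
Proof.
elim/tens_ind: x => [|m a|u v eu ev]; first by rewrite !lin0.
  elim/tens_ind: y => [|n b|u v eu ev]; first by rewrite !lin0.
    by rewrite !cojoinE tmapE tswapE lidE hmulC.
  by move: eu ev; rewrite !linD => -> ->.
by move: eu ev; rewrite !linD => -> ->.
Qed.

Lemma braid_comod (M N : comodule) :
  lcomp (coact (tens_comodule N M)) (tswap M N) =
  lcomp (tmap (tswap M N) (lid G)) (coact (tens_comodule M N)).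
Proof.
by apply: linext_pure => m n; rewrite !lcompE tswapE !tens_comoduleE cojoinC.
Qed.

Lemma runit_comod (M : comodule) :
  lcomp (coact M) (trunit M) =
  lcomp (tmap (trunit M) (lid G)) (coact (tens_comodule M unit_comodule)).
Proof.
have -> : trunit M = lcomp (tlunit M) (tswap M (regmod R)).
  by apply: linext_pure => m a; rewrite lcompE trunitE tswapE tlunitE.
apply: linext => x.
have b := congr1 (fun u : {linear _ -> _} => u x) (braid_comod M unit_comodule).
have l := congr1 (fun u : {linear _ -> _} => u (tswap M (regmod R) x)) (lunit_comod M).
move: b l; rewrite !lcompE => b ->; rewrite b.
elim/tens_ind: (coact (tens_comodule M unit_comodule) x) => [|m h|u v eu ev]; first by rewrite !lin0.
  by rewrite !tmapE.
by rewrite !linD eu ev.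
Qed.

Local Notation "M ** N" := (tens_comodule M N) (at level 40, left associativity).
Local Notation I1 := unit_comodule.

Definition cassoc (M N P : comodule) : comodule_map (M ** N ** P) (M ** (N ** P)) :=
  @mkcmap (M ** N ** P) (M ** (N ** P)) _ (assoc_comod M N P).
Definition cassocV (M N P : comodule) : comodule_map (M ** (N ** P)) (M ** N ** P) :=
  @mkcmap (M ** (N ** P)) (M ** N ** P) _
    (@transport_comod (M ** N ** P) (M ** (N ** P)) _ _
      (tassocK M N P) (tassocVK M N P) (assoc_comod M N P)).
Definition clunit (M : comodule) : comodule_map (I1 ** M) M :=
  @mkcmap (I1 ** M) M _ (lunit_comod M).
Definition clunitV (M : comodule) : comodule_map M (I1 ** M) :=
  @mkcmap M (I1 ** M) _
    (@transport_comod (I1 ** M) M _ _ (tlunitK M) (tlunitVK M) (lunit_comod M)).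
Definition crunit (M : comodule) : comodule_map (M ** I1) M :=
  @mkcmap (M ** I1) M _ (runit_comod M).
Definition crunitV (M : comodule) : comodule_map M (M ** I1) :=
  @mkcmap M (M ** I1) _
    (@transport_comod (M ** I1) M _ _ (trunitK M) (trunitVK M) (runit_comod M)).
Definition cbraid (M N : comodule) : comodule_map (M ** N) (N ** M) :=
  @mkcmap (M ** N) (N ** M) _ (braid_comod M N).
Definition ctensm (M M' N N' : comodule) (f : comodule_map M M')
    (g : comodule_map N N') : comodule_map (M ** N) (M' ** N') :=
  @mkcmap (M ** N) (M' ** N') _ (tensm_comod f g).

Program Definition RepMon : SymMonoidal RepLin :=
  {| tens := tens_comodule; tensm := ctensm; munit := unit_comodule;
     assoc := cassoc; assocV := cassocV; lunit := clunit; runit := crunit;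
     braid := cbraid |}.
Next Obligation. by apply: cmap_inj; exact: tmap1. Qed.
Next Obligation. by apply: cmap_inj; exact: tmapD. Qed.
Next Obligation. by apply: cmap_inj; exact: tassocK. Qed.
Next Obligation. by apply: cmap_inj; exact: tassocVK. Qed.
Next Obligation.
by exists (clunitV X); split; apply: cmap_inj; [exact: tlunitK|exact: tlunitVK].
Qed.
Next Obligation.
by exists (crunitV X); split; apply: cmap_inj; [exact: trunitK|exact: trunitVK].
Qed.
Next Obligation. by apply: cmap_inj; exact: tassoc_nat. Qed.
Next Obligation. by apply: cmap_inj; exact: tlunit_nat. Qed.
Next Obligation. by apply: cmap_inj; exact: trunit_nat. Qed.
Next Obligation. by apply: cmap_inj; exact: tswap_nat. Qed.
Next Obligation. by apply: cmap_inj; exact: tpentagon. Qed.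
Next Obligation. by apply: cmap_inj; exact: ttriangle. Qed.
Next Obligation. by apply: cmap_inj; exact: thexagon. Qed.
Next Obligation. by apply: cmap_inj; exact: tswapK. Qed.

Program Definition Rep : TensorCategory R := {| tcat := RepLin; tmon := RepMon |}.
Next Obligation.
move=> a f h; apply: cmap_inj; apply: linext_pure => m n.
by rewrite /= /hfun !tmapE /= /hfun pureDl pureZl.
Qed.
Next Obligation.
move=> a g h; apply: cmap_inj; apply: linext_pure => m n.
by rewrite /= /hfun !tmapE /= /hfun pureDr pureZr.
Qed.

End Comodules.

(* There is an equivalence of symmetric monoidal R-linear categories between A
   and the full subcategory of T on the objects satisfying P; the tensor
   structure on that subcategory is the one inherited from T. *)
Definition equivalent_to_full_subcategory (R : comPzRingType)
    (A T : TensorCategory R) (P : T -> Prop) : Prop :=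
  exists F : Functor A (full_subcategory P),
    [/\ is_equivalence F,
        @linear_functor R A T (compF (inclusion P) F) &
        inhabited (StrongSymMonoidal A T (compF (inclusion P) F))].

(* Main.v *)
(** For a module N let H_N be the coend of W X (x) Hom(W X, N) over X in A. As the
    fiber functor W is exact, the category of elements of W is cofiltered, so every
    element of H_N is a single class [X, x, f] with x in W X and f : W X -> N, and
    [X, x, f] = [Y, y, g] if and only if there is a span u : P -> X, v : P -> Y and
    p in W P with u p = x, v p = y and f u = g v. Objects with a dual cover all
    others, so P and X may be taken with a dual; then W X has dual bases, whence
    N (x) H = H_N for H = H_R. Since N |-> H_N clearly preserves injections, H is
    flat; the comultiplication, the product and the antipode come from dual bases,
    from the tensor product and from the duals of A, and each W X is a comodule by
    x |-> [X, x, id]. Comparing classes by spans then shows that A -> Rep H is full,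
    that every comodule is a filtered colimit of objects of A, and hence that the
    finitely presentable comodules are retracts of objects of A. Conversely, objects
    of A are finitely presentable because their underlying modules are, colimits of
    comodules being computed on modules. *)
From HB Require Import structures.
Require Import Defs.
From mathcomp Require Import all_boot all_algebra.
From mathcomp Require Import boolp.

Set Implicit Arguments.
Unset Strict Implicit.
Unset Printing Implicit Defensive.

Import GRing.Theory.
Local Open Scope ring_scope.
Local Open Scope quotient_scope.
Local Open Scope cat_scope.

(** The obstacle is that the vanishing of a tensor in N (x) H cannot be read off its pure summands,
    while comodules are made of such tensors. H_N is designed for this: every element and every
    vanishing has a witness in A, and the isomorphism with N (x) H, natural in N, carries these
    witnesses over to tensors. The formula that does the work is [theta_coact_map]: applying f (x) 1
    to the coaction of x gives the class [X, x, f]. Identities between maps composed with coactions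
    thus become identities of classes, and so hold after some arrow P -> X of A that reaches x. A
    witness serves one element only; since W X is finitely generated, biproducts in A, or upper
    bounds in a filtered diagram, merge finitely many witnesses into one that serves all of W X. *)

(** * Filtered colimits and cokernels of modules *)

(* The transition maps form a class rather than the values of a functor:
   filteredness is only needed up to equality of the maps. *)
Record dsys (R : comPzRingType) : Type := {
  dix : SmallType;
  dmod : dix -> lmodType R;
  dtr : forall i j, {linear dmod i -> dmod j} -> Prop;
  dix0 : dix;
  dtr1 : forall i, dtr (lid (dmod i));
  dtrM : forall i j k (g : {linear dmod j -> dmod k}) (f : {linear dmod i -> dmod j}),
    dtr g -> dtr f -> dtr (lcomp g f);
  dtr_ub : forall i j, exists k (f : {linear dmod i -> dmod k})
    (g : {linear dmod j -> dmod k}), dtr f /\ dtr g;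
  dtr_eq : forall i j (f g : {linear dmod i -> dmod j}), dtr f -> dtr g ->
    exists k (h : {linear dmod j -> dmod k}), dtr h /\ forall x, h (f x) = h (g x)
}.

Section FilteredColimit.
Variables (R : comPzRingType) (D : dsys R).
Local Notation M := (@dmod R D).

Definition dtot : Type := {i : dix D & M i}.
HB.instance Definition _ := gen_eqMixin dtot.
HB.instance Definition _ := gen_choiceMixin dtot.

Definition crel (a b : dtot) : Prop :=
  exists k (f : {linear M (tag a) -> M k}) (g : {linear M (tag b) -> M k}),
    [/\ dtr f, dtr g & f (tagged a) = g (tagged b)].

Lemma dtr_amalg i j k (f : {linear M i -> M j}) (g : {linear M i -> M k}) :
  dtr f -> dtr g ->
  exists l (p : {linear M j -> M l}) (q : {linear M k -> M l}),
    [/\ dtr p, dtr q & forall x, p (f x) = q (g x)].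
Proof.
move=> tf tg; have [l [p [q [tp tq]]]] := dtr_ub j k.
have [m [h [th e]]] := dtr_eq (dtrM tp tf) (dtrM tq tg).
by exists m, (lcomp h p), (lcomp h q); split=> //; exact: dtrM.
Qed.

Definition creqb (a b : dtot) : bool := `[< crel a b >].
Lemma crel_equiv : equiv_class_of creqb.
Proof.
split=> [a|a b|b a c].
- by apply/asboolP; exists (tag a), (lid _), (lid _); split=> //; exact: dtr1.
- by apply/asboolP/asboolP => -[k [f [g [tf tg e]]]]; exists k, g, f.
- move=> /asboolP [k [f [g [tf tg e]]]] /asboolP [k' [f' [g' [tf' tg' e']]]].
  have [l [p [q [tp tq pq]]]] := dtr_amalg tg tf'.
  apply/asboolP; exists l, (lcomp p f), (lcomp q g'); split; try exact: dtrM.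
  by rewrite /= e pq e'.
Qed.
Canonical creqb_equiv := EquivRelPack crel_equiv.

Definition fcarrier : Type := {eq_quot creqb}.
HB.instance Definition _ := Choice.on fcarrier.

Definition fin_fun i (x : M i) : fcarrier :=
  \pi_({eq_quot creqb}) (Tagged M x).

Lemma fin_eq i j (x : M i) (y : M j) : fin_fun x = fin_fun y <->
  exists k (f : {linear M i -> M k}) (g : {linear M j -> M k}),
    [/\ dtr f, dtr g & f x = g y].
Proof. by split=> [/eqmodP/asboolP //|e]; apply/eqmodP/asboolP. Qed.

Lemma fin_fun_tr i j (f : {linear M i -> M j}) x : dtr f -> fin_fun (f x) = fin_fun x.
Proof. by move=> tf; apply/fin_eq; exists j, (lid _), f; split=> //; exact: dtr1. Qed.

Lemma fin_fun_surj (a : fcarrier) : exists i (x : M i), a = fin_fun x.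
Proof.
exists (tag (repr a)), (tagged (repr a)).
by rewrite /fin_fun -[LHS]reprK; case: (repr a).
Qed.

Lemma fin_surj2 (a b : fcarrier) :
  exists i (x y : M i), a = fin_fun x /\ b = fin_fun y.
Proof.
have [i [x ->]] := fin_fun_surj a; have [j [y ->]] := fin_fun_surj b.
have [k [f [g [tf tg]]]] := dtr_ub i j.
by exists k, (f x), (g y); rewrite !fin_fun_tr.
Qed.

Lemma fin_surj3 (a b c : fcarrier) :
  exists i (x y z : M i), [/\ a = fin_fun x, b = fin_fun y & c = fin_fun z].
Proof.
have [i [x [y [-> ->]]]] := fin_surj2 a b; have [j [z ->]] := fin_fun_surj c.
have [k [f [g [tf tg]]]] := dtr_ub i j.
by exists k, (f x), (f y), (g z); rewrite !fin_fun_tr.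
Qed.

Lemma fin_eq1 i (x y : M i) : fin_fun x = fin_fun y ->
  exists k (f : {linear M i -> M k}), dtr f /\ f x = f y.
Proof.
move/fin_eq => [k [f [g [tf tg e]]]].
have [l [h [th hE]]] := dtr_eq tf tg.
by exists l, (lcomp h f); split; [exact: dtrM|rewrite /= e hE].
Qed.

(** Representatives of a and b may live at different stages, so the sum is first a relation over any
    common stage. For uniqueness, two such sums are moved to one stage, then along a map that
    identifies the first summands and one that identifies the second. *)
Definition fadd_rel (a b c : fcarrier) : Prop :=
  exists i (x y : M i), [/\ a = fin_fun x, b = fin_fun y & c = fin_fun (x + y)].

Lemma fadd_ex a b : exists c, fadd_rel a b c.
Proof.
have [i [x [y [-> ->]]]] := fin_surj2 a b.
by exists (fin_fun (x + y)), i, x, y.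
Qed.

Lemma fadd_uniq a b c c' : fadd_rel a b c -> fadd_rel a b c' -> c = c'.
Proof.
move=> [i [x [y [-> -> ->]]]] [j [x' [y' [ex ey ->]]]].
have [k [f [g [tf tg]]]] := dtr_ub i j.
move: ex ey; rewrite -(fin_fun_tr x tf) -(fin_fun_tr y tf) -(fin_fun_tr x' tg)
  -(fin_fun_tr y' tg) -(fin_fun_tr (x + y) tf) -(fin_fun_tr (x' + y') tg).
move=> /fin_eq1 [l [p [tp ep]]]; rewrite -(fin_fun_tr (f y) tp) -(fin_fun_tr (g y') tp).
move=> /fin_eq1 [m [q [tq eq]]].
rewrite -(fin_fun_tr _ (dtrM tq tp)) -[RHS](fin_fun_tr _ (dtrM tq tp)).
by rewrite /= !linearD ep eq.
Qed.

Definition fadd a b := sval (cid (fadd_ex a b)).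
Lemma faddE i (x y : M i) : fadd (fin_fun x) (fin_fun y) = fin_fun (x + y).
Proof.
by apply: fadd_uniq (svalP (cid (fadd_ex _ _))) _; exists i, x, y.
Qed.

Definition fscale r (a : fcarrier) : fcarrier :=
  fin_fun (r *: tagged (repr a)).
Lemma fscaleE r i (x : M i) : fscale r (fin_fun x) = fin_fun (r *: x).
Proof.
rewrite /fscale; case E: (repr _) => [j y] /=.
have /fin_eq [k [f [g [tf tg e]]]] : fin_fun y = fin_fun x.
  by rewrite {1}/fin_fun /Tagged -E reprK.
by apply/fin_eq; exists k, f, g; split=> //; rewrite !linearZ e.
Qed.

Definition fzero : fcarrier := fin_fun (0 : M (dix0 D)).
Lemma fin_fun0 i : fin_fun (0 : M i) = fzero.
Proof.
have [k [f [g [tf tg]]]] := dtr_ub i (dix0 D).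
by apply/fin_eq; exists k, f, g; rewrite !linear0.
Qed.

Lemma fcol_addA : associative fadd.
Proof.
move=> a b c; have [i [x [y [z [-> -> ->]]]]] := fin_surj3 a b c.
by rewrite !faddE addrA.
Qed.
Lemma fcol_addC : commutative fadd.
Proof.
by move=> a b; have [i [x [y [-> ->]]]] := fin_surj2 a b; rewrite !faddE addrC.
Qed.
Lemma fcol_add0 : left_id fzero fadd.
Proof.
by move=> a; have [i [x ->]] := fin_fun_surj a; rewrite -(fin_fun0 i) faddE add0r.
Qed.
Lemma fcol_addN : left_inverse fzero (fscale (-1)) fadd.
Proof.
move=> a; have [i [x ->]] := fin_fun_surj a.
by rewrite fscaleE faddE scaleN1r addNr fin_fun0.
Qed.
Lemma fcol_scaleA r s a : fscale r (fscale s a) = fscale (r * s) a.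
Proof. by have [i [x ->]] := fin_fun_surj a; rewrite !fscaleE scalerA. Qed.
Lemma fcol_scale1 : left_id 1 fscale.
Proof. by move=> a; have [i [x ->]] := fin_fun_surj a; rewrite !fscaleE scale1r. Qed.
Lemma fcol_scaleDr : right_distributive fscale fadd.
Proof.
move=> r a b; have [i [x [y [-> ->]]]] := fin_surj2 a b.
by rewrite !faddE !fscaleE faddE scalerDr.
Qed.
Lemma fcol_scaleDl a : {morph fscale^~ a : r s / r + s >-> fadd r s}.
Proof.
by move=> r s; have [i [x ->]] := fin_fun_surj a; rewrite !fscaleE faddE scalerDl.
Qed.
HB.instance Definition _ :=
  GRing.isZmodule.Build fcarrier fcol_addA fcol_addC fcol_add0 fcol_addN.
HB.instance Definition _ :=
  GRing.Zmodule_isLmodule.Build R fcarrier fcol_scaleA fcol_scale1 fcol_scaleDr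
    fcol_scaleDl.
Definition fcolim : lmodType R := GRing.Lmodule.clone R fcarrier _.

Lemma fin_linear i : linear (@fin_fun i : M i -> fcolim).
Proof.
move=> r x y; rewrite -[in LHS]faddE -fscaleE; by [].
Qed.
Definition fin i : {linear M i -> fcolim} := mklin (@fin_linear i).

Lemma fin_tr i j (f : {linear M i -> M j}) x : dtr f -> fin j (f x) = fin i x.
Proof. exact: fin_fun_tr. Qed.

Lemma fin_surj (a : fcolim) : exists i x, a = fin i x.
Proof. exact: fin_fun_surj. Qed.

Lemma fin_eq0 i x : fin i x = 0 ->
  exists k (f : {linear M i -> M k}), dtr f /\ f x = 0.
Proof.
rewrite -(linear0 (fin i)) => /fin_eq1 [k [f [tf e]]].
by exists k, f; rewrite e linear0.
Qed.

Section Rec.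
Variables (Q : lmodType R) (d : forall i, {linear M i -> Q}).
Hypothesis dE : forall i j (f : {linear M i -> M j}) x, dtr f -> d j (f x) = d i x.

Definition frec_fun (a : fcolim) : Q := d (tag (repr a)) (tagged (repr a)).
Lemma frec_fin i x : frec_fun (fin i x) = d i x.
Proof.
rewrite /frec_fun; case E: (repr _) => [j y] /=.
have /fin_eq [k [f [g [tf tg e]]]] : fin_fun y = fin_fun x.
  by rewrite {1}/fin_fun /Tagged -E reprK.
by rewrite -(dE _ tf) e dE.
Qed.
Lemma frec_linear : linear frec_fun.
Proof.
move=> r a b; have [i [x [y [-> ->]]]] := fin_surj2 a b.
rewrite (_ : r *: _ + _ = fin i (r *: x + y)); last by rewrite [RHS]linearP.
by rewrite -[fin_fun x]/(fin i x) -[fin_fun y]/(fin i y) !frec_fin linearP.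
Qed.
Definition frec : {linear fcolim -> Q} := mklin frec_linear.
Lemma frecE i x : frec (fin i x) = d i x. Proof. exact: frec_fin. Qed.
End Rec.

End FilteredColimit.

Section Cokernel.
Variables (R : comPzRingType) (N M : lmodType R) (f : {linear N -> M}).

Definition cok_eqb (x y : M) : bool := `[< exists n : N, x - y = f n >].
Lemma cok_equiv_class : equiv_class_of cok_eqb.
Proof.
split=> [x|x y|y x z].
- by apply/asboolP; exists 0; rewrite subrr linear0.
- by apply/asboolP/asboolP => -[n e]; exists (- n); rewrite [RHS]linearN -e opprB.
- move=> /asboolP [n e] /asboolP [n' e']; apply/asboolP; exists (n + n').
  by rewrite [RHS]linearD -e -e' addrA subrK.
Qed.
Canonical cok_equiv := EquivRelPack cok_equiv_class.
Definition cok_carrier : Type := {eq_quot cok_eqb}.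
HB.instance Definition _ := Choice.on cok_carrier.

Definition cok_cls (x : M) : cok_carrier := \pi_({eq_quot cok_eqb}) x.
Definition cok_repr (a : cok_carrier) : M := repr a.
Lemma cok_reprK a : cok_cls (cok_repr a) = a. Proof. exact: reprK. Qed.
Lemma cok_clsP x y : cok_cls x = cok_cls y <-> exists n : N, x - y = f n.
Proof. by split=> [/eqmodP/asboolP|h]; [|apply/eqmodP/asboolP]. Qed.

Definition cok_add a b := cok_cls (cok_repr a + cok_repr b).
Definition cok_scale r a := cok_cls (r *: cok_repr a).

Lemma cok_addE x y : cok_add (cok_cls x) (cok_cls y) = cok_cls (x + y).
Proof.
have [n en] := (cok_clsP _ _).1 (cok_reprK (cok_cls x)).
have [m em] := (cok_clsP _ _).1 (cok_reprK (cok_cls y)).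
by apply/cok_clsP; exists (n + m); rewrite [RHS]linearD -en -em opprD addrACA.
Qed.
Lemma cok_scaleE r x : cok_scale r (cok_cls x) = cok_cls (r *: x).
Proof.
have [n en] := (cok_clsP _ _).1 (cok_reprK (cok_cls x)).
by apply/cok_clsP; exists (r *: n); rewrite [RHS]linearZ /= -en scalerBr.
Qed.

Lemma cok_addA : associative cok_add.
Proof.
by move=> a b c; rewrite -(cok_reprK a) -(cok_reprK b) -(cok_reprK c) !cok_addE addrA.
Qed.
Lemma cok_addC : commutative cok_add.
Proof. by move=> a b; rewrite /cok_add addrC. Qed.
Lemma cok_add0 : left_id (cok_cls 0) cok_add.
Proof. by move=> a; rewrite -(cok_reprK a) cok_addE add0r. Qed.
Lemma cok_addN : left_inverse (cok_cls 0) (cok_scale (-1)) cok_add.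
Proof. by move=> a; rewrite -(cok_reprK a) cok_scaleE cok_addE scaleN1r addNr. Qed.
Lemma cok_scaleA r s a : cok_scale r (cok_scale s a) = cok_scale (r * s) a.
Proof. by rewrite -(cok_reprK a) !cok_scaleE scalerA. Qed.
Lemma cok_scale1 : left_id 1 cok_scale.
Proof. by move=> a; rewrite -(cok_reprK a) cok_scaleE scale1r. Qed.
Lemma cok_scaleDr : right_distributive cok_scale cok_add.
Proof.
move=> r a b; rewrite -(cok_reprK a) -(cok_reprK b).
by rewrite !(cok_addE, cok_scaleE) scalerDr.
Qed.
Lemma cok_scaleDl a : {morph cok_scale^~ a : r s / r + s >-> cok_add r s}.
Proof. by move=> r s; rewrite -(cok_reprK a) !cok_scaleE cok_addE scalerDl. Qed.
HB.instance Definition _ :=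
  GRing.isZmodule.Build cok_carrier cok_addA cok_addC cok_add0 cok_addN.
HB.instance Definition _ :=
  GRing.Zmodule_isLmodule.Build R cok_carrier cok_scaleA cok_scale1 cok_scaleDr
    cok_scaleDl.
Definition cok : lmodType R := GRing.Lmodule.clone R cok_carrier _.

Lemma cok_proj_linear : linear (cok_cls : M -> cok).
Proof. by move=> r x y; rewrite -cok_addE -cok_scaleE. Qed.
Definition cok_proj : {linear M -> cok} := mklin cok_proj_linear.

Lemma cok_proj_eq0 x : cok_proj x = 0 <-> exists n : N, x = f n.
Proof.
rewrite -(linear0 cok_proj); split=> [/cok_clsP|e]; first by rewrite subr0.
by apply/cok_clsP; rewrite subr0.
Qed.

(** The projection to the cokernel and the zero map agree on the image of f, hence are equal. *)
Lemma epi_lin_surj :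
  (forall (Q : lmodType R) (g h : {linear M -> Q}), lcomp g f = lcomp h f -> g = h) ->
  forall y, exists x, y = f x.
Proof.
move=> epi y; apply/cok_proj_eq0.
rewrite (epi _ cok_proj (mklin (@hzero_linear R M cok))) //.
by apply: linext => x /=; apply/cok_proj_eq0; exists x.
Qed.

End Cokernel.

(** * Abelian categories *)

Section AbelianLemmas.
Variables (R : comPzRingType) (A : LinearCategory R) (ab : abelian A).
Implicit Types X Y Z : A.

Lemma lcompDl X Y Z (g h : lhom Y Z) (f : lhom X Y) : (g + h) ∙ f = g ∙ f + h ∙ f.
Proof. by rewrite -[g]scale1r (lccomp_linearl f) !scale1r. Qed.
Lemma lcompDr X Y Z (f : lhom Y Z) (g h : lhom X Y) : f ∙ (g + h) = f ∙ g + f ∙ h.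
Proof. by rewrite -[g]scale1r (lccomp_linearr f) !scale1r. Qed.
Lemma lcomp0l X Y Z (f : lhom X Y) : (0 : lhom Y Z) ∙ f = 0.
Proof. by apply: (addrI (0 ∙ f)); rewrite -lcompDl !addr0. Qed.
Lemma lcomp0r X Y Z (f : lhom Y Z) : f ∙ (0 : lhom X Y) = 0.
Proof. by apply: (addrI (f ∙ 0)); rewrite -lcompDr !addr0. Qed.
Lemma lcompBl X Y Z (g h : lhom Y Z) (f : lhom X Y) : (g - h) ∙ f = g ∙ f - h ∙ f.
Proof. by apply: (addIr (h ∙ f)); rewrite -lcompDl !subrK. Qed.
Lemma lcompBr X Y Z (f : lhom Y Z) (g h : lhom X Y) : f ∙ (g - h) = f ∙ g - f ∙ h.
Proof. by apply: (addIr (f ∙ h)); rewrite -lcompDr !subrK. Qed.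

Lemma epic0 X Y (f : lhom X Y) :
  (forall Z (t : lhom Y Z), t ∙ f = 0 -> t = 0) -> epic (C := A) f.
Proof.
by move=> h Z s t e; apply/subr0_eq/h; rewrite lcompBl [X in X - _]e subrr.
Qed.
Lemma monic0 X Y (f : lhom X Y) :
  (forall Z (t : lhom Z X), f ∙ t = 0 -> t = 0) -> Defs.monic (C := A) f.
Proof.
by move=> h Z s t e; apply/subr0_eq/h; rewrite lcompBr [X in X - _]e subrr.
Qed.

Lemma cokernel_epic X Y Q (q : lhom Y Q) (f : lhom X Y) :
  is_cokernel q f -> epic (C := A) q.
Proof.
move=> [qf0 u]; apply: epic0 => Z t tq0.
have [v [_ uniq]] := u Z 0 (lcomp0l _ _).
by rewrite -(uniq t tq0); exact/uniq/lcomp0l.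
Qed.
Lemma kernel_monic K X Y (k : lhom K X) (f : lhom X Y) :
  is_kernel k f -> Defs.monic (C := A) k.
Proof.
move=> [fk0 u]; apply: monic0 => Z t kt0.
have [v [_ uniq]] := u Z 0 (lcomp0r _ _).
by rewrite -(uniq t kt0); exact/uniq/lcomp0r.
Qed.

Lemma epic_comp X Y Z (g : lhom Y Z) (f : lhom X Y) :
  epic (C := A) g -> epic (C := A) f -> epic (C := A) (g ∙ f).
Proof.
by move=> eg ef W s t; rewrite /= !lccompA => /ef /eg.
Qed.
Lemma monic_comp X Y Z (g : lhom Y Z) (f : lhom X Y) :
  Defs.monic (C := A) g -> Defs.monic (C := A) f -> Defs.monic (C := A) (g ∙ f).
Proof.
by move=> mg mf W s t; rewrite /= -!lccompA => /mg /mf.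
Qed.

(* If m kills t and q = coker t, then the epimorphism q e is the cokernel of
   some g; as g factors through k, e factors through q e, so q is split monic. *)
Lemma coimage_monic X Y K Q (f : lhom X Y) (k : lhom K X) (e : lhom X Q)
    (m : lhom Q Y) :
  is_kernel k f -> is_cokernel e k -> m ∙ e = f -> Defs.monic (C := A) m.
Proof.
move=> [fk0 uk] ce mE; have ee := cokernel_epic ce.
apply: monic0 => T t mt0.
have [Q' [q [qt0 uq]]] := ab_cokernel ab t.
have eq : epic (C := A) q by apply: (cokernel_epic (f := t)).
have [m' [m'E _]] := uq _ m mt0.
have [Z [g [qeg0 ug]]] := ab_epic ab (epic_comp eq ee).
have [g' [g'E _]] : exists! g', k ∙ g' = g.
  by apply: uk; rewrite -mE -m'E -!lccompA [q ∙ _]lccompA qeg0 lcomp0r.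
have [s [sE _]] : exists! s, s ∙ (q ∙ e) = e.
  by apply: ug; rewrite -g'E lccompA ce.1 lcomp0l.
have sq : s ∙ q = lidm Q.
  by apply: ee; rewrite /= -lccompA sE lccomp1m.
by rewrite -(lccomp1m t) -sq -lccompA qt0 lcomp0r.
Qed.

(** Dual to [coimage_monic]: if t kills e and i = ker t, then the monomorphism k i is the kernel of
    some g; as g factors through q, k factors through k i, so i is split epic and t = 0. *)
Lemma image_epic X Y K Q (f : lhom X Y) (q : lhom Y Q) (k : lhom K Y)
    (e : lhom X K) :
  is_cokernel q f -> is_kernel k q -> k ∙ e = f -> epic (C := A) e.
Proof.
move=> [qf0 uq] ck kE; have mk := kernel_monic ck.
apply: epic0 => T t te0.
have [K' [i [ti0 ui]]] := ab_kernel ab t.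
have mi : Defs.monic (C := A) i by apply: (kernel_monic (f := t)).
have [e' [e'E _]] := ui _ e te0.
have [Z [g [gki0 ug]]] := ab_monic ab (monic_comp mk mi).
have [g' [g'E _]] : exists! g', g' ∙ q = g.
  by apply: uq; rewrite -kE -e'E !lccompA -[_ ∙ k ∙ i]lccompA gki0 lcomp0l.
have [s [sE _]] : exists! s, (k ∙ i) ∙ s = k.
  by apply: ug; rewrite -g'E -lccompA ck.1 lcomp0r.
have si : i ∙ s = lidm K.
  by apply: mk; rewrite /= lccompA sE lccompm1.
by rewrite -(lccompm1 t) -si lccompA ti0 lcomp0l.
Qed.

(** An exact functor is only known to preserve short exact sequences; this factorization gives
    access to kernels of arbitrary maps, as [cokernel_image] does for cokernels. *)
Lemma kernel_coimage X Y (f : lhom X Y) :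
  exists K Q (k : lhom K X) (e : lhom X Q) (m : lhom Q Y),
    [/\ is_kernel k f, short_exact k e, m ∙ e = f & Defs.monic (C := A) m].
Proof.
have [K [k kk]] := ab_kernel ab f.
have [Q [e ce]] := ab_cokernel ab k.
have [m [mE _]] := ce.2 _ f kk.1.
exists K, Q, k, e, m; split=> //; last exact: coimage_monic kk ce mE.
split=> //; split=> [|T t et0]; first exact: ce.1.
by apply: kk.2; rewrite -mE -lccompA et0 lcomp0r.
Qed.

Lemma cokernel_image X Y (f : lhom X Y) (Q : A) (q : lhom Y Q) :
  is_cokernel q f ->
  exists K (k : lhom K Y) (e : lhom X K),
    [/\ short_exact k q, k ∙ e = f & epic (C := A) e].
Proof.
move=> cq; have [K [k kk]] := ab_kernel ab q.
have [e [eE _]] := kk.2 _ f cq.1.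
exists K, k, e; split=> //; last exact: image_epic cq kk eE.
split=> //; split=> [|T t tk0]; first exact: kk.1.
by apply: cq.2; rewrite -eE lccompA tk0 lcomp0l.
Qed.

Lemma epic_short_exact X Y (e : lhom X Y) : epic (C := A) e ->
  exists K (k : lhom K X), short_exact k e.
Proof.
move=> /(ab_epic ab) [Z [g cg]]; have [K [k [i [se _ _]]]] := cokernel_image cg.
by exists K, k.
Qed.

(** If m is a kernel of g, then m and the kernel k of g factor through each other, so the coimage of
    g is a cokernel of m as well. *)
Lemma monic_short_exact X Y (m : lhom X Y) : Defs.monic (C := A) m ->
  exists Q (q : lhom Y Q), short_exact m q.
Proof.
move=> /(ab_monic ab) [Z [g kg]]; have [K [Q [k [e [m' [kk se e' mm]]]]]] := kernel_coimage g.
exists Q, e; split; last first.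
  have [u [uE _]] := kk.2 _ m kg.1; have [v [vE _]] := kg.2 _ k kk.1.
  split=> [|T t tm0]; first by rewrite -uE lccompA se.1.1 lcomp0l.
  by apply: se.2.2; rewrite -vE lccompA tm0 lcomp0l.
split=> [|T t et0]; first by apply: mm; rewrite /= lcomp0r lccompA e' kg.1.
by apply: kg.2; rewrite -e' -lccompA et0 lcomp0r.
Qed.

(** The image of an idempotent f is the kernel of 1 - f. *)
Lemma idempotent_split X (f : lhom X X) : f ∙ f = f ->
  exists Q (r : lhom X Q) (i : lhom Q X), r ∙ i = lidm Q /\ i ∙ r = f.
Proof.
move=> ff; have [K [k [k0 uk]]] := ab_kernel ab (lidm X - f).
have [r [rE _]] : exists! r, k ∙ r = f.
  by apply: uk; rewrite lcompBl lccomp1m ff subrr.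
exists K, r, k; split=> //.
apply: (kernel_monic (conj k0 uk)); rewrite /= lccompA rE lccompm1.
by apply/esym/subr0_eq; rewrite -[X in X - _]lccomp1m -lcompBl k0.
Qed.

End AbelianLemmas.

(** * Fiber functors on elements *)

Lemma linapp (R : comPzRingType) (M N : lmodType R) (f g : {linear M -> N}) :
  f = g -> forall x, f x = g x.
Proof. by move=> ->. Qed.

(** Essential smallness enters as a fixed family of representatives over a small type, from which
    coends with small carriers can be built. *)
Record neutral_tannakian (R : comPzRingType) (A : TensorCategory R) : Type := {
  nt_fun : NeutralFiberFunctor A;
  nt_abelian : abelian A;
  nt_dual : forall X : A, exists (X' : A) (p : lhom X' X),
    epic (C := A) p /\ has_dual A X';
  nt_ix : SmallType;
  nt_sk : nt_ix -> A;
  nt_skP : forall X : A, exists i, isomorphic (C := A) X (nt_sk i)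
}.

Section FiberFunctor.
Variables (R : comPzRingType) (A : TensorCategory R) (T : neutral_tannakian A).
Local Notation ab := (nt_abelian T).
Local Notation enough_duals := (nt_dual T).
Local Notation w := (nt_fun T).
Implicit Types X Y Z P : A.

Definition W X : lmodType R := ff_fun w X.
Definition wm X Y (f : lhom X Y) : {linear W X -> W Y} := fmap (ff_fun w) f.

Lemma wm1 X x : wm (lidm X) x = x.
Proof. by rewrite /wm (fmap1 (ff_fun w)). Qed.
Lemma wmM X Y Z (g : lhom Y Z) (f : lhom X Y) x : wm (g ∙ f) x = wm g (wm f x).
Proof. by rewrite /wm (fmapD (ff_fun w)). Qed.
Lemma wmP a X Y (f g : lhom X Y) x : wm (a *: f + g) x = a *: wm f x + wm g x.
Proof.
exact: (@linapp _ (W X) (W Y) _ _ (ff_linear w a f g) x).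
Qed.
Lemma wmD X Y (f g : lhom X Y) x : wm (f + g) x = wm f x + wm g x.
Proof. by rewrite -[f]scale1r wmP !scale1r. Qed.
Lemma wm0 X Y x : wm (0 : lhom X Y) x = 0.
Proof. by apply: (addrI (wm 0 x)); rewrite -wmD !addr0. Qed.
Lemma wmB X Y (f g : lhom X Y) x : wm (f - g) x = wm f x - wm g x.
Proof. by apply: (addIr (wm g x)); rewrite -wmD !subrK. Qed.
Lemma wm_inj X Y (f g : lhom X Y) : wm f =1 wm g -> f = g.
Proof. by move=> e; apply: (@ff_faithful _ _ _ _ w); apply: linext. Qed.

(** An element y is a linear map out of R, which factors through the kernel in modules; the preimage
    is the value of the factorization at 1. *)
Lemma short_exact_ker X Y Z (f : lhom X Y) (g : lhom Y Z) y :
  short_exact f g -> wm g y = 0 -> exists x, y = wm f x.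
Proof.
move=> /(@ff_exact _ _ _ _ w _ _ _ _ _) [[_ u] _] gy0.
have tl : linear (fun a : regmod R => (a : R) *: y).
  by move=> a b c; rewrite scalerDl scalerA.
have gt0 : lcomp (wm g) (mklin tl) = @hzero R R idfun (regmod R) (W Z).
  by apply: linext => a; rewrite /= linearZ /= gy0 scaler0.
have [t [tE _]] := u (regmod R) (mklin tl) gt0.
have := @linapp _ (regmod R) (W Y) _ _ tE (1 : R); rewrite /= scale1r => <-.
by exists ((t : {linear _ -> _}) (1 : R)).
Qed.

Lemma short_exact_coker X Y Z (f : lhom X Y) (g : lhom Y Z) (N : lmodType R)
    (h : {linear W Y -> N}) :
  short_exact f g -> (forall x, h (wm f x) = 0) ->
  exists h' : {linear W Z -> N}, forall y, h' (wm g y) = h y.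
Proof.
move=> /(@ff_exact _ _ _ _ w _ _ _ _ _) [_ [_ u]] hf0.
have e : lcomp h (wm f) = @hzero R R idfun (W X) N by apply: linext.
have [h' [h'E _]] := u N h e; exists h' => y.
exact: (@linapp _ (W Y) N _ _ h'E y).
Qed.

Lemma wm_surj X Y (e : lhom X Y) : epic (C := A) e -> forall y, exists x, y = wm e x.
Proof.
move=> /(epic_short_exact ab) [K [k /(@ff_exact _ _ _ _ w _ _ _ _ _) [_ [ek u]]]].
apply: epi_lin_surj => Q g h gh.
have e0 : lcomp (lcomp g (wm e)) (wm k) = @hzero R R idfun (W K) Q.
  apply: linext => x; rewrite lcompE lcompE.
  by have /= -> := @linapp _ (W K) (W Y) _ _ ek x; rewrite linear0.
have [v [_ uniq]] := u Q _ e0.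
by rewrite -(uniq (g : linhom idfun _ _) erefl) -(uniq (h : linhom idfun _ _) (esym gh)).
Qed.

Lemma surj_epic X Y (e : lhom X Y) : (forall y, exists x, y = wm e x) -> epic (C := A) e.
Proof.
move=> es; apply: epic0 => Z t te0; apply: wm_inj => y.
by have [x ->] := es y; rewrite -wmM te0 !wm0.
Qed.

Lemma wm_injective X Y (m : lhom X Y) : Defs.monic (C := A) m ->
  forall x, wm m x = 0 -> x = 0.
Proof.
move=> mm x mx0; have [Q [q se]] := monic_short_exact ab mm.
have [[_ u] _] := @ff_exact _ _ _ _ w _ _ _ _ _ se.
have tl : linear (fun a : regmod R => (a : R) *: x).
  by move=> a b c; rewrite scalerDl scalerA.
have mt0 : lcomp (wm q) (@hzero R R idfun (regmod R) (W Y)) =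
    @hzero R R idfun (regmod R) (W Q).
  by apply: linext => a; rewrite /= linear0.
(* The zero map R -> W Y lifts uniquely along [wm m]; both the zero map and the map 1 |-> x are
   lifts, so x = 0. *)
have [v [_ uniq]] := u _ _ mt0.
have e1 : lcomp (wm m) (mklin tl) = @hzero R R idfun (regmod R) (W Y).
  by apply: linext => a; rewrite /= linearZ /= mx0 scaler0.
have e2 : lcomp (wm m) (@hzero R R idfun (regmod R) (W X)) =
    @hzero R R idfun (regmod R) (W Y).
  by apply: linext => a; rewrite /= linear0.
have := uniq (mklin tl) e1; rewrite (uniq _ e2).
by move=> /(@linapp _ (regmod R) (W X)) /(_ (1 : R)) /=; rewrite scale1r.
Qed.

Lemma wm_ker X Y (f : lhom X Y) x : wm f x = 0 ->
  exists K (k : lhom K X) y, f ∙ k = 0 /\ x = wm k y.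
Proof.
have [K [Q [k [e [m [kk se <- mm]]]]]] := kernel_coimage ab f.
rewrite wmM => /(wm_injective mm) /(short_exact_ker se) [y ->].
by exists K, k, y; split=> //; rewrite -lccompA se.1.1 lcomp0r.
Qed.

Lemma wm_coker X Y Q (f : lhom X Y) (q : lhom Y Q) (N : lmodType R)
    (h : {linear W Y -> N}) :
  is_cokernel q f -> (forall x, h (wm f x) = 0) ->
  exists h' : {linear W Q -> N}, forall y, h' (wm q y) = h y.
Proof.
move=> /(cokernel_image ab) [K [k [e [se <- /wm_surj es]]]] hf0.
apply: short_exact_coker se _ => x; have [z ->] := es x.
by rewrite -wmM hf0.
Qed.

Lemma dual_cover X (x : W X) : exists P (u : lhom P X) (p : W P),
  has_dual A P /\ x = wm u p.
Proof.
have [P [u [/wm_surj us dP]]] := enough_duals X.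
by have [p ->] := us x; exists P, u, p.
Qed.

(** The category of elements is cofiltered, objects: cover the element (x, y) of the biproduct by an
    object with a dual. *)
Lemma span_pair X Y (x : W X) (y : W Y) :
  exists P (u : lhom P X) (v : lhom P Y) (p : W P),
  [/\ has_dual A P, x = wm u p & y = wm v p].
Proof.
have [S [i1 [i2 [p1 [p2 [e11 e22 e21 e12 _]]]]]] := ab_biproduct ab X Y.
have [P [u [p [dP e]]]] := dual_cover (wm i1 x + wm i2 y).
exists P, (p1 ∙ u), (p2 ∙ u), p; split=> //; rewrite wmM -e linearD -!wmM.
  by rewrite e11 e12 wm1 wm0 addr0.
by rewrite e21 e22 wm1 wm0 add0r.
Qed.

Lemma span_kernel X Y (f : lhom X Y) x : wm f x = 0 ->
  exists P (u : lhom P X) (p : W P), [/\ has_dual A P, f ∙ u = 0 & x = wm u p].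
Proof.
move=> /wm_ker [K [k [y [fk0 ->]]]]; have [P [u [p [dP ->]]]] := dual_cover y.
by exists P, (k ∙ u), p; rewrite lccompA fk0 lcomp0l wmM.
Qed.

(** The category of elements is cofiltered, parallel arrows: x lies in the kernel of f - g, which is
    covered by an object with a dual. *)
Lemma span_equalizer X Y (f g : lhom X Y) x : wm f x = wm g x ->
  exists P (u : lhom P X) (p : W P),
  [/\ has_dual A P, f ∙ u = g ∙ u & x = wm u p].
Proof.
move=> e; have [|P [u [p [dP fgu ->]]]] := @span_kernel _ _ (f - g) x.
  by rewrite wmB e subrr.
by exists P, u, p; split=> //; apply/subr0_eq; rewrite -lcompBl.
Qed.

End FiberFunctor.

(** * Tensor products and duality on elements *)

Section MonoidalElements.
Variables (R : comPzRingType) (A : TensorCategory R) (T : neutral_tannakian A).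
Implicit Types (X Y Z P : A) (M N : lmodType R).
Local Notation w := (nt_fun T).
Local Notation W := (W T).
Local Notation wm := (wm T).
Local Notation "X ⊗ Y" := (tens (s := tmon A) X Y) (at level 35, right associativity).
Local Notation "𝟙" := (munit (s := tmon A)).

Definition wmul X Y : {linear tensor (W X) (W Y) -> W (X ⊗ Y)} := fmul (ff_monoidal w) X Y.
Definition wpair X Y (x : W X) (y : W Y) : W (X ⊗ Y) := wmul X Y (pure x y).
Local Notation "x ⊙ y" := (wpair x y) (at level 35, right associativity).

Definition wmulV X Y : {linear W (X ⊗ Y) -> tensor (W X) (W Y)} :=
  sval (cid (fmul_iso (ff_monoidal w) X Y)).
Lemma wmulK X Y t : wmulV X Y (wmul X Y t) = t.
Proof.
rewrite /wmulV; case: cid => g [gf _] /=.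
exact: (@linapp _ (tensor (W X) (W Y)) (tensor (W X) (W Y)) _ _ gf t).
Qed.
Lemma wmulVK X Y t : wmul X Y (wmulV X Y t) = t.
Proof.
rewrite /wmulV; case: cid => g [_ fg] /=.
exact: (@linapp _ (W (X ⊗ Y)) (W (X ⊗ Y)) _ _ fg t).
Qed.

Definition wunit : {linear regmod R -> W 𝟙} := funit (ff_monoidal w).
Definition wone : W 𝟙 := wunit (1 : R).
Definition wunitV : {linear W 𝟙 -> regmod R} := sval (cid (funit_iso (ff_monoidal w))).
Lemma wunitK a : wunitV (wunit a) = a.
Proof.
rewrite /wunitV; case: cid => g [gf _] /=.
exact: (@linapp _ (regmod R) (regmod R) _ _ gf a).
Qed.
Lemma wunitVK a : wunit (wunitV a) = a.
Proof.
rewrite /wunitV; case: cid => g [_ fg] /=.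
exact: (@linapp _ (W 𝟙) (W 𝟙) _ _ fg a).
Qed.
Lemma wunitE (a : R) : wunit a = a *: wone.
Proof. by rewrite /wone -linearZ /GRing.scale /= mulr1. Qed.
Lemma wunitV1 : wunitV wone = 1 :> R. Proof. exact: wunitK. Qed.
Lemma wunitVE a : a = (wunitV a : R) *: wone.
Proof. by rewrite -wunitE wunitVK. Qed.

Lemma wpairDl X Y (x x' : W X) (y : W Y) : (x + x') ⊙ y = x ⊙ y + x' ⊙ y.
Proof. by rewrite /wpair pureDl linearD. Qed.
Lemma wpairDr X Y (x : W X) (y y' : W Y) : x ⊙ (y + y') = x ⊙ y + x ⊙ y'.
Proof. by rewrite /wpair pureDr linearD. Qed.
Lemma wpairZl X Y a (x : W X) (y : W Y) : (a *: x) ⊙ y = a *: x ⊙ y.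
Proof. by rewrite /wpair pureZl linearZ. Qed.
Lemma wpairZr X Y a (x : W X) (y : W Y) : x ⊙ (a *: y) = a *: x ⊙ y.
Proof. by rewrite /wpair pureZr linearZ. Qed.

Lemma wpair_suml X Y (S : Type) (s : seq S) (F : S -> W X) (y : W Y) :
  (\sum_(p <- s) F p) ⊙ y = \sum_(p <- s) F p ⊙ y.
Proof.
elim/big_rec2: _ => [|p a b _ <-]; last by rewrite wpairDl.
by rewrite /wpair pure0l linear0.
Qed.
Lemma wpair_sumr X Y (S : Type) (s : seq S) (x : W X) (F : S -> W Y) :
  x ⊙ (\sum_(p <- s) F p) = \sum_(p <- s) x ⊙ F p.
Proof.
elim/big_rec2: _ => [|p a b _ <-]; last by rewrite wpairDr.
by rewrite /wpair pure0r linear0.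
Qed.

Lemma wtens_ind X Y (Q : W (X ⊗ Y) -> Prop) :
  Q 0 -> (forall x y, Q (x ⊙ y)) -> (forall a b, Q a -> Q b -> Q (a + b)) ->
  forall a, Q a.
Proof.
move=> Q0 Qp QD a; rewrite -(wmulVK a); elim/tens_ind: (wmulV X Y a) => [|x y|s t].
- by rewrite linear0.
- exact: Qp.
- by rewrite linearD; exact: QD.
Qed.

Lemma linext_wpair X Y N (f g : {linear W (X ⊗ Y) -> N}) :
  (forall x y, f (x ⊙ y) = g (x ⊙ y)) -> f = g.
Proof.
move=> e; apply: linext; elim/wtens_ind => // [|a b ea eb].
  by rewrite !linear0.
by rewrite !linearD ea eb.
Qed.

Lemma linext_wunit N (f g : {linear W 𝟙 -> N}) : f wone = g wone -> f = g.
Proof. by move=> e; apply: linext => a; rewrite (wunitVE a) !linearZ /= e. Qed.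

Lemma wtensm X X' Y Y' (f : lhom X X') (g : lhom Y Y') x y :
  wm (tensm (s := tmon A) f g) (x ⊙ y) = wm f x ⊙ wm g y.
Proof.
have := @linapp _ (tensor (W X) (W Y)) (W (X' ⊗ Y')) _ _
  (fmul_nat (ff_monoidal w) f g) (pure x y).
by rewrite /= tmapE => <-.
Qed.

Lemma wassoc X Y Z x y z : wm (assoc X Y Z) ((x ⊙ y) ⊙ z) = x ⊙ y ⊙ z.
Proof.
have := @linapp _ (tensor (tensor (W X) (W Y)) (W Z)) (W (X ⊗ Y ⊗ Z)) _ _
  (fmul_assoc (ff_monoidal w) X Y Z) (pure (pure x y) z).
by rewrite /= tmapE tassocE tmapE.
Qed.

Lemma wassocV X Y Z x y z : wm (assocV X Y Z) (x ⊙ y ⊙ z) = (x ⊙ y) ⊙ z.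
Proof.
rewrite -wassoc -wmM.
have -> : assocV X Y Z ∙ assoc X Y Z = lidm _ := @assocK _ (tmon A) X Y Z.
exact: wm1.
Qed.

Lemma wlunit X x : wm (lunit X) (wone ⊙ x) = x.
Proof.
have := @linapp _ (tensor (regmod R) (W X)) (W X) _ _
  (fmul_lunit (ff_monoidal w) X) (@pure R (regmod R) (W X) (1 : R) x).
by rewrite /= tmapE tlunitE scale1r => e; exact: e.
Qed.

Lemma wrunit X x : wm (runit X) (x ⊙ wone) = x.
Proof.
have := @linapp _ (tensor (W X) (regmod R)) (W X) _ _
  (fmul_runit (ff_monoidal w) X) (@pure R (W X) (regmod R) x (1 : R)).
by rewrite /= tmapE trunitE scale1r => e; exact: e.
Qed.

Lemma wlunitZ X a x : wm (lunit X) (a ⊙ x) = (wunitV a : R) *: x.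
Proof. by rewrite [a in LHS]wunitVE wpairZl linearZ /= wlunit. Qed.
Lemma wrunitZ X x a : wm (runit X) (x ⊙ a) = (wunitV a : R) *: x.
Proof. by rewrite [a in LHS]wunitVE wpairZr linearZ /= wrunit. Qed.

Lemma wbraid X Y x y : wm (braid X Y) (x ⊙ y) = y ⊙ x.
Proof.
have := @linapp _ (tensor (W X) (W Y)) (W (Y ⊗ X)) _ _
  (fmul_braid (ff_monoidal w) X Y) (pure x y).
by rewrite /= tswapE.
Qed.

Definition wtens X Y M N (f : {linear W X -> M}) (g : {linear W Y -> N}) :
  {linear W (X ⊗ Y) -> tensor M N} := lcomp (tmap f g) (wmulV X Y).
Lemma wtensE X Y M N (f : {linear W X -> M}) (g : {linear W Y -> N}) x y :
  wtens f g (x ⊙ y) = pure (f x) (g y).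
Proof. by rewrite /wtens lcompE wmulK tmapE. Qed.

(* A duality in A seen through W: [wd_basis] is the value of the coevaluation at
   1, and the triangle identities say that its two components are dual bases. *)
Record wdual X : Type := WDual {
  wd_ob : A;
  wd_ev : lhom (wd_ob ⊗ X) 𝟙;
  wd_coev : lhom 𝟙 (X ⊗ wd_ob);
  wd_basis : seq (W X * W wd_ob);
  wd_coevE : wm wd_coev wone = \sum_(p <- wd_basis) p.1 ⊙ p.2;
  wd_expand : forall x, \sum_(p <- wd_basis) (wunitV (wm wd_ev (p.2 ⊙ x)) : R) *: p.1 = x;
  wd_expandV : forall c, \sum_(p <- wd_basis) (wunitV (wm wd_ev (c ⊙ p.1)) : R) *: p.2 = c
}.

Lemma tensor_sum M N (t : tensor M N : lmodType R) :
  exists s : seq (M * N), t = \sum_(p <- s) pure p.1 p.2.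
Proof.
elim/tens_ind: t => [|m n|x y [s ->] [t ->]].
- by exists [::]; rewrite big_nil.
- by exists [:: (m, n)]; rewrite big_seq1.
- by exists (s ++ t); rewrite big_cat.
Qed.

(** The triangle identities, evaluated at [wone ⊙ x] and [c ⊙ wone], are the two dual basis
    expansions. *)
Lemma wdual_ex X : has_dual A X -> exists d : wdual X, True.
Proof.
move=> [Xd [ev [coev [t1 t2]]]].
have [s sE] := tensor_sum (wmulV X Xd (wm coev wone)).
have cE : wm coev wone = \sum_(p <- s) p.1 ⊙ p.2.
  by rewrite -(wmulVK (wm coev wone)) sE linear_sum.
have e1 x : \sum_(p <- s) (wunitV (wm ev (p.2 ⊙ x)) : R) *: p.1 = x.
  have := congr1 (fun u => wm u (wone ⊙ x)) t1.
  rewrite wlunit !wmM wtensm cE wm1 => {2}<-.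
  rewrite wpair_suml !linear_sum; apply: eq_bigr => p _.
  by rewrite wassoc wtensm wm1 wrunitZ.
have e2 c : \sum_(p <- s) (wunitV (wm ev (c ⊙ p.1)) : R) *: p.2 = c.
  have := congr1 (fun u => wm u (c ⊙ wone)) t2.
  rewrite wrunit !wmM wtensm cE wm1 => {2}<-.
  rewrite wpair_sumr !linear_sum; apply: eq_bigr => p _.
  by rewrite wassocV wtensm wm1 wlunitZ.
by exists (WDual cE e1 e2).
Qed.

Definition wev X (d : wdual X) (c : W (wd_ob d)) (x : W X) : R :=
  wunitV (wm (wd_ev d) (c ⊙ x)).
Lemma wev_linearl X (d : wdual X) x : linear (fun c => wev (d := d) c x : regmod R).
Proof. by move=> a b c; rewrite /wev wpairDl wpairZl !linearP. Qed.
Lemma wev_linearr X (d : wdual X) c : linear (wev (d := d) c : W X -> regmod R).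
Proof. by move=> a x y; rewrite /wev wpairDr wpairZr !linearP. Qed.
Definition wevl X (d : wdual X) x : {linear W (wd_ob d) -> regmod R} :=
  mklin (@wev_linearl X d x).
Definition wevr X (d : wdual X) c : {linear W X -> regmod R} :=
  mklin (@wev_linearr X d c).

(** g is the mate of f: insert the coevaluation of X, apply f, evaluate against Y; r inverts the
    right unitor. *)
Lemma wev_transpose X Y (d : wdual X) (d' : wdual Y) (f : lhom X Y) :
  exists g : lhom (wd_ob d') (wd_ob d),
    forall c x, wev (wm g c) x = wev c (wm f x).
Proof.
have [r [r1 r2]] := @runit_iso _ (tmon A) (wd_ob d').
exists (lunit (wd_ob d) ∙ tensm (s := tmon A) (wd_ev d') (lidm _)
  ∙ assocV (wd_ob d') Y (wd_ob d)
  ∙ tensm (s := tmon A) (lidm _) (tensm (s := tmon A) f (lidm _) ∙ wd_coev d) ∙ r) => c x.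
have rE : wm r c = c ⊙ wone.
  rewrite -{1}(wrunit c) -wmM.
  have -> : r ∙ runit (wd_ob d') = lidm _ := r1.
  exact: wm1.
rewrite !wmM rE !wtensm !wmM wd_coevE !linear_sum wpair_sumr !linear_sum /=.
(* With x expanded in the basis of d on the right, both sides are sums over that basis and agree
   term by term. *)
rewrite /wev -{2}(wd_expand d x) !linear_sum wpair_sumr !linear_sum wpair_suml !linear_sum.
apply: eq_bigr => p _.
rewrite wtensm !wm1 wassocV wtensm wm1 wlunitZ.
rewrite wpairZl !linearZ /= wpairZr !linearZ /=. exact: mulrC.
Qed.
End MonoidalElements.

(** * The coend of a fiber functor *)

Section Matrices.
Variables (R : comPzRingType) (A : TensorCategory R) (T : neutral_tannakian A).
Local Notation ab := (nt_abelian T).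
Local Notation sk := (@nt_sk _ _ T).
Local Notation skP := (nt_skP T).
Local Notation I := (nt_ix T).
Implicit Types (X Y Z P : A) (M N Q : lmodType R).
Local Notation W := (W T).
Local Notation wm := (wm T).

Definition homR M N : lmodType R := linhom (idfun : {rmorphism R -> R}) M N.

Lemma precomp_linear M M' N (f : {linear M -> M'}) :
  linear (fun g : homR M' N => lcomp (g : {linear M' -> N}) f : homR M N).
Proof. by move=> a g h; apply: linext => x. Qed.
Definition precomp M M' N (f : {linear M -> M'}) : {linear homR M' N -> homR M N} :=
  mklin (@precomp_linear M M' N f).

Definition skel X : I := sval (cid (skP X)).
Lemma skel_iso_ex X : exists f : lhom X (sk (skel X)), exists g : lhom (sk (skel X)) X,
  g ∙ f = lidm _.
Proof. by rewrite /skel; case: cid => i [f [g [gf _]]] /=; exists f, g. Qed.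
Definition to_sk X : lhom X (sk (skel X)) := sval (cid (skel_iso_ex X)).
Definition of_sk X : lhom (sk (skel X)) X := sval (cid (svalP (cid (skel_iso_ex X)))).
Lemma to_skK X : of_sk X ∙ to_sk X = lidm _.
Proof. exact: svalP (cid (svalP (cid (skel_iso_ex X)))). Qed.

Section Coend.
Variable N : lmodType R.

Definition mix : SmallType := {i : I & W (sk i)}.
Definition mmod (a : mix) : lmodType R := homR (W (sk (tag a))) N.
Definition mtr (a b : mix) (h : {linear mmod a -> mmod b}) : Prop :=
  exists u : lhom (sk (tag b)) (sk (tag a)),
    wm u (tagged b) = tagged a /\ h = precomp N (wm u).

Lemma mtr1 a : mtr (lid (mmod a)).
Proof.
exists (lidm _); split; first exact: wm1.
by apply: linext => f; apply: linext => x /=; rewrite wm1.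
Qed.
Lemma mtrM a b c (g : {linear mmod b -> mmod c}) (f : {linear mmod a -> mmod b}) :
  mtr g -> mtr f -> mtr (lcomp g f).
Proof.
move=> [v [vx ->]] [u [ux ->]]; exists (u ∙ v); split; first by rewrite wmM vx.
by apply: linext => h; apply: linext => x /=; rewrite wmM.
Qed.
Lemma mtr_ub a b : exists c (f : {linear mmod a -> mmod c}) (g : {linear mmod b -> mmod c}),
  mtr f /\ mtr g.
Proof.
have [P [u [v [p [_ ua vb]]]]] := span_pair (tagged a) (tagged b).
exists (existT _ (skel P) (wm (to_sk P) p)).
exists (precomp N (wm (u ∙ of_sk P))), (precomp N (wm (v ∙ of_sk P))).
split; [exists (u ∙ of_sk P)|exists (v ∙ of_sk P)]; split=> //=.
  by rewrite -wmM -lccompA to_skK lccompm1.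
by rewrite -wmM -lccompA to_skK lccompm1.
Qed.
Lemma mtr_eq a b (f g : {linear mmod a -> mmod b}) : mtr f -> mtr g ->
  exists c (h : {linear mmod b -> mmod c}), mtr h /\ forall x, h (f x) = h (g x).
Proof.
move=> [u [ua ->]] [v [va ->]]; have [|P [t [p [_ e tb]]]] :=
  @span_equalizer _ _ T _ _ u v (tagged b); first by rewrite ua va.
exists (existT _ (skel P) (wm (to_sk P) p)), (precomp N (wm (t ∙ of_sk P))); split.
  by exists (t ∙ of_sk P); split=> //=; rewrite -wmM -lccompA to_skK lccompm1.
move=> x; apply: linext => y /=.
by rewrite -!wmM !lccompA e.
Qed.

Definition msys : dsys R :=
  {| dtr := mtr; dix0 := existT _ (skel (munit (s := tmon A))) (0 : W _);
     dtr1 := mtr1; dtrM := mtrM; dtr_ub := mtr_ub; dtr_eq := mtr_eq |}.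

(* The coend of W X (x) Hom(W X, N) over X, as a filtered colimit of the modules
   Hom(W X, N) over the opposite of the category of elements of W; it turns out
   to be N (x) H. *)
Definition coend : lmodType R := fcolim msys.

(** The class [X, x, f] for an arbitrary X, moved to the representative of X: the element along
    [to_sk], the map along its retraction [of_sk]. *)
Definition cls X (x : W X) (f : {linear W X -> N}) : coend :=
  fin (existT _ (skel X) (wm (to_sk X) x) : dix msys) (lcomp f (wm (of_sk X))).

(** The defining relation of a coend; u becomes a transition map once conjugated to
    representatives. *)
Lemma cls_nat X Y (u : lhom X Y) (x : W X) (f : {linear W Y -> N}) :
  cls x (lcomp f (wm u)) = cls (wm u x) f.
Proof.
rewrite /cls.
have tr : mtr (a := existT _ (skel Y) (wm (to_sk Y) (wm u x)))
    (b := existT _ (skel X) (wm (to_sk X) x))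
    (precomp N (wm (to_sk Y ∙ u ∙ of_sk X))).
  exists (to_sk Y ∙ u ∙ of_sk X); split=> //=.
  by rewrite -!wmM -[_ ∙ to_sk X]lccompA to_skK lccompm1.
rewrite -(fin_tr (D := msys) _ tr); apply: (congr1 (@fin _ msys _)); apply: linext => y /=.
by rewrite -!wmM !lccompA to_skK lccomp1m.
Qed.

Lemma cls_linear X (x : W X) : linear (cls x : homR (W X) N -> coend).
Proof.
move=> a f g; rewrite /cls -linearP; apply: (congr1 (@fin _ msys _)).
by apply: linext => z.
Qed.
Lemma clsD X (x : W X) (f g : {linear W X -> N}) :
  cls x (hadd (f : linhom idfun _ _) g) = cls x f + cls x g.
Proof. by have := cls_linear x 1 f g; rewrite !scale1r => <-. Qed.
Lemma cls0 X (x : W X) (f : {linear W X -> N}) : (forall y, f y = 0) -> cls x f = 0.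
Proof.
move=> f0; apply: (addrI (cls x f)); rewrite -clsD addr0; apply: (congr1 (cls _)).
by apply: linext => y /=; rewrite /hfun f0 addr0.
Qed.

Lemma cls_surj_sk (a : coend) : exists i (x : W (sk i)) f, a = cls x f.
Proof.
have [[i x] [f ->]] := fin_surj a; exists i, x, f.
rewrite /cls.
have tr : mtr (a := existT _ i x)
    (b := existT _ (skel (sk i)) (wm (to_sk (sk i)) x))
    (precomp N (wm (of_sk (sk i)))).
  exists (of_sk (sk i)); split=> //=.
  by rewrite -!wmM to_skK wm1.
by rewrite -(fin_tr (D := msys) _ tr).
Qed.

Lemma cls_surj (a : coend) : exists X (x : W X) f, has_dual A X /\ a = cls x f.
Proof.
have [i [x [f ->]]] := cls_surj_sk a.
have [P [u [p [dP ->]]]] := dual_cover x.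
by exists P, p, (lcomp f (wm u)); rewrite cls_nat.
Qed.

Lemma cls_surj2 (a b : coend) : exists X (x : W X) f g,
  [/\ has_dual A X, a = cls x f & b = cls x g].
Proof.
have [X [x [f [_ ->]]]] := cls_surj a; have [Y [y [g [_ ->]]]] := cls_surj b.
have [P [u [v [p [dP -> ->]]]]] := span_pair x y.
by exists P, p, (lcomp f (wm u)), (lcomp g (wm v)); rewrite !cls_nat.
Qed.

(** In a filtered colimit an element vanishes only if a transition map kills it, and transition maps
    are precompositions with arrows of A that reach x. *)
Lemma cls_eq0 X (x : W X) f : cls x f = 0 ->
  exists P (u : lhom P X) (p : W P),
    [/\ has_dual A P, x = wm u p & forall y, f (wm u y) = 0].
Proof.
move=> /fin_eq0 [[i y] [h [[u [uy ->]] e]]].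
have [P [v [p [dP yE]]]] := dual_cover y.
exists P, (of_sk X ∙ u ∙ v), p; split=> //.
  rewrite !wmM -yE.
  by move: uy => /= ->; rewrite -wmM to_skK wm1.
move=> z; have /= := @linapp _ _ _ _ _ e (wm v z).
by rewrite !wmM.
Qed.

Lemma cls_eq X (x : W X) f g : cls x f = cls x g ->
  exists P (u : lhom P X) (p : W P),
    [/\ has_dual A P, x = wm u p & forall y, f (wm u y) = g (wm u y)].
Proof.
move=> e.
have : cls x (hadd (f : linhom idfun _ _) (hopp (g : linhom idfun _ _))) = 0.
  rewrite clsD e -clsD; apply: cls0 => y /=; exact: subrr.
move=> /cls_eq0 [P [u [p [dP xE e']]]]; exists P, u, p; split=> // y.
by apply/subr0_eq/e'.
Qed.

(** Linearity in f is built into the colimit, additivity in x is not. It comes from [p1 + p2] on the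
    biproduct of X with itself: this map sends [i1 x + i2 x'] to x + x', and composing f with it
    gives a sum. *)
Lemma clsDl X (x x' : W X) f : cls (x + x') f = cls x f + cls x' f.
Proof.
have [S [i1 [i2 [p1 [p2 [e11 e22 e21 e12 _]]]]]] := ab_biproduct ab X X.
have -> : x + x' = wm (p1 + p2) (wm i1 x + wm i2 x').
  rewrite wmD !linearD -!wmM e11 e22 e21 e12 !wm1 !wm0.
  by rewrite addr0 add0r.
rewrite -cls_nat (_ : lcomp f _ = hadd (lcomp f (wm p1) : linhom idfun _ _) (lcomp f (wm p2))).
  rewrite clsD !cls_nat; congr (_ + _); apply: (congr1 (fun x => cls x f)).
    by rewrite linearD -!wmM e11 e12 wm1 wm0 addr0.
  by rewrite linearD -!wmM e21 e22 wm1 wm0 add0r.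
by apply: linext => y /=; rewrite wmD linearD.
Qed.
Lemma clsZl X a (x : W X) f :
  cls (a *: x) f = cls x (hscale a (f : linhom idfun _ _)).
Proof.
rewrite -[a *: x](_ : wm (a *: lidm X) x = _) -?cls_nat; last first.
  by rewrite -[_ *: _]addr0 wmP wm1 wm0 addr0.
apply: (congr1 (cls _)); apply: linext => y /=.
by rewrite -[_ *: lidm _]addr0 wmP wm1 wm0 addr0 linearZ.
Qed.
Lemma clsZr X a (x : W X) f :
  cls x (hscale a (f : linhom idfun _ _)) = a *: cls x f.
Proof.
rewrite -[RHS]addr0 -[X in _ = _ + X](@cls0 _ x (hzero idfun _ _)) //.
rewrite -(cls_linear x a f); apply: (congr1 (cls _)).
by apply: linext => y; rewrite /= /hfun /= addr0.
Qed.
Lemma clsl_linear X (f : {linear W X -> N}) : linear (fun x => cls x f).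
Proof. by move=> a x y; rewrite clsDl clsZl clsZr. Qed.

Section Recursor.
Variables (Q : lmodType R)
  (F : forall X, has_dual A X -> W X -> {linear W X -> N} -> Q).
Hypothesis Fnat : forall X Y (dX : has_dual A X) (dY : has_dual A Y) (u : lhom X Y) x f,
  F dX x (lcomp f (wm u)) = F dY (wm u x) f.
Hypothesis Flin : forall X (dX : has_dual A X) x,
  linear (F dX x : homR (W X) N -> Q).

Lemma coend_rec_ex (a : coend) :
  exists q, exists X (dX : has_dual A X) x f, a = cls x f /\ q = F dX x f.
Proof.
by have [X [x [f [dX ->]]]] := cls_surj a; exists (F dX x f), X, dX, x, f.
Qed.
Definition coend_rec_fun a := sval (cid (coend_rec_ex a)).
(** Two representations of a class are pulled back to a common span and then to an object where the
    maps agree; [Fnat] compares the values there. F is asked for on objects with a dual only, since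
    the antipode is defined by duals. *)
Lemma coend_rec_funE X (dX : has_dual A X) x f : coend_rec_fun (cls x f) = F dX x f.
Proof.
rewrite /coend_rec_fun.
have [Y [dY [y [g [e ->]]]]] := svalP (cid (coend_rec_ex (cls x f))).
have [P [u [v [p [dP xE yE]]]]] := span_pair x y.
move: e; rewrite xE yE -!cls_nat => /cls_eq [P' [t [p' [dP' pE e]]]].
rewrite pE -(Fnat dP dX) -(Fnat dP dY) -!(Fnat dP' dP); apply: (congr1 (F dP' p')).
by apply: linext => z; rewrite /= -[LHS]e.
Qed.
Lemma coend_rec_linear : linear coend_rec_fun.
Proof.
move=> a b c; have [X [x [f [g [dX -> ->]]]]] := cls_surj2 b c.
by rewrite -(cls_linear x) !(coend_rec_funE dX) Flin.
Qed.
Definition coend_rec : {linear coend -> Q} := mklin coend_rec_linear.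
Lemma coend_recE X (dX : has_dual A X) x f : coend_rec (cls x f) = F dX x f.
Proof. exact: coend_rec_funE. Qed.
End Recursor.

Lemma linext_cls Q (f g : {linear coend -> Q}) :
  (forall X (x : W X) h, has_dual A X -> f (cls x h) = g (cls x h)) -> f = g.
Proof.
by move=> e; apply: linext => a; have [X [x [h [dX ->]]]] := cls_surj a; exact: e.
Qed.

Section Recursor'.
Variables (Q : lmodType R) (F : forall X, W X -> {linear W X -> N} -> Q).
Hypothesis Fnat : forall X Y (u : lhom X Y) x f, F x (lcomp f (wm u)) = F (wm u x) f.
Hypothesis Flin : forall X (x : W X), linear (F x : homR (W X) N -> Q).

Definition coend_rec' : {linear coend -> Q} :=
  coend_rec (F := fun X _ => @F X) (fun X Y _ _ => @Fnat X Y) (fun X _ => @Flin X).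
Lemma coend_rec'E X (x : W X) f : coend_rec' (cls x f) = F x f.
Proof.
have [P [u [p [dP ->]]]] := dual_cover x.
by rewrite -cls_nat (coend_recE _ _ dP) Fnat.
Qed.
End Recursor'.
End Coend.

Section CoendMap.
Variables (N N' : lmodType R) (g : {linear N -> N'}).
Lemma coend_map_nat X Y (u : lhom X Y) x (f : {linear W Y -> N}) :
  cls x (lcomp g (lcomp f (wm u))) = cls (wm u x) (lcomp g f).
Proof. by rewrite -cls_nat; apply: (congr1 (cls _)); apply: linext => z. Qed.
Lemma coend_map_lin X (x : W X) :
  linear (fun f : homR (W X) N => cls x (lcomp g (f : {linear _ -> _}))).
Proof.
move=> a f h; rewrite -[RHS](cls_linear x); apply: (congr1 (cls _)).
by apply: linext => y /=; rewrite linearP.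
Qed.
Definition coend_map : {linear coend N -> coend N'} := coend_rec' coend_map_nat coend_map_lin.
Lemma coend_mapE X (x : W X) f : coend_map (cls x f) = cls x (lcomp g f).
Proof. exact: coend_rec'E. Qed.
(** The source of flatness: the equality of two images is witnessed by an equality of maps into N'
    on some P, where g can be cancelled. *)
Lemma coend_map_inj : injective g -> injective coend_map.
Proof.
move=> gi a b; have [X [x [f [h [_ -> ->]]]]] := cls_surj2 a b.
rewrite !coend_mapE => /cls_eq [P [u [p [_ -> e]]]].
rewrite -!cls_nat; apply: (congr1 (cls _)); apply: linext => y; exact/gi/e.
Qed.
End CoendMap.

End Matrices.

(** * The ring of matrix coefficients and its comodules *)

Section HopfRing.
Variables (R : comPzRingType) (A : TensorCategory R) (T : neutral_tannakian A).
Implicit Types (X Y Z P : A) (M N Q : lmodType R).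
Local Notation W := (W T).
Local Notation wm := (wm T).
Local Notation coend := (coend T).
Local Notation coend_map := (coend_map T).
Local Notation wone := (wone T).
Local Notation wunitV := (wunitV T).
Local Notation "X ⊗ Y" := (tens (s := tmon A) X Y) (at level 35, right associativity).
Local Notation "x ⊙ y" := (wpair x y) (at level 35, right associativity).

Lemma sum_homR (S : Type) (s : seq S) M N (F : S -> homR M N) x :
  (\sum_(i <- s) F i : {linear M -> N}) x = \sum_(i <- s) (F i : {linear M -> N}) x.
Proof.
elim: s => [|i s IH]; first by rewrite !big_nil.
by rewrite !big_cons -IH.
Qed.

Lemma pure_suml (S : Type) (s : seq S) M N (F : S -> M) (n : N) :
  pure (\sum_(i <- s) F i) n = \sum_(i <- s) pure (F i) n.
Proof. by elim/big_rec2: _ => [|i a b _ <-]; rewrite (pure0l, pureDl). Qed.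
Lemma pure_sumr (S : Type) (s : seq S) M N (m : M) (F : S -> N) :
  pure m (\sum_(i <- s) F i) = \sum_(i <- s) pure m (F i).
Proof. by elim/big_rec2: _ => [|i a b _ <-]; rewrite (pure0r, pureDr). Qed.

Lemma homRP M N a (f g : homR M N) x :
  (a *: f + g : {linear M -> N}) x = a *: (f : {linear M -> N}) x + (g : {linear M -> N}) x.
Proof. by []. Qed.

Section Product.
Variables M N : lmodType R.

Section ProductLeft.
Variables (Y : A) (y : W Y) (g : {linear W Y -> N}).
Lemma cprod1_nat X X' (u : lhom X X') x (f : {linear W X' -> M}) :
  cls (x ⊙ y) (wtens (lcomp f (wm u)) g) = cls (wm u x ⊙ y) (wtens f g).
Proof.
rewrite -{2}[y](wm1 (T := T)) -wtensm -cls_nat; apply: (congr1 (cls _)).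
by apply: linext_wpair => a b; rewrite lcompE wtensm !wtensE wm1.
Qed.
Lemma cprod1_lin X (x : W X) :
  linear (fun f : homR (W X) M => cls (x ⊙ y) (wtens (f : {linear _ -> _}) g)).
Proof.
move=> a f h; rewrite -(cls_linear (x ⊙ y)); apply: (congr1 (cls _)).
apply: linext_wpair => b c.
by rewrite homRP !wtensE homRP pureDl pureZl.
Qed.
Definition cprod1 : {linear coend M -> coend (tensor M N)} :=
  coend_rec' cprod1_nat cprod1_lin.
Lemma cprod1E X (x : W X) f : cprod1 (cls x f) = cls (x ⊙ y) (wtens f g).
Proof. exact: coend_rec'E. Qed.
End ProductLeft.

Lemma cprod2_nat Y Y' (u : lhom Y Y') y (g : {linear W Y' -> N}) :
  cprod1 y (lcomp g (wm u)) = cprod1 (wm u y) g.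
Proof.
apply: linext_cls => X x f _; rewrite !cprod1E.
rewrite -{2}[x](wm1 (T := T)) -wtensm -cls_nat; apply: (congr1 (cls _)).
by apply: linext_wpair => a b; rewrite lcompE wtensm !wtensE wm1.
Qed.
Lemma cprod2_lin Y (y : W Y) :
  linear (fun g : homR (W Y) N => cprod1 y (g : {linear _ -> _}) : homR _ _).
Proof.
move=> a f h; apply: linext_cls => X x k _; rewrite homRP !cprod1E.
rewrite -(cls_linear (x ⊙ y)); apply: (congr1 (cls _)).
apply: linext_wpair => b c.
by rewrite homRP !wtensE homRP pureDr pureZr.
Qed.
(** Recursion in the second factor with linear maps of the first as values, so that bilinearity
    needs no separate proof. *)
Definition cprod2 : {linear coend N -> homR (coend M) (coend (tensor M N))} :=
  coend_rec' (F := fun Y y g => cprod1 y g : homR (coend M) (coend (tensor M N)))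
    cprod2_nat cprod2_lin.

Definition cprod (a : coend M) (b : coend N) : coend (tensor M N) :=
  (cprod2 b : {linear _ -> _}) a.
Lemma cprodE X Y (x : W X) (y : W Y) f g :
  cprod (cls x f) (cls y g) = cls (x ⊙ y) (wtens f g).
Proof. by rewrite /cprod /cprod2 coend_rec'E cprod1E. Qed.
Lemma cprod_linearl b : linear (cprod ^~ b).
Proof. by move=> a x y; rewrite /cprod linearP. Qed.
Lemma cprod_linearr a : linear (cprod a).
Proof. by move=> c x y; rewrite /cprod linearP. Qed.
Lemma cprod_bil : bilinear_map cprod.
Proof. by split=> *; [exact: cprod_linearl|exact: cprod_linearr]. Qed.
End Product.

Definition wfmul X Y (f : {linear W X -> regmod R}) (g : {linear W Y -> regmod R}) :
  {linear W (X ⊗ Y) -> regmod R} := lcomp (tlunit (regmod R)) (wtens f g).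
Lemma wfmulE X Y (f : {linear W X -> regmod R}) (g : {linear W Y -> regmod R}) x y :
  wfmul f g (x ⊙ y) = (f x : R) * g y :> R.
Proof. by rewrite /wfmul lcompE wtensE tlunitE. Qed.

(** A copy of the coend that keeps only its additive group; the scalars return through [heta]. *)
Definition hcarrier : Type := coend (regmod R).
HB.instance Definition _ := GRing.Zmodule.on hcarrier.

Definition hmul (a b : hcarrier) : hcarrier := coend_map (tlunit (regmod R)) (cprod a b).
Definition hone : hcarrier := cls wone wunitV.
Lemma hmulE X Y (x : W X) (y : W Y) f g :
  hmul (cls x f) (cls y g) = cls (x ⊙ y) (wfmul f g).
Proof. by rewrite /hmul cprodE coend_mapE. Qed.

(** The ring laws are the associator, braiding and unitor of A, moved across a class by
    [cls_nat]. *)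
Lemma hmulA : associative hmul.
Proof.
move=> a b c; have [X [x [f [_ ->]]]] := cls_surj a.
have [Y [y [g [_ ->]]]] := cls_surj b; have [Z [z [h [_ ->]]]] := cls_surj c.
rewrite !hmulE -wassoc -cls_nat; apply: (congr1 (cls _)); apply: linext_wpair => p q.
elim/wtens_ind: p => [|p r|p r]; first by rewrite /wpair pure0l !linear0.
  by rewrite lcompE wassoc !wfmulE mulrA.
by rewrite wpairDl !linearD => -> ->.
Qed.

Lemma hmulC : commutative hmul.
Proof.
move=> a b; have [X [x [f [_ ->]]]] := cls_surj a.
have [Y [y [g [_ ->]]]] := cls_surj b.
rewrite !hmulE -wbraid -cls_nat; apply: (congr1 (cls _)); apply: linext_wpair => p q.
by rewrite lcompE wbraid !wfmulE mulrC.
Qed.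
Lemma hmul1 : left_id hone hmul.
Proof.
move=> a; have [X [x [f [_ ->]]]] := cls_surj a.
rewrite hmulE -[in RHS](wlunit x) -cls_nat; apply: (congr1 (cls _)).
by apply: linext_wpair => p q; rewrite lcompE wlunitZ wfmulE linearZ.
Qed.
Lemma hmulDl : left_distributive hmul +%R.
Proof.
by move=> a b c; rewrite /hmul -[a]scale1r cprod_linearl !scale1r linearD.
Qed.
Lemma hmulZl r (a b : coend (regmod R)) : hmul (r *: a) b = r *: hmul a b :> coend (regmod R).
Proof.
by rewrite /hmul -[r *: a]addr0 cprod_linearl linearP -[X in _ + X]/(hmul 0 b)
  (_ : hmul 0 b = 0) ?addr0 //; apply: (addrI (hmul 0 b)); rewrite -hmulDl !addr0.
Qed.
HB.instance Definition _ :=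
  GRing.Zmodule_isComPzRing.Build hcarrier hmulA hmulC hmul1 hmulDl.
Definition hring : comPzRingType := hcarrier.

Definition heta_fun (r : R) : hring := r *: (hone : coend (regmod R)).
Lemma heta_additive : zmod_morphism heta_fun.
Proof. by move=> r s; rewrite /heta_fun scalerBl. Qed.
Lemma heta_multiplicative : monoid_morphism heta_fun.
Proof.
split; first by rewrite /heta_fun scale1r.
move=> r s; rewrite /heta_fun -[RHS]/(hmul _ _) hmulZl.
by rewrite hmulC hmulZl hmul1 scalerA.
Qed.
HB.instance Definition _ := GRing.isZmodMorphism.Build R hring heta_fun heta_additive.
HB.instance Definition _ := GRing.isMonoidMorphism.Build R hring heta_fun heta_multiplicative.
Definition heta : {rmorphism R -> hring} := heta_fun.

Local Notation G := (algmod heta).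

(** The scalar action through [heta] agrees with that of the coend, so the identity is linear both
    ways. *)
Lemma toG_linear : linear (fun a : coend (regmod R) => a : G).
Proof.
move=> r a b; congr (_ + _); rewrite [RHS]/GRing.scale /= /amscale.
by rewrite -[RHS]/(hmul (r *: _) a) hmulZl hmul1.
Qed.
Definition toG : {linear coend (regmod R) -> G} := mklin toG_linear.
Lemma ofG_linear : linear (fun a : G => a : coend (regmod R)).
Proof.
move=> r a b; rewrite -[r *: _ + _]/(r *: toG a + toG b) -linearP.
by [].
Qed.
Definition ofG : {linear G -> coend (regmod R)} := mklin ofG_linear.

(** The matrix coefficient of the representation W X at x and f. *)
Definition mcoef X (x : W X) (f : {linear W X -> regmod R}) : G := toG (cls x f).
Lemma mcoef_nat X Y (u : lhom X Y) x f : mcoef x (lcomp f (wm u)) = mcoef (wm u x) f.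
Proof. by rewrite /mcoef cls_nat. Qed.
Lemma mcoef_surj (g : G) : exists X (x : W X) f, has_dual A X /\ g = mcoef x f.
Proof. exact: cls_surj. Qed.
Lemma mcoefl_linear X (f : {linear W X -> regmod R}) : linear (fun x => mcoef x f).
Proof. by move=> a x y; rewrite /mcoef (clsl_linear f) linearP. Qed.
Lemma mcoefr_linear X (x : W X) : linear (mcoef x : homR (W X) (regmod R) -> G).
Proof. by move=> a x' y; rewrite /mcoef (cls_linear x) linearP. Qed.
Definition mcoefl X f : {linear W X -> G} := mklin (@mcoefl_linear X f).
Definition mcoefr X x : {linear homR (W X) (regmod R) -> G} := mklin (@mcoefr_linear X x).
Lemma amul_mcoef X Y (x : W X) (y : W Y) f g :
  amul heta (pure (mcoef x f) (mcoef y g)) = mcoef (x ⊙ y) (wfmul f g).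
Proof. by rewrite amulE -[LHS]/(hmul _ _) hmulE. Qed.

Lemma line_linear N (n : N) : linear (fun a : regmod R => (a : R) *: n).
Proof. by move=> a b c; rewrite scalerDl scalerA. Qed.
Definition line N n : {linear regmod R -> N} := mklin (@line_linear N n).
Lemma lineE N (n : N) (a : R) : line n a = a *: n. Proof. by []. Qed.

Section Theta.
Variable N : lmodType R.

Lemma theta_bil : bilinear_map (fun (n : N) (g : G) => coend_map (line n) (ofG g)).
Proof.
split=> [g|n] a n1 n2; last by rewrite !linearP.
have [X [x [f [_ ->]]]] := mcoef_surj g; rewrite !coend_mapE -(cls_linear x).
apply: (congr1 (cls _)); apply: linext => y.
by rewrite homRP !lcompE !lineE scalerDr !scalerA mulrC.
Qed.
Definition theta : {linear tensor N G -> coend N} := tlift theta_bil.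
Lemma thetaE X n (x : W X) f : theta (pure n (mcoef x f)) = cls x (lcomp (line n) f).
Proof. by rewrite tliftE coend_mapE. Qed.

(* Over an object with a dual, dual bases invert [theta]. *)
Definition tau X (d : wdual T X) (x : W X) (f : {linear W X -> N}) : tensor N G :=
  \sum_(p <- wd_basis d) pure (f p.1) (mcoef x (wevr p.2)).

Lemma theta_tau X (d : wdual T X) x f : theta (tau d x f) = cls x f.
Proof.
rewrite /tau linear_sum (eq_bigr _ (fun p _ => thetaE _ _ _)).
rewrite -[RHS]/(mklin (cls_linear x) f).
rewrite -(linear_sum (mklin (cls_linear x))); congr (mklin _ _).
apply: linext => y; rewrite sum_homR -{2}(wd_expand d y) linear_sum /=.
by apply: eq_bigr => p _; rewrite linearZ.
Qed.

(** By [e] the functionals composed with u are expanded in the dual basis of P; after exchanging the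
    sums, the inner one is the expansion of [wm u q.1] in the dual basis of X. *)
Lemma tau_nat P X (dP : wdual T P) (dX : wdual T X) (u : lhom P X) p f :
  tau dP p (lcomp f (wm u)) = tau dX (wm u p) f.
Proof.
rewrite /tau.
have e (r : W (wd_ob dX)) : mcoef (wm u p) (wevr r) =
    \sum_(q <- wd_basis dP) wev r (wm u q.1) *: mcoef p (wevr q.2).
  rewrite -mcoef_nat -[LHS]/(mcoefr p (lcomp (wevr r) (wm u))).
  rewrite (eq_bigr (fun q => mcoefr p (wev r (wm u q.1) *: (wevr q.2 : homR _ _)))).
    rewrite -linear_sum; congr (mcoefr _ _).
    apply: linext => z; rewrite sum_homR lcompE -{1}(wd_expand dP z) !linear_sum.
    by apply: eq_bigr => q _; rewrite !linearZ; exact: mulrC.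
  by move=> q _; rewrite linearZ.
rewrite [RHS](eq_bigr _ (fun r _ => congr1 (pure (f r.1)) (e r.2))).
rewrite [RHS](eq_bigr _ (fun r _ => pure_sumr _ _ _)) exchange_big /=.
apply: eq_bigr => q _; rewrite -{1}(wd_expand dX (wm u q.1)) linear_sum pure_suml.
by apply: eq_bigr => r _; rewrite linearZ pureZl pureZr.
Qed.

Lemma tauD X (d : wdual T X) x (f g : homR (W X) N) :
  tau d x (f + g : homR _ _) = tau d x f + tau d x g.
Proof. by rewrite /tau -big_split; apply: eq_bigr => p _; exact: pureDl. Qed.
Lemma tau0 X (d : wdual T X) x (f : {linear W X -> N}) :
  (forall y, f y = 0) -> tau d x f = 0.
Proof. by move=> f0; rewrite /tau big1 // => p _; rewrite f0 pure0l. Qed.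

(** A sum of two tensors is again a single [tau], because a span moves both to one element p, where
    [tau] is additive in f. *)
Lemma tau_surj t : exists X (d : wdual T X) x f, t = tau d x f.
Proof.
elim/tens_ind: t => [|n g|t t' [X [d [x [f ->]]]] [Y [d' [y [g ->]]]]].
- have [X [x [f [/(wdual_ex T) [d _] _]]]] := mcoef_surj 0.
  by exists X, d, x, (hzero idfun _ _); rewrite tau0.
- have [X [x [f [/(wdual_ex T) [d _] ->]]]] := mcoef_surj g.
  exists X, d, x, (lcomp (line n) f).
  rewrite /tau (eq_bigr (fun p : W X * W (wd_ob d) =>
      pure n (mcoefr x ((f p.1 : R) *: (wevr p.2 : homR _ (regmod R)))))).
    rewrite -pure_sumr -linear_sum; congr (pure _ (mcoefr _ _)).
    apply: linext => z; rewrite sum_homR -{1}(wd_expand d z) linear_sum.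
    by apply: eq_bigr => q _; rewrite !linearZ; exact: mulrC.
  by move=> p _; rewrite lcompE lineE pureZl -pureZr linearZ.
- have [P [u [v [p [/(wdual_ex T) [dP _] -> ->]]]]] := span_pair x y.
  by exists P, dP, p, (hadd (lcomp f (wm u) : linhom idfun _ _) (lcomp g (wm v)));
    rewrite -(tau_nat dP d) -(tau_nat dP d') -tauD.
Qed.

(** The witness that [X, x, f] = 0 is an arrow u with f u = 0, along which [tau] can be pulled
    back. *)
Lemma theta_eq0 t : theta t = 0 -> t = 0.
Proof.
have [X [d [x [f ->]]]] := tau_surj t; rewrite theta_tau => /cls_eq0.
move=> [P [u [p [/(wdual_ex T) [dP _] -> fu0]]]].
by rewrite -(tau_nat dP) tau0.
Qed.
Lemma theta_inj : injective theta.
Proof. by move=> s t e; apply/subr0_eq/theta_eq0; rewrite linearB e subrr. Qed.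
Lemma theta_surj a : exists t, theta t = a.
Proof.
have [X [x [f [/(wdual_ex T) [d _] ->]]]] := cls_surj a.
by exists (tau d x f); exact: theta_tau.
Qed.
Definition thetaV_fun a := sval (cid (theta_surj a)).
Lemma thetaV_funK a : theta (thetaV_fun a) = a.
Proof. exact: svalP (cid (theta_surj a)). Qed.
Lemma thetaV_linear : linear thetaV_fun.
Proof. by move=> a x y; apply: theta_inj; rewrite linearP !thetaV_funK. Qed.
Definition thetaV : {linear coend N -> tensor N G} := mklin thetaV_linear.
Lemma thetaVK a : theta (thetaV a) = a.
Proof. exact: thetaV_funK. Qed.
End Theta.

Lemma theta_nat M N (g : {linear M -> N}) t :
  theta N (tmap g (lid G) t) = coend_map g (theta M t).
Proof.
elim/tens_ind: t => [|m h|t t' e e']; first by rewrite !linear0.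
  have [X [x [f [_ ->]]]] := mcoef_surj h.
  rewrite tmapE !thetaE coend_mapE; apply: (congr1 (cls _)).
  by apply: linext => y; rewrite !lcompE !lineE linearZ.
by rewrite !linearD e e'.
Qed.
Lemma flat_hring : flat G.
Proof.
move=> N N' f fi s t e; apply: theta_inj; apply: (coend_map_inj fi).
by rewrite -!theta_nat e.
Qed.

(** The coaction is [X, x, id] carried back along [theta]. As the witness is sealed, [theta_coact]
    is its only description. *)
Lemma coact_ex X : {r : {linear W X -> tensor (W X) G} |
  forall x, theta (W X) (r x) = cls x (lid (W X))}.
Proof. by exists (lcomp (thetaV (W X)) (mklin (clsl_linear (lid (W X))))) => x; exact: thetaVK. Qed.
Definition coact_lin X : {linear W X -> tensor (W X) G} := sval (coact_ex X).
Lemma theta_coact X (x : W X) : theta (W X) (coact_lin X x) = cls x (lid (W X)).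
Proof. exact: (svalP (coact_ex X)). Qed.
Lemma coact_linE X (d : wdual T X) (x : W X) :
  coact_lin X x = \sum_(p <- wd_basis d) pure p.1 (mcoef x (wevr p.2)).
Proof. by apply: theta_inj; rewrite theta_coact -(theta_tau d). Qed.
(** Turns identities between tensors obtained from a coaction into identities of classes, which have
    witnesses in A. *)
Lemma theta_coact_map X (x : W X) N (f : {linear W X -> N}) :
  theta N (tmap f (lid G) (coact_lin X x)) = cls x f.
Proof.
rewrite theta_nat theta_coact coend_mapE; apply: (congr1 (cls _)).
by apply: linext.
Qed.
Lemma coact_nat X Y (u : lhom X Y) (x : W X) :
  coact_lin Y (wm u x) = tmap (wm u) (lid G) (coact_lin X x).
Proof.
apply: theta_inj; rewrite theta_coact theta_coact_map -cls_nat.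
by apply: (congr1 (cls _)); apply: linext.
Qed.

(* Every element comes from an object with a dual, where the coaction is given
   by dual bases. *)
Lemma coact_ind (Q : forall X, W X -> Prop) :
  (forall X Y (u : lhom X Y) x, Q X x -> Q Y (wm u x)) ->
  (forall X, wdual T X -> forall x, Q X x) -> forall X x, Q X x.
Proof.
move=> Qnat Qd X x; have [P [u [p [/(wdual_ex T) [d _] ->]]]] := dual_cover x.
exact/Qnat/Qd.
Qed.
End HopfRing.

(** * The Hopf algebra *)

Section HopfStructure.
Variables (R : comPzRingType) (A : TensorCategory R) (T : neutral_tannakian A).
Implicit Types (X Y Z P : A) (M N Q : lmodType R).
Local Notation W := (W T).
Local Notation wm := (wm T).
Local Notation wone := (wone T).
Local Notation wunitV := (wunitV T).
Local Notation hring := (hring T).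
Local Notation heta := (heta T).
Local Notation theta := (theta T).
Local Notation thetaV := (thetaV T).
Local Notation coact_lin := (@coact_lin _ _ T _).
Local Notation G := (algmod heta).
Local Notation mul := (amul heta).
Local Notation "X ⊗ Y" := (tens (s := tmon A) X Y) (at level 35, right associativity).
Local Notation "x ⊙ y" := (wpair x y) (at level 35, right associativity).

Lemma linext_mcoef Q (f g : {linear G -> Q}) :
  (forall X (x : W X) h, wdual T X -> f (mcoef x h) = g (mcoef x h)) -> f = g.
Proof.
move=> e; apply: linext => a.
by have [X [x [h [/(wdual_ex T) [d _] ->]]]] := mcoef_surj a; exact: e.
Qed.

Lemma mcoefl_nat X Y (u : lhom X Y) (f : {linear W Y -> regmod R}) :
  mcoefl (lcomp f (wm u)) = lcomp (mcoefl f) (wm u).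
Proof. by apply: linext => y; exact: mcoef_nat. Qed.

Lemma comul_nat X Y (u : lhom X Y) x (f : {linear W Y -> regmod R}) :
  cls x (mcoefl (lcomp f (wm u))) = cls (wm u x) (mcoefl f).
Proof. by rewrite mcoefl_nat cls_nat. Qed.
Lemma comul_lin X (x : W X) :
  linear (fun f : homR (W X) (regmod R) => cls x (mcoefl (f : {linear _ -> _}))).
Proof.
move=> a f g; rewrite -(cls_linear x); apply: (congr1 (cls _)).
by apply: linext => y; exact: mcoefr_linear.
Qed.
(** With H (x) H read as H_H, the coproduct of [x, f] is the class of x with the map y |->
    [y, f]. *)
Lemma comul_ex : {c : {linear G -> tensor G G} |
  forall X (x : W X) f, theta G (c (mcoef x f)) = cls x (mcoefl f)}.
Proof.
exists (lcomp (thetaV G) (lcomp (coend_rec' comul_nat comul_lin) (ofG T))) => X x f.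
by rewrite !lcompE thetaVK; exact: coend_rec'E.
Qed.
Definition comul : {linear G -> tensor G G} := sval comul_ex.
Lemma theta_comul X (x : W X) f : theta G (comul (mcoef x f)) = cls x (mcoefl f).
Proof. exact: (svalP comul_ex). Qed.
Lemma comulE X (x : W X) f :
  comul (mcoef x f) = tmap (mcoefl f) (lid G) (coact_lin x).
Proof. by apply: theta_inj; rewrite theta_comul theta_coact_map. Qed.
Lemma comul_sum X (d : wdual T X) (x : W X) f :
  comul (mcoef x f) = \sum_(p <- wd_basis d) pure (mcoef p.1 f) (mcoef x (wevr p.2)).
Proof.
rewrite comulE (coact_linE d) linear_sum; apply: eq_bigr => p _.
by rewrite tmapE.
Qed.

Lemma counit_lin X (x : W X) :
  linear (fun f : homR (W X) (regmod R) => (f : {linear _ -> _}) x).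
Proof. by []. Qed.
Lemma counit_ex : {e : {linear G -> regmod R} |
  forall X (x : W X) f, e (mcoef x f) = f x}.
Proof.
exists (lcomp (coend_rec' (T := T) (F := fun X x (f : {linear W X -> regmod R}) => f x)
  (fun _ _ _ _ _ => erefl) counit_lin) (ofG T)) => X x f.
by rewrite lcompE; exact: coend_rec'E.
Qed.
Definition counit : {linear G -> regmod R} := sval counit_ex.
Lemma counitE X (x : W X) f : counit (mcoef x f) = f x.
Proof. exact: (svalP counit_ex). Qed.

(** Both sides are natural in x, so X may be given a dual; then both are the same double sum over
    the dual basis. *)
Lemma coact_coassoc X (x : W X) :
  tassoc (W X) G G (tmap coact_lin (lid G) (coact_lin x)) =
  tmap (lid (W X)) comul (coact_lin x).
Proof.
elim/coact_ind: x => [{}X Y u x e|{}X d x].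
  rewrite coact_nat.
  transitivity (tmap (wm u) (lid (tensor G G))
      (tassoc (W X) G G (tmap coact_lin (lid G) (coact_lin x)))).
    elim/tens_ind: (coact_lin x) => [|y h|s t es et]; first by rewrite !linear0.
      rewrite !tmapE !lidE coact_nat.
      elim/tens_ind: (coact_lin y) => [|z k|s t es et]; first by rewrite !(linear0, pure0l).
        by rewrite !(tmapE, tassocE).
      by rewrite !(linearD, pureDl) es et.
    by rewrite !linearD es et.
  rewrite e; elim/tens_ind: (coact_lin x) => [|y h|s t es et]; first by rewrite !linear0.
    by rewrite !tmapE.
  by rewrite !linearD es et.
rewrite !(coact_linE d) !linear_sum.
rewrite (eq_bigr (fun p => \sum_(q <- wd_basis d)
    pure q.1 (pure (mcoef p.1 (wevr q.2)) (mcoef x (wevr p.2))))); last first.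
  move=> p _; rewrite tmapE (coact_linE d) pure_suml linear_sum.
  by apply: eq_bigr => q _; rewrite tassocE.
rewrite exchange_big; apply: eq_bigr => q _.
by rewrite tmapE (comul_sum d) pure_sumr.
Qed.

Lemma coact_counital X (x : W X) :
  trunit (W X) (tmap (lid (W X)) counit (coact_lin x)) = x.
Proof.
elim/coact_ind: x => [{}X Y u x e|{}X d x].
  rewrite coact_nat -[in RHS]e.
  elim/tens_ind: (coact_lin x) => [|y h|s t es et]; first by rewrite !linear0.
    by rewrite !tmapE !trunitE linearZ.
  by rewrite !linearD es et.
rewrite (coact_linE d) -[RHS](wd_expand d x) !linear_sum.
by apply: eq_bigr => p _; rewrite tmapE trunitE counitE.
Qed.

Lemma comul_coassoc :
  lcomp (tassoc G G G) (lcomp (tmap comul (lid G)) comul) =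
  lcomp (tmap (lid G) comul) comul.
Proof.
apply: linext_mcoef => X x f d; rewrite !lcompE !(comul_sum d) !linear_sum.
rewrite (eq_bigr (fun p => \sum_(q <- wd_basis d)
    pure (mcoef q.1 f) (pure (mcoef p.1 (wevr q.2)) (mcoef x (wevr p.2))))); last first.
  move=> p _; rewrite tmapE (comul_sum d) pure_suml linear_sum.
  by apply: eq_bigr => q _; rewrite tassocE.
rewrite exchange_big; apply: eq_bigr => q _.
by rewrite tmapE (comul_sum d) pure_sumr.
Qed.

Lemma comul_counitl : lcomp (tlunit G) (lcomp (tmap counit (lid G)) comul) = lid G.
Proof.
apply: linext_mcoef => X x f d; rewrite !lcompE (comul_sum d) !linear_sum.
rewrite (eq_bigr (fun p : W X * W (wd_ob d) =>
    mcoefr x ((f p.1 : R) *: (wevr p.2 : homR _ (regmod R))))); last first.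
  by move=> p _; rewrite tmapE tlunitE counitE linearZ.
rewrite -linear_sum; apply: (congr1 (mcoefr x)); apply: linext => y.
rewrite sum_homR -[in RHS](wd_expand d y) linear_sum.
by apply: eq_bigr => p _; rewrite linearZ; exact: mulrC.
Qed.

Lemma comul_counitr : lcomp (trunit G) (lcomp (tmap (lid G) counit) comul) = lid G.
Proof.
apply: linext_mcoef => X x f d; rewrite !lcompE (comul_sum d) !linear_sum.
rewrite lidE -[RHS]/(mcoefl f x) -[in RHS](wd_expand d x) linear_sum.
by apply: eq_bigr => p _; rewrite tmapE trunitE counitE linearZ.
Qed.

Lemma mcoef1 : (1 : hring) = mcoef wone wunitV :> G. Proof. by []. Qed.

Lemma comul1 : comul (1 : hring) = @pure R G G (1 : hring) (1 : hring).
Proof.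
apply: theta_inj; rewrite mcoef1 theta_comul thetaE; apply: (congr1 (cls _)).
by apply: linext_wunit; rewrite lcompE lineE wunitV1 scale1r.
Qed.

(** [cojoin] for G, at a point where G is not yet a [HopfAlgebra]. *)
Definition cojoinG M N : {linear tensor (tensor M G) (tensor N G) -> tensor (tensor M N) G} :=
  lcomp (tmap (lid (tensor M N)) mul) (tmid M G N G).
(** Reduces multiplicativity of the coproduct, and later compatibility of coactions with tensor
    products, to a computation with [cprod]. *)
Lemma theta_cojoin M N s t :
  theta (tensor M N) (cojoinG M N (pure s t)) = cprod (theta M s) (theta N t).
Proof.
have [cl cr] := cprod_bil T M N.
elim/tens_ind: s => [|m g|s s' es es'].
- by rewrite pure0l !linear0 -[cprod 0 _]/(mklin (cl (theta N t)) 0) linear0.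
- elim/tens_ind: t => [|n h|t t' et et'].
  + by rewrite pure0r !linear0 -[cprod _ 0]/(mklin (cr _) 0) linear0.
  + have [X [x [f [_ ->]]]] := mcoef_surj g; have [Y [y [k [_ ->]]]] := mcoef_surj h.
    rewrite /cojoinG lcompE tmidE tmapE amul_mcoef !thetaE cprodE.
    apply: (congr1 (cls _)); apply: linext_wpair => a b.
    by rewrite lcompE lineE wfmulE wtensE !lcompE !lineE pureZl pureZr scalerA.
  + by rewrite pureDr !linearD et et' -[theta N t]scale1r cr !scale1r.
- by rewrite pureDl !linearD es es' -[theta M s]scale1r cl !scale1r.
Qed.

Lemma tmap_cojoin s t :
  tmap mul mul (tmid G G G G (pure s t)) = tmap mul (lid G) (cojoinG G G (pure s t)).
Proof.
rewrite /cojoinG lcompE.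
elim/tens_ind: (tmid _ _ _ _ _) => [|x y|x y ex ey]; first by rewrite !linear0.
  by rewrite !tmapE.
by rewrite !linearD ex ey.
Qed.

Lemma comulM (x y : hring) :
  comul (x * y) = tmap mul mul (tmid G G G G (pure (comul x) (comul y))).
Proof.
rewrite tmap_cojoin; apply: theta_inj; rewrite theta_nat theta_cojoin.
have [X [a [f [_ ->]]]] := mcoef_surj (x : G); have [Y [b [g [_ ->]]]] := mcoef_surj (y : G).
rewrite -(amulE (eta := heta)) amul_mcoef !theta_comul cprodE coend_mapE.
apply: (congr1 (cls _)); apply: linext_wpair => p q.
by rewrite lcompE wtensE -[LHS]amul_mcoef.
Qed.

Lemma counit1 : counit (1 : hring) = 1.
Proof. by rewrite mcoef1 counitE wunitV1. Qed.
Lemma counitM (x y : hring) : counit (x * y) = (counit x : R) * counit y.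
Proof.
have [X [a [f [_ ->]]]] := mcoef_surj (x : G); have [Y [b [g [_ ->]]]] := mcoef_surj (y : G).
by rewrite -(amulE (eta := heta)) amul_mcoef !counitE wfmulE.
Qed.

(* The element of the dual that represents the functional f. *)
Definition whatd X (d : wdual T X) (f : {linear W X -> regmod R}) : W (wd_ob d) :=
  \sum_(p <- wd_basis d) (f p.1 : R) *: p.2.
Lemma wev_whatd X (d : wdual T X) f x : wev (whatd d f) x = f x.
Proof.
rewrite -[LHS]/(wevl d x (whatd d f)) linear_sum -[in RHS](wd_expand d x) linear_sum.
by apply: eq_bigr => p _; rewrite !linearZ; exact: mulrC.
Qed.
Lemma wev_ext X (d : wdual T X) (c c' : W (wd_ob d)) :
  (forall x, wev c x = wev c' x) -> c = c'.
Proof.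
move=> e; rewrite -(wd_expandV c) -(wd_expandV c').
by apply: eq_bigr => p _; congr (_ *: _); exact: e.
Qed.
Lemma whatd_wevr X (d : wdual T X) (c : W (wd_ob d)) : whatd d (wevr c) = c.
Proof. by apply: wev_ext => x; rewrite wev_whatd. Qed.

(** The matrix coefficient of the contragredient: f becomes an element of the dual and x a
    functional on it. *)
Definition antip X (d : wdual T X) x f : G := mcoef (whatd d f) (wevl d x).
Lemma antip_nat X Y (dX : wdual T X) (dY : wdual T Y) (u : lhom X Y) x f :
  antip dX x (lcomp f (wm u)) = antip dY (wm u x) f.
Proof.
have [g gE] := wev_transpose dX dY u; rewrite /antip.
have -> : whatd dX (lcomp f (wm u)) = wm g (whatd dY f).
  by apply: wev_ext => y; rewrite gE !wev_whatd.
by rewrite -mcoef_nat; congr mcoef; apply: linext => c; exact: gE.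
Qed.
Definition wdual_of X (h : has_dual A X) : wdual T X := sval (cid (wdual_ex T h)).
Lemma antip_lin X (d : wdual T X) x : linear (antip d x : homR (W X) (regmod R) -> G).
Proof.
move=> a f g; rewrite /antip -(mcoefl_linear (wevl d x)); congr mcoef.
rewrite /whatd scaler_sumr -big_split; apply: eq_bigr => p _.
rewrite [in RHS]scalerA; exact: scalerDl.
Qed.
(** The recursion uses the chosen duals [wdual_of]; [antip_nat] along a cover of x shows that any
    dual d gives the same value. *)
Lemma antipode_ex : {S : {linear G -> G} |
  forall X (d : wdual T X) x f, S (mcoef x f) = antip d x f}.
Proof.
exists (lcomp (coend_rec (T := T) (F := fun X h => antip (wdual_of h))
  (fun X Y hX hY => @antip_nat X Y _ _) (fun X h => @antip_lin X _)) (ofG T)).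
move=> X d x f; rewrite lcompE.
have [P [u [p [hP ->]]]] := dual_cover x; rewrite -mcoef_nat.
by rewrite [LHS](coend_recE _ _ hP) (antip_nat _ d).
Qed.
Definition antipode : {linear G -> G} := sval antipode_ex.
Lemma antipodeE X (d : wdual T X) x f : antipode (mcoef x f) = mcoef (whatd d f) (wevl d x).
Proof. exact: (svalP antipode_ex). Qed.

(** For h = [x, f] the sum is a single class at [whatd d f ⊙ x] whose functional is the evaluation
    pairing; moving the evaluation across the class leaves f x times the unit. *)
Lemma antipodel h : mul (tmap antipode (lid G) (comul h)) = heta (counit h).
Proof.
have [X [x [f [/(wdual_ex T) [d _] ->]]]] := mcoef_surj h.
rewrite (comul_sum d) counitE !linear_sum.
rewrite (eq_bigr (fun p : W X * W (wd_ob d) =>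
    mcoefr (whatd d f ⊙ x) (wfmul (wevl d p.1) (wevr p.2) : homR _ _))); last first.
  by move=> p _; rewrite tmapE (antipodeE d) amul_mcoef.
rewrite -linear_sum (_ : \sum_(p <- _) _ = (lcomp wunitV (wm (wd_ev d)) : homR _ _)).
  rewrite -[LHS]/(mcoef _ _) mcoef_nat [wm _ _]wunitVE -/(wev (whatd d f) x) wev_whatd.
  by rewrite -[LHS]/(toG T (cls _ _)) -[cls _ _]/(mklin (clsl_linear wunitV) _) linearZ.
apply: linext_wpair => c y; rewrite sum_homR lcompE -[RHS]/(wevr c y).
rewrite -[in RHS](wd_expand d y) linear_sum.
by apply: eq_bigr => p _; rewrite wfmulE linearZ; exact: mulrC.
Qed.

(** Here the elements [p.1 ⊙ p.2] add up to the coevaluation at [wone], which is moved across the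
    class instead. *)
Lemma antipoder h : mul (tmap (lid G) antipode (comul h)) = heta (counit h).
Proof.
have [X [x [f [/(wdual_ex T) [d _] ->]]]] := mcoef_surj h.
rewrite (comul_sum d) counitE !linear_sum.
rewrite (eq_bigr (fun p : W X * W (wd_ob d) =>
    mcoefl (wfmul f (wevl d x)) (p.1 ⊙ p.2))); last first.
  by move=> p _; rewrite tmapE (antipodeE d) amul_mcoef whatd_wevr.
rewrite -linear_sum -wd_coevE -[LHS]/(mcoef _ _) -mcoef_nat.
have -> : lcomp (wfmul f (wevl d x)) (wm (wd_coev d)) = hscale (f x : R) (wunitV : homR _ _).
  apply: linext_wunit; rewrite lcompE wd_coevE linear_sum.
  rewrite -[RHS]/((f x : R) * (wunitV wone : R)) wunitV1 mulr1.
  rewrite -[in RHS](wd_expand d x) linear_sum; apply: eq_bigr => p _.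
  by rewrite wfmulE linearZ; exact: mulrC.
by rewrite /mcoef clsZr.
Qed.

Definition hopf : HopfAlgebra R :=
  {| hcoassoc := comul_coassoc; hcounitl := comul_counitl; hcounitr := comul_counitr;
     hcomul1 := comul1; hcomulM := comulM; hcounit1 := counit1; hcounitM := counitM;
     hantipodel := antipodel; hantipoder := antipoder |}.

End HopfStructure.

(** * The functor to comodules *)

Section ComoduleFunctor.
Variables (R : comPzRingType) (A : TensorCategory R) (T : neutral_tannakian A).
Implicit Types (X Y Z P : A) (M N Q : lmodType R).
Local Notation W := (W T).
Local Notation wm := (wm T).
Local Notation H := (hopf T).
Local Notation G := (hmod H).
Local Notation theta := (theta T).
Local Notation coact_lin := (@coact_lin _ _ T _).
Local Notation "X ⊗ Y" := (tens (s := tmon A) X Y) (at level 35, right associativity).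
Local Notation "x ⊙ y" := (wpair x y) (at level 35, right associativity).

Lemma wcom_assoc X : lcomp (tassoc (W X) G G) (lcomp (tmap coact_lin (lid G)) coact_lin) =
  lcomp (tmap (lid (W X)) (hcomul H)) coact_lin.
Proof. by apply: linext => x; exact: coact_coassoc. Qed.
Lemma wcom_counit X :
  lcomp (trunit (W X)) (lcomp (tmap (lid (W X)) (hcounit H)) coact_lin) = lid (W X).
Proof. by apply: linext => x; exact: coact_counital. Qed.
Definition wcom X : comodule H :=
  {| coact_assoc := wcom_assoc X; coact_counit := wcom_counit X |}.

Lemma wcmap_subproof X Y (f : lhom X Y) :
  lcomp (coact (wcom Y)) (wm f) = lcomp (tmap (wm f) (lid G)) (coact (wcom X)).
Proof. by apply: linext => x; exact: coact_nat. Qed.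
Definition wcmap X Y (f : lhom X Y) : comodule_map (wcom X) (wcom Y) :=
  @mkcmap _ H (wcom X) (wcom Y) _ (wcmap_subproof f).

Program Definition wrep : Functor A (Rep H) :=
  {| fobj := wcom; fmap := fun X Y f => wcmap f |}.
Next Obligation. by apply: cmap_inj; apply: linext => x; exact: wm1. Qed.
Next Obligation. by apply: cmap_inj; apply: linext => x; exact: wmM. Qed.

Lemma wcmap_inj X Y : injective (@wcmap X Y).
Proof.
move=> f g /(congr1 (fun h => cmap h)) e; apply: wm_inj => x.
exact: (@linapp _ (W X) (W Y) _ _ e x).
Qed.

Lemma wrep_linear : @linear_functor R A (Rep H) wrep.
Proof. by move=> X Y a f g; apply: cmap_inj; apply: linext => x; exact: wmP. Qed.

Lemma wmul_comod X Y :
  lcomp (coact (wcom (X ⊗ Y))) (wmul T X Y) =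
  lcomp (tmap (wmul T X Y) (lid G)) (coact (tens_comodule (wcom X) (wcom Y))).
Proof.
apply: linext_pure => x y; rewrite !lcompE tens_comoduleE.
apply: (@theta_inj _ _ T); rewrite [RHS]theta_nat.
rewrite [theta _ (cojoin H _ _ _)](theta_cojoin (M := W X) (N := W Y)).
rewrite !theta_coact cprodE coend_mapE; apply: (congr1 (cls _)).
by apply: linext_wpair => a b; rewrite lcompE wtensE.
Qed.
Lemma wunit_comod :
  lcomp (coact (wcom (munit (s := tmon A)))) (wunit T) =
  lcomp (tmap (wunit T) (lid G)) (coact (unit_comodule H)).
Proof.
apply: linext => a; rewrite !lcompE wunitE.
rewrite [coact (unit_comodule H) a]/= tmapE.
apply: (@theta_inj _ _ T); rewrite [coact _ _]linearZ [LHS]linearZ /=.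
rewrite [theta _ (coact_lin _)]theta_coact.
rewrite [RHS](thetaE (wunit T a) (wone T) (wunitV T)) -clsZr; apply: (congr1 (cls _)).
apply: linext_wunit; rewrite lcompE lineE wunitE.
by rewrite /= /hfun wunitV1 scale1r.
Qed.

Lemma iso_rep (M N : comodule H) (f : comodule_map M N) :
  (exists g : {linear N -> M}, lcomp g (cmap f) = lid M /\ lcomp (cmap f) g = lid N) ->
  is_iso (C := Rep H) f.
Proof.
move=> [g [gf fg]].
have fM : lcomp (coact N) (cmap f) = lcomp (tmap (cmap f) (lid G)) (coact M).
  by apply: linext => x; rewrite !lcompE cmapE.
exists (mkcmap (transport_comod gf fg fM)).
by split; apply: cmap_inj.
Qed.

Program Definition wrep_monoidal : StrongSymMonoidal A (Rep H) wrep :=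
  {| fmul := fun X Y => @mkcmap _ H (tens_comodule (wcom X) (wcom Y)) (wcom (X ⊗ Y)) _
       (wmul_comod X Y);
     funit := @mkcmap _ H (unit_comodule H) (wcom (munit (s := tmon A))) _ wunit_comod |}.
Next Obligation.
apply: iso_rep; have [g gP] := fmul_iso (ff_monoidal (nt_fun T)) X Y.
by exists g.
Qed.
Next Obligation.
apply: iso_rep; have [g gP] := funit_iso (ff_monoidal (nt_fun T)).
by exists g.
Qed.
Next Obligation. apply: cmap_inj; exact: (fmul_nat (ff_monoidal (nt_fun T)) f g). Qed.
Next Obligation. apply: cmap_inj; exact: (fmul_assoc (ff_monoidal (nt_fun T)) X Y Z). Qed.
Next Obligation. apply: cmap_inj; exact: (fmul_lunit (ff_monoidal (nt_fun T)) X). Qed.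
Next Obligation. apply: cmap_inj; exact: (fmul_runit (ff_monoidal (nt_fun T)) X). Qed.
Next Obligation. apply: cmap_inj; exact: (fmul_braid (ff_monoidal (nt_fun T)) X Y). Qed.

(** Finite generation as an induction principle; the generators are images of a dual basis of a
    cover of X. *)
Lemma fin_gen X : exists s : seq (W X), forall S : W X -> Prop,
  S 0 -> (forall a x y, S x -> S y -> S (a *: x + y)) -> {in s, forall x, S x} ->
  forall x, S x.
Proof.
have [P [q [/(wm_surj (T := T)) qs /(wdual_ex T) [d _]]]] := nt_dual T X.
exists [seq wm q p.1 | p <- wd_basis d] => S S0 SP Ss x.
have [z ->] := qs x; rewrite -(wd_expand d z) linear_sum.
have : {in wd_basis d, forall p, S (wm q p.1)} by move=> p pd; apply/Ss/map_f.
elim: (wd_basis d) => [|p s IH] Sd; first by rewrite big_nil.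
rewrite big_cons linearZ; apply: SP; first by apply: Sd; rewrite mem_head.
by apply: IH => r rs; apply: Sd; rewrite inE rs orbT.
Qed.

Lemma cls_eq2 N X Y (x : W X) (y : W Y) (f : {linear W X -> N}) g : cls x f = cls y g ->
  exists P (u : lhom P X) (v : lhom P Y) (p : W P),
    [/\ has_dual A P, x = wm u p, y = wm v p & forall z, f (wm u z) = g (wm v z)].
Proof.
have [P [u [v [p [_ -> ->]]]]] := span_pair x y.
rewrite -!cls_nat => /cls_eq [P' [t [p' [dP' -> e]]]].
exists P', (u ∙ t), (v ∙ t), p'; split=> // [||z]; rewrite !wmM //; exact: e.
Qed.

(* As g is a comodule map, cls x g = cls (g x) id; this equality is a span
   X <- P -> Y whose left leg reaches x and over which g lifts to A. *)
Lemma wrep_full X Y (g : comodule_map (wcom X) (wcom Y)) : exists f, wcmap f = g.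
Proof.
pose gl : {linear W X -> W Y} := cmap g.
pose good P (u : lhom P X) := exists v : lhom P Y, forall z, gl (wm u z) = wm v z.
have good1 x : exists P (u : lhom P X) p, good P u /\ x = wm u p.
  have : cls x gl = cls (gl x) (lid (W Y)).
    rewrite -theta_coact -theta_coact_map; congr (theta _ _).
    exact: (esym (cmapE g x)).
  move=> /cls_eq2 [P [u [v [p [_ -> _ e]]]]].
  by exists P, u, p; split=> //; exists v.
(* Good arrows are added over biproducts until one reaches all generators of W X, which makes it
   epic. *)
have goods (s : seq (W X)) :
    exists P (u : lhom P X), good P u /\ {in s, forall x, exists p, x = wm u p}.
  elim: s => [|x s [P [u [[v uv] us]]]].
    have [P [u [p [gu _]]]] := good1 0; by exists P, u.
  have [P' [u' [p' [[v' uv'] ->]]]] := good1 x.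
  have [S [i1 [i2 [p1 [p2 [e11 e22 e21 e12 _]]]]]] := ab_biproduct (nt_abelian T) P P'.
  exists S, (u ∙ p1 + u' ∙ p2); split.
    exists (v ∙ p1 + v' ∙ p2) => z.
    by rewrite !wmD linearD !wmM uv uv'.
  move=> y; rewrite inE => /predU1P [->|/us [p ->]].
    exists (wm i2 p'); rewrite -wmM lcompDl -!lccompA e12 e22.
    by rewrite lcomp0r add0r lccompm1.
  exists (wm i1 p); rewrite -wmM lcompDl -!lccompA e11 e21.
  by rewrite lcomp0r addr0 lccompm1.
have [s sP] := fin_gen X.
have [P [u [[v uv] us]]] := goods s.
have ue : epic (C := A) u.
  apply: (surj_epic (T := T)); apply: sP us; first by exists 0; rewrite linear0.
  by move=> a _ _ [p ->] [q ->]; exists (a *: p + q); rewrite linearP.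
have [Z [k [uk0 cu]]] := ab_epic (nt_abelian T) ue.
(* v descends along u because [wm v] is g after [wm u], hence vanishes on the image of k. *)
have [f [fE _]] : exists! f, f ∙ u = v.
  apply: cu; apply: (wm_inj (T := T)) => z.
  by rewrite wmM -uv -wmM uk0 !wm0 linear0.
exists f; apply: cmap_inj; apply: linext => x.
have [p ->] := wm_surj (T := T) ue x.
by rewrite -[LHS]/(wm f _) -wmM fE -uv.
Qed.

End ComoduleFunctor.

(** * Finitely presentable comodules *)

Lemma tmap_tmap (R : comPzRingType) (M M' M'' N N' N'' : lmodType R)
    (f' : {linear M' -> M''}) (f : {linear M -> M'})
    (g' : {linear N' -> N''}) (g : {linear N -> N'}) t :
  tmap f' g' (tmap f g t) = tmap (lcomp f' f) (lcomp g' g) t.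
Proof. by rewrite tmapD. Qed.

Lemma tmap_lid (R : comPzRingType) (M M' M'' P : lmodType R)
    (f' : {linear M' -> M''}) (f : {linear M -> M'}) t :
  tmap f' (lid P) (tmap f (lid P) t) = tmap (lcomp f' f) (lid P) t.
Proof. by rewrite tmap_tmap; congr (tmap _ _ _); apply: linext. Qed.

Lemma tassocV_nat (R : comPzRingType) (M M' N N' P P' : lmodType R) (f : {linear M -> M'})
    (g : {linear N -> N'}) (h : {linear P -> P'}) t :
  tassocV M' N' P' (tmap f (tmap g h) t) = tmap (tmap f g) h (tassocV M N P t).
Proof.
elim/tens_ind: t => [|m u|t t' et et']; first by rewrite !linear0.
  elim/tens_ind: u => [|n p|u v eu ev]; first by rewrite pure0r !linear0.
    by rewrite !(tmapE, tassocVE).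
  by rewrite pureDr !linearD eu ev.
by rewrite !linearD et et'.
Qed.

(** * Cofree comodules and underlying modules of colimits *)

Section Cofree.
Variables (R : comPzRingType) (H : HopfAlgebra R).
Implicit Types (M : comodule H) (N : lmodType R).
Local Notation G := (hmod H).

Section CofreeComodule.
Variable N : lmodType R.
Definition cofree_coact : {linear tensor N G -> tensor (tensor N G) G} :=
  lcomp (tassocV N G G) (tmap (lid N) (hcomul H)).
Lemma cofree_coactE n g :
  cofree_coact (pure n g) = tassocV N G G (pure n (hcomul H g)).
Proof. by rewrite /cofree_coact lcompE tmapE. Qed.

Lemma cofree_assoc :
  lcomp (tassoc (tensor N G) G G) (lcomp (tmap cofree_coact (lid G)) cofree_coact) =
  lcomp (tmap (lid (tensor N G)) (hcomul H)) cofree_coact.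
Proof.
apply: linext_pure => n g.
rewrite -[LHS]/(tassoc _ _ _ (tmap cofree_coact (lid G) (cofree_coact (pure n g)))).
rewrite -[RHS]/(tmap (lid _) (hcomul H) (cofree_coact (pure n g))) cofree_coactE.
transitivity (tassocV N G (tensor G G)
    (pure n (tassoc G G G (tmap (hcomul H) (lid G) (hcomul H g))))).
  elim/tens_ind: (hcomul H g) => [|a b|t t' et et']; first by rewrite !(linear0, pure0r).
    rewrite tassocVE !tmapE cofree_coactE !lidE.
    elim/tens_ind: (hcomul H a) => [|c d|t t' et et']; first by rewrite !(linear0, pure0r, pure0l).
      by rewrite !(tassocVE, tassocE).
    by move: et et'; rewrite !(pureDr, pureDl, linearD) => -> ->.
  by rewrite !(pureDr, linearD) et et'.
have e := @linapp _ _ _ _ _ (hcoassoc H) g; rewrite !lcompE in e; rewrite e.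
elim/tens_ind: (hcomul H g) => [|a b|t t' et et']; first by rewrite !(linear0, pure0r).
  by rewrite !(tmapE, tassocVE).
by rewrite !(pureDr, linearD) et et'.
Qed.

Lemma cofree_counit :
  lcomp (trunit (tensor N G)) (lcomp (tmap (lid (tensor N G)) (hcounit H)) cofree_coact) =
  lid (tensor N G).
Proof.
apply: linext_pure => n g; rewrite lidE.
rewrite -[LHS]/(trunit _ (tmap (lid _) (hcounit H) (cofree_coact (pure n g)))) cofree_coactE.
have := @linapp _ _ _ _ _ (hcounitr H) g; rewrite !lcompE lidE => {2}<-.
elim/tens_ind: (hcomul H g) => [|a b|t t' et et']; first by rewrite !(linear0, pure0r).
  by rewrite tassocVE !tmapE !trunitE pureZr.
by rewrite !(pureDr, linearD) et et'.
Qed.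

Definition cofree : comodule H :=
  {| coact_assoc := cofree_assoc; coact_counit := cofree_counit |}.
End CofreeComodule.

Section CofreeMap.
Variables (M : comodule H) (N : lmodType R) (f : {linear M -> N}).
Lemma cofree_map_subproof :
  lcomp (coact (cofree N)) (lcomp (tmap f (lid G)) (coact M)) =
  lcomp (tmap (lcomp (tmap f (lid G)) (coact M)) (lid G)) (coact M).
Proof.
apply: linext => m.
rewrite -[LHS]/(tassocV N G G (tmap (lid N) (hcomul H) (tmap f (lid G) (coact M m)))).
rewrite -[RHS]/(tmap _ (lid G) (coact M m)) -tmap_lid coactA -tassocV_nat !tmap_tmap.
congr (tassocV _ _ _ (tmap _ _ _)); apply: linext => // g.
by rewrite tmap1.
Qed.
Definition cofree_map : comodule_map M (cofree N) := mkcmap cofree_map_subproof.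
Lemma cofree_mapK m :
  trunit N (tmap (lid N) (hcounit H) ((cmap cofree_map : {linear _ -> _}) m)) = f m.
Proof.
rewrite -[X in tmap _ _ X]/(tmap f (lid G) (coact M m)) -[in RHS](coact1 m).
elim/tens_ind: (coact M m) => [|n g|t t' et et']; first by rewrite !linear0.
  by rewrite !tmapE !trunitE linearZ.
by rewrite !linearD et et'.
Qed.
End CofreeMap.

Lemma cofree_map_comp M M' N (g : comodule_map M' M) (f : {linear M -> N}) :
  ccmp (cofree_map f) g = cofree_map (lcomp f (cmap g)).
Proof.
apply: cmap_inj; apply: linext => m.
rewrite -[LHS]/(tmap f (lid G) (coact M ((cmap g : {linear _ -> _}) m))) cmapE.
exact: tmap_lid.
Qed.

(* The underlying module functor is left adjoint to [cofree], so that colimits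
   of comodules are colimits of modules. *)
Lemma colimit_module (J : Category) (D : Functor J (Rep H)) (L : Rep H) (c : cocone D L)
    (N : lmodType R) (d : forall j, {linear (D j : comodule H) -> N}) :
  is_colimit c ->
  (forall i j (u : Defs.Hom i j) x, d j ((cmap (fmap D u) : {linear _ -> _}) x) = d i x) ->
  exists h : {linear (L : comodule H) -> N},
    forall j x, h ((cmap (c j) : {linear _ -> _}) x) = d j x.
Proof.
move=> cc dE.
have nat i j (u : Defs.Hom i j) :
    (cofree_map (d j) : Defs.Hom (c := Rep H) _ _) ∘ fmap D u = cofree_map (d i).
  rewrite [LHS]cofree_map_comp; congr cofree_map.
  by apply: linext => x; exact: dE.
have [h [hE _]] := cc (cofree N) (Build_cocone nat).
exists (lcomp (trunit N) (lcomp (tmap (lid N) (hcounit H)) (cmap h))) => j x.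
have e : ccmp h (c j) = cofree_map (d j) := hE j.
by rewrite -(cofree_mapK (d j)) -e.
Qed.

(** The adjuncts of h and k into the cofree comodule agree on all legs, so they are equal, and the
    counit recovers h and k. *)
Lemma colimit_module_uniq (J : Category) (D : Functor J (Rep H)) (L : Rep H) (c : cocone D L)
    (N : lmodType R) (h k : {linear (L : comodule H) -> N}) :
  is_colimit c ->
  (forall j x, h ((cmap (c j) : {linear _ -> _}) x) = k ((cmap (c j) : {linear _ -> _}) x)) ->
  h = k.
Proof.
move=> cc e.
have nat i j (u : Defs.Hom i j) :
    (ccmp (cofree_map h) (c j) : Defs.Hom (c := Rep H) _ _) ∘ fmap D u =
    ccmp (cofree_map h) (c i).
  rewrite -[LHS]/(ccmp (ccmp (cofree_map h) (c j)) (fmap D u)).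
  by rewrite -(leg_nat c u); apply: cmap_inj; apply: linext.
have [g [_ gu]] := cc (cofree N) (Build_cocone nat).
have : cofree_map h = cofree_map k.
  rewrite -(gu (cofree_map h)) //; apply: gu => j /=.
  rewrite !cofree_map_comp; congr cofree_map.
  by apply: linext => x; rewrite !lcompE e.
move=> hk; apply: linext => x.
by rewrite -(cofree_mapK h) -(cofree_mapK k) hk.
Qed.
End Cofree.

Lemma set_colimit (J : Category) (F : Functor J SetCat) (L : SetCat) (c : cocone F L) :
  (forall l : L, exists j x, c j x = l) ->
  (forall i j (x : F i) (y : F j), c i x = c j y ->
     exists k (u : Defs.Hom i k) (v : Defs.Hom j k), fmap F u x = fmap F v y) ->
  is_colimit c.
Proof.
move=> surj inj V d.
have ex l : exists v, forall j x, c j x = l -> d j x = v.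
  have [i [y yl]] := surj l; exists (d i y) => j x; rewrite -yl => /inj [k [u [v e]]].
  rewrite -(leg_nat d u) -(leg_nat d v) /=.
  by congr (d k _).
exists (fun l => sval (cid (ex l))); split=> [j|h hE].
  by apply/funext => x /=; exact/esym/(svalP (cid (ex (c j x)))).
apply/funext => l; have [i [y yl]] := surj l.
rewrite -(svalP (cid (ex l)) i y yl) -yl.
by have := congr1 (fun f => f y) (hE i).
Qed.

(** Tested against [bool]: the constant [true] and the indicator of the union of the images agree on
    every leg. *)
Lemma set_colimit_surj (J : Category) (F : Functor J SetCat) (L : SetCat) (c : cocone F L) :
  is_colimit c -> forall l : L, exists j x, c j x = l.
Proof.
move=> cc l.
have nat i j (u : Defs.Hom i j) :
    ((fun _ => true) : Defs.Hom (c := SetCat) (F j) bool) ∘ fmap F u = (fun _ => true) by [].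
have [h [_ hu]] := cc (bool : SetCat) (Build_cocone nat).
have e1 := hu (fun _ => true) (fun j => erefl).
have e2 : h = (fun l => `[< exists j x, c j x = l >]).
  apply: hu => j; apply/funext => x /=; apply/asboolP; by exists j, x.
have := congr1 (fun f => f l) e2; rewrite e1.
by move=> /esym/asboolP.
Qed.

Lemma filtered_amalg (J : Category) : filtered J ->
  forall (i j k : J) (u : Defs.Hom i j) (v : Defs.Hom i k),
  exists l (a : Defs.Hom j l) (b : Defs.Hom k l), a ∘ u = b ∘ v.
Proof.
move=> [_ ub eq] i j k u v; have [l [a [b _]]] := ub j k.
have [m [t e]] := eq _ _ (a ∘ u) (b ∘ v).
by exists m, (t ∘ a), (t ∘ b); rewrite -!ccompA.
Qed.

(** * Comodules as filtered colimits of objects of A *)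

Section EssentialImage.
Variables (R : comPzRingType) (A : TensorCategory R) (T : neutral_tannakian A).
Implicit Types (X Y Z P : A).
Local Notation W := (W T).
Local Notation wm := (wm T).
Local Notation H := (hopf T).
Local Notation G := (hmod H).
Local Notation theta := (theta T).
Local Notation coact_lin := (@coact_lin _ _ T _).
Local Notation wcom := (wcom T).
Local Notation wcmap := (wcmap T).

(* If f kills x, then cls x f = 0, and this is witnessed by some u : P -> X
   reaching x such that f u = 0; no kernel comodule has to be formed. *)
Lemma wcom_map_ker (M : comodule H) X (f : comodule_map (wcom X) M) x :
  (cmap f : {linear _ -> _}) x = 0 ->
  exists P (u : lhom P X), (exists p, x = wm u p) /\
    forall y, (cmap f : {linear _ -> _}) (wm u y) = 0.
Proof.
move=> fx0.
have : cls x (cmap f : {linear W X -> M}) = 0.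
  by rewrite -theta_coact_map -[tmap _ _ _](cmapE f) fx0 !linear0.
by move=> /cls_eq0 [P [u [p [_ xE e]]]]; exists P, u; split=> //; exists p.
Qed.

(* Write coact m = (f (x) 1) (coact x) with f linear. By coassociativity the maps
   coact f and (f (x) 1) coact have the same class at x, hence agree after
   composition with some u reaching x: then f u is a comodule map. *)
Lemma wcom_generates (M : comodule H) (m : M) :
  exists X (f : comodule_map (wcom X) M) x, m = (cmap f : {linear _ -> _}) x.
Proof.
have [X [x [f [_ fE]]]] := cls_surj (theta M (coact M m)).
have rm : coact M m = tmap f (lid G) (coact_lin x).
  by apply: (@theta_inj _ _ T); rewrite fE theta_coact_map.
have mE : m = f x.
  rewrite -(coact1 m) rm -[in RHS](coact_counital x).
  elim/tens_ind: (coact_lin x) => [|y h|s t es et]; first by rewrite !linear0.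
    by rewrite !tmapE !trunitE linearZ.
  by rewrite !linearD es et.
have : cls x (lcomp (coact M) f) = cls x (lcomp (tmap f (lid G)) coact_lin).
  rewrite -!theta_coact_map; congr (theta _ _).
  rewrite -[LHS]tmap_lid -[X in tmap _ _ X]rm -[RHS]tmap_lid [LHS]coactA rm.
  rewrite [X in _ = tmap _ _ X](@coactA _ H (wcom X) x).
  by rewrite -tassocV_nat !tmap_tmap; congr (tassocV _ _ _ (tmap _ _ _));
    apply: linext => // g; rewrite !lcompE tmap1.
move=> /cls_eq [P [u [p [_ xE e]]]].
have fu : lcomp (coact M) (lcomp f (wm u)) =
    lcomp (tmap (lcomp f (wm u)) (lid G)) (coact (wcom P)).
  apply: linext => y; rewrite -[LHS]/(lcomp (coact M) f (wm u y)) e.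
  rewrite -[LHS]/(tmap f (lid G) (coact_lin (wm u y))) coact_nat.
  exact: tmap_lid.
by exists P, (@mkcmap _ H (wcom P) M _ fu), p; rewrite mE xE.
Qed.

Lemma wcom_descent (M : comodule H) X Q (q : lhom X Q) (f : comodule_map (wcom X) M)
    (g : {linear W Q -> M}) :
  epic (C := A) q -> (forall x, g (wm q x) = (cmap f : {linear _ -> _}) x) ->
  lcomp (coact M) g = lcomp (tmap g (lid G)) (coact (wcom Q)).
Proof.
move=> /(wm_surj (T := T)) qs gq; apply: linext => z; have [x ->] := qs z.
rewrite -[LHS]/(coact M (g (wm q x))) gq cmapE.
rewrite -[RHS]/(tmap g (lid G) (coact_lin (wm q x))) coact_nat tmap_lid.
by congr (tmap _ _ _); apply: linext => y; rewrite lcompE gq.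
Qed.

(* The objects of A over M; they form a filtered category with colimit M, so that
   a finitely presentable M is a retract of an object of A. *)
Section Slice.
Variable M : comodule H.

Definition slice_ob : SmallType := {i : nt_ix T & comodule_map (wcom (nt_sk i)) M}.
Definition slice_hom (a b : slice_ob) : SmallType :=
  {f : lhom (nt_sk (tag a)) (nt_sk (tag b)) | ccmp (tagged b) (wcmap f) = tagged a}.
Lemma slice_hom_eq a b (f g : slice_hom a b) : sval f = sval g -> f = g.
Proof. by case: f g => f ef [g eg] /= fg; apply: eq_exist. Qed.
Program Definition slice : Category :=
  {| Ob := slice_ob; Defs.Hom := slice_hom;
     idm := fun a => exist _ (lidm _) _;
     ccomp := fun a b c g f => exist _ (sval g ∙ sval f) _ |}.
Next Obligation. by apply: cmap_inj; apply: linext => x; rewrite /= wm1. Qed.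
Next Obligation.
case: g f => g gE [f fE] /=; rewrite -fE -gE.
by apply: cmap_inj; apply: linext => x; rewrite /= wmM.
Qed.
Next Obligation. by apply: slice_hom_eq; exact: lccomp1m. Qed.
Next Obligation. by apply: slice_hom_eq; exact: lccompm1. Qed.
Next Obligation. by apply: slice_hom_eq; exact: lccompA. Qed.

Program Definition slice_diagram : Functor slice (Rep H) :=
  {| fobj := fun a : slice => wcom (nt_sk (tag a)); fmap := fun a b f => wcmap (sval f) |}.
Next Obligation. exact: (fmap1 (wrep T)). Qed.
Next Obligation. exact: (fmapD (wrep T)). Qed.

Definition slice_fun (a : slice) : {linear W (nt_sk (tag a)) -> M} := cmap (tagged a).
Lemma slice_nat (a b : slice) (f : Defs.Hom a b) x :
  slice_fun b (wm (sval f) x) = slice_fun a x.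
Proof.
by have /(congr1 (fun h => cmap h))/linapp := svalP f; apply.
Qed.

Program Definition slice_cocone : cocone slice_diagram (M : Rep H) :=
  {| leg := fun a => tagged a |}.
Next Obligation. exact: (svalP u). Qed.

(** Moves an arrow over M with arbitrary target X to the representative of X. The factorization
    through u is kept, so that whatever u kills stays killed. *)
Lemma slice_lift (a : slice) X (u : lhom (nt_sk (tag a)) X) (f : comodule_map (wcom X) M) :
  (forall x, (cmap f : {linear _ -> _}) (wm u x) = slice_fun a x) ->
  exists (b : slice) (h : Defs.Hom a b) (v : lhom X (nt_sk (tag b))), sval h = v ∙ u.
Proof.
move=> fu; pose b : slice := existT _ (skel T X) (ccmp f (wcmap (of_sk T X))).
have hb : ccmp (tagged b) (wcmap (to_sk T X ∙ u)) = tagged a.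
  apply: cmap_inj; apply: linext => x; rewrite -[RHS]fu /= -wmM lccompA.
  by rewrite to_skK lccomp1m.
by exists b, (exist _ (to_sk T X ∙ u) hb), (to_sk T X).
Qed.

(** By exactness the map to M descends to the cokernel of u formed in A, and the descended map is
    again a comodule map. *)
Lemma slice_coker (a : slice) Z (u : lhom Z (nt_sk (tag a))) :
  (forall z, slice_fun a (wm u z) = 0) ->
  exists (b : slice) (h : Defs.Hom a b), sval h ∙ u = 0.
Proof.
move=> au; have [Q [q cq]] := ab_cokernel (nt_abelian T) u.
have [g gE] := wm_coker cq au.
have gM := wcom_descent (cokernel_epic cq) gE.
have [b [h [v hE]]] := @slice_lift a Q q (@mkcmap _ H (wcom Q) M _ gM) gE.
by exists b, h; rewrite hE -lccompA cq.1 lcomp0r.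
Qed.

(** Upper bounds are biproducts in A, and parallel arrows are merged by the cokernel of their
    difference. *)
Lemma slice_filtered : filtered slice.
Proof.
split.
- constructor; exists (skel T (munit (s := tmon A))); exact: 0.
- move=> a b.
  have [S [i1 [i2 [p1 [p2 [e11 e22 e21 e12 _]]]]]] :=
    ab_biproduct (nt_abelian T) (nt_sk (tag a)) (nt_sk (tag b)).
  pose f : comodule_map (wcom S) M :=
    ccmp (tagged a) (wcmap p1) + ccmp (tagged b) (wcmap p2).
  have fE x : (cmap f : {linear _ -> _}) x = slice_fun a (wm p1 x) + slice_fun b (wm p2 x).
    by [].
  pose c : slice := existT _ (skel T S) (ccmp f (wcmap (of_sk T S))).
  have ha : ccmp (tagged c) (wcmap (to_sk T S ∙ i1)) = tagged a.
    apply: cmap_inj; apply: linext => x.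
    rewrite -[LHS]/((cmap f : {linear _ -> _}) (wm (of_sk T S) (wm (to_sk T S ∙ i1) x))).
    by rewrite -wmM lccompA to_skK lccomp1m fE -!wmM e11 e21 wm1 wm0 linear0 addr0.
  have hb : ccmp (tagged c) (wcmap (to_sk T S ∙ i2)) = tagged b.
    apply: cmap_inj; apply: linext => x.
    rewrite -[LHS]/((cmap f : {linear _ -> _}) (wm (of_sk T S) (wm (to_sk T S ∙ i2) x))).
    by rewrite -wmM lccompA to_skK lccomp1m fE -!wmM e12 e22 wm1 wm0 linear0 add0r.
  by exists c, (exist _ (to_sk T S ∙ i1) ha), (exist _ (to_sk T S ∙ i2) hb).
- move=> a b f g.
  have [|c [h hE]] := @slice_coker b _ (sval f - sval g).
    by move=> z; rewrite wmB linearB !slice_nat subrr.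
  exists c, h; apply: slice_hom_eq => /=.
  by apply/subr0_eq; rewrite -lcompBr.
Qed.

Lemma slice_small : essentially_small slice.
Proof.
exists slice_ob, (fun a => a : slice) => a.
by exists a, (idm a), (idm a); rewrite !ccomp1m.
Qed.

Lemma slice_surj (m : M) : exists (a : slice) x, slice_fun a x = m.
Proof.
have [X [f [x ->]]] := wcom_generates m.
exists (existT _ (skel T X) (ccmp f (wcmap (of_sk T X)))), (wm (to_sk T X) x).
by rewrite /slice_fun /= -wmM to_skK wm1.
Qed.

Lemma slice_ker (a : slice) x : slice_fun a x = 0 ->
  exists (b : slice) (h : Defs.Hom a b), wm (sval h) x = 0.
Proof.
move=> /wcom_map_ker [P [u [[p ->] au]]].
have [b [h hu]] := slice_coker au; exists b, h.
by rewrite -wmM hu wm0.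
Qed.

(** [slice_surj] and [slice_ker] make M the colimit on elements, so a cocone defines a function on
    M; its linearity and its compatibility with coactions are checked at a stage. *)
Lemma slice_colimit : is_colimit slice_cocone.
Proof.
move=> N d.
pose dl (a : slice) : {linear W (nt_sk (tag a)) -> N} := cmap (d a).
have dnat (a b : slice) (f : Defs.Hom a b) x : dl b (wm (sval f) x) = dl a x.
  by have /(congr1 (fun h => cmap h))/linapp := leg_nat d f; apply.
have ub := let: And3 _ u _ := slice_filtered in u.
have d0 a x : slice_fun a x = 0 -> dl a x = 0.
  by move=> /slice_ker [b [h hx]]; rewrite -(dnat _ _ h) hx linear0.
have ex m : exists v, forall a x, slice_fun a x = m -> dl a x = v.
  have [a [x am]] := slice_surj m; exists (dl a x) => b y bm.
  have [c [f [g _]]] := ub a b.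
  rewrite -(dnat _ _ f) -(dnat _ _ g); apply/subr0_eq; rewrite -linearB.
  by apply: d0; rewrite linearB !slice_nat am bm subrr.
pose h m := sval (cid (ex m)).
have hE a x : h (slice_fun a x) = dl a x.
  exact: esym (svalP (cid (ex (slice_fun a x))) a x erefl).
have hlin : linear h.
  move=> r m n; have [a [x <-]] := slice_surj m; have [b [y <-]] := slice_surj n.
  have [c [f [g _]]] := ub a b.
  by rewrite -(slice_nat f) -(slice_nat g) -linearP !hE linearP.
have hM : lcomp (coact N) (mklin hlin) = lcomp (tmap (mklin hlin) (lid G)) (coact M).
  apply: linext => m; have [a [x <-]] := slice_surj m.
  rewrite -[LHS]/(coact N (h (slice_fun a x))) hE [LHS](cmapE (d a) x).
  rewrite -[RHS]/(tmap _ _ (coact M (slice_fun a x))) [coact M _](cmapE (tagged a) x) tmap_lid.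
  by congr (tmap _ _ _); apply: linext => y; rewrite -[LHS]hE.
exists (mkcmap hM); split=> [a|k kE]; first by apply: cmap_inj; apply: linext => x; exact: hE.
apply: cmap_inj; apply: linext => m; have [a [x <-]] := slice_surj m.
rewrite -[LHS]/(h _) hE /dl -(kE a).
by [].
Qed.

End Slice.

(** The identity of M factors through a stage of the slice. The resulting idempotent lifts to A by
    fullness and splits there. *)
Lemma fp_image (M : comodule H) : finitely_presentable (C := Rep H) M ->
  exists X, isomorphic (C := Rep H) (wcom X) M.
Proof.
move=> /(_ _ _ _ _ (slice_small M) (slice_filtered M) (@slice_colimit M)) /set_colimit_surj.
move=> /(_ (Defs.cid M)) [a [g gE]].
have fg : ccmp (tagged a) g = Defs.cid M := gE.
have [e eE] := wrep_full (ccmp g (tagged a)).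
have ee : e ∙ e = e.
  apply: (wcmap_inj (T := T)); rewrite -[LHS]/(fmap (wrep T) (e ∙ e)) fmapD /= eE.
  apply: cmap_inj; apply: linext => x /=.
  by have := linapp (congr1 (fun h => cmap h) fg) ((cmap (tagged a) : {linear _ -> _}) x) => /= ->.
have [Q [r [i [ri ir]]]] := idempotent_split (nt_abelian T) ee.
exists Q, (ccmp (tagged a) (wcmap i)), (ccmp (wcmap r) g).
have fgx x : slice_fun a ((cmap g : {linear _ -> _}) x) = x.
  exact: (linapp (congr1 (fun h => cmap h) fg) x).
have gfx x : (cmap g : {linear _ -> _}) (slice_fun a x) = wm e x.
  exact: (esym (linapp (congr1 (fun h => cmap h) eE) x)).
split; apply: cmap_inj; apply: linext => x.
  rewrite -[LHS]/(wm r ((cmap g : {linear _ -> _}) (slice_fun a (wm i x)))) gfx.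
  by rewrite -!wmM -ir !lccompA ri lccomp1m ri wm1.
rewrite -[LHS]/(slice_fun a (wm i (wm r ((cmap g : {linear _ -> _}) x)))).
by rewrite -wmM ir -gfx !fgx.
Qed.

End EssentialImage.

(** * Filtered colimits of comodules on elements *)

Section DiagramColimit.
Variables (R : comPzRingType) (H : HopfAlgebra R) (J : Category) (D : Functor J (Rep H)).

Definition dmap i j (u : Defs.Hom i j) : {linear (D i : comodule H) -> (D j : comodule H)} :=
  cmap (fmap D u).
Lemma dmap1 j x : dmap (idm j) x = x.
Proof. by rewrite /dmap fmap1. Qed.
Lemma dmapM i j k (v : Defs.Hom j k) (u : Defs.Hom i j) x : dmap (v ∘ u) x = dmap v (dmap u x).
Proof. by rewrite /dmap fmapD. Qed.

Section Elements.
Variables (filt : filtered J) (I : SmallType) (s : I -> J)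
  (sP : forall j : J, exists i, isomorphic j (s i)) (i0 : I).

Definition diag_tr i j (h : {linear (D (s i) : comodule H) -> (D (s j) : comodule H)}) : Prop :=
  exists u, h = dmap u.
Lemma diag_tr1 i : diag_tr (lid (D (s i) : comodule H)).
Proof. by exists (idm _); apply: linext => x; rewrite dmap1. Qed.
Lemma diag_trM i j k (g : {linear (D (s j) : comodule H) -> (D (s k) : comodule H)})
    (f : {linear (D (s i) : comodule H) -> (D (s j) : comodule H)}) :
  diag_tr g -> diag_tr f -> diag_tr (lcomp g f).
Proof.
by move=> [v ->] [u ->]; exists (v ∘ u); apply: linext => x; rewrite dmapM.
Qed.
Lemma diag_ub i j : exists k (f : {linear (D (s i) : comodule H) -> (D (s k) : comodule H)})
    (g : {linear (D (s j) : comodule H) -> (D (s k) : comodule H)}), diag_tr f /\ diag_tr g.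
Proof.
have [_ ub _] := filt; have [l [u [v _]]] := ub (s i) (s j).
have [k [t _]] := sP l.
by exists k, (dmap (t ∘ u)), (dmap (t ∘ v)); split; [exists (t ∘ u)|exists (t ∘ v)].
Qed.
Lemma diag_eq i j (f g : {linear (D (s i) : comodule H) -> (D (s j) : comodule H)}) :
  diag_tr f -> diag_tr g ->
  exists k (h : {linear (D (s j) : comodule H) -> (D (s k) : comodule H)}),
    diag_tr h /\ forall x, h (f x) = h (g x).
Proof.
move=> [u ->] [v ->]; have [_ _ eq] := filt; have [l [t e]] := eq _ _ u v.
have [k [r _]] := sP l.
exists k, (dmap (r ∘ t)); split=> [|x]; first by exists (r ∘ t).
by rewrite -!dmapM -!ccompA e.
Qed.
Definition diag_sys : dsys R :=
  {| dmod := fun i => (D (s i) : comodule H) : lmodType R; dtr := diag_tr; dix0 := i0;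
     dtr1 := diag_tr1; dtrM := diag_trM; dtr_ub := diag_ub; dtr_eq := diag_eq |}.

Variables (L : Rep H) (c : cocone D L).
Hypothesis cc : is_colimit c.
Local Notation cl j := (cmap (c j) : {linear _ -> _}).

Lemma cocone_dmap i j (u : Defs.Hom i j) x : cl j (dmap u x) = cl i x.
Proof. exact: (linapp (congr1 (fun h => cmap h) (leg_nat c u)) x). Qed.

(** J is only essentially small, so the module colimit V is formed over representatives. The cocone
    gives p : V -> L, [colimit_module] gives h : L -> V, and p h = id yields surjectivity; an
    element that dies in L dies in V by h, hence at a stage. *)
Lemma colimit_elements :
  (forall l, exists j x, cl j x = l) /\
  (forall j x, cl j x = 0 -> exists k (u : Defs.Hom j k), dmap u x = 0).
Proof.
pose V := fcolim diag_sys.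
have iso j := cid (sP j).
pose t j : Defs.Hom j (s (sval (iso j))) := sval (cid (svalP (iso j))).
have t_iso j : is_iso (t j) := svalP (cid (svalP (iso j))).
pose d j : {linear (D j : comodule H) -> V} := lcomp (@fin _ diag_sys (sval (iso j))) (dmap (t j)).
have dtE i (u : Defs.Hom (s i) (s (sval (iso (s i))))) x :
    @fin _ diag_sys _ (dmap u x) = @fin _ diag_sys i x.
  by apply: (fin_tr (D := diag_sys) (f := dmap u)); exists u.
(* With g inverse to [t i], [t j ∘ u] is a transition [t j ∘ u ∘ g] between representatives after
   [t i]. *)
have dE i j (u : Defs.Hom i j) x : d j (dmap u x) = d i x.
  have [g [gt _]] := t_iso i.
  rewrite /d !lcompE -dmapM -[t j ∘ u]ccompm1 -gt ccompA dmapM.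
  exact: (fin_tr (D := diag_sys) (f := dmap (t j ∘ u ∘ g)) _
            (ex_intro _ (t j ∘ u ∘ g) erefl)).
have [h hE] := colimit_module cc dE.
split=> [l|j x cx0].
  have ccl i j (f : {linear dmod i -> dmod j}) x :
      @dtr _ diag_sys i j f -> cl (s j) (f x) = cl (s i) x.
    by move=> [u ->]; exact: cocone_dmap.
  pose p : {linear V -> (L : comodule H)} := frec ccl.
  have ph : lcomp p h = lid _.
    apply: (colimit_module_uniq cc) => j x.
    by rewrite lcompE hE /d lcompE frecE cocone_dmap.
  have [i [x xE]] := fin_surj (h l).
  exists (s i), x.
  by rewrite -(frecE ccl) -xE -[LHS](lcompE p h) ph.
have : d j x = 0 by rewrite -hE cx0 linear0.
rewrite /d lcompE => /fin_eq0 [k [f [[u ->] e]]].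
by exists (s k), (u ∘ t j); rewrite dmapM.
Qed.
End Elements.
End DiagramColimit.

(** * Finite presentability of the objects of A *)

Section ImageIsFP.
Variables (R : comPzRingType) (A : TensorCategory R) (T : neutral_tannakian A).
Local Notation W := (W T).
Local Notation wm := (wm T).
Local Notation H := (hopf T).
Local Notation G := (hmod H).
Local Notation theta := (theta T).
Local Notation coact_lin := (@coact_lin _ _ T _).
Local Notation wcom := (wcom T).
Variables (J : Category) (D : Functor J (Rep H)) (L : Rep H) (c : cocone D L).
Hypotheses (small : essentially_small J) (filt : filtered J) (cc : is_colimit c).
Local Notation cl j := (cmap (c j) : {linear _ -> _}).
Local Notation Dm j := (D j : comodule H).
Local Notation dmap := (@dmap _ _ _ D _ _).

Lemma colim_surj l : exists j x, cl j x = l.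
Proof.
have [I [s sP]] := small; have [[j0] _ _] := filt; have [i0 _] := sP j0.
by have [+ _] := colimit_elements filt sP i0 cc; apply.
Qed.
Lemma colim_ker j x : cl j x = 0 -> exists k (u : Defs.Hom j k), dmap u x = 0.
Proof.
have [I [s sP]] := small; have [[j0] _ _] := filt; have [i0 _] := sP j0.
by have [_ +] := colimit_elements filt sP i0 cc; apply.
Qed.

(* W X is finitely generated, so a map out of it that dies pointwise along the
   filtered diagram dies at some stage. *)
Lemma kill_gen X (N : J -> lmodType R)
    (n : forall i j, Defs.Hom i j -> {linear N i -> N j}) j (f : {linear W X -> N j}) :
  (forall i j k (v : Defs.Hom j k) (u : Defs.Hom i j) x, n _ _ (v ∘ u) x = n _ _ v (n _ _ u x)) ->
  (forall x, exists k (u : Defs.Hom j k), n _ _ u (f x) = 0) ->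
  exists k (u : Defs.Hom j k), forall x, n _ _ u (f x) = 0.
Proof.
move=> nM fx; have [s sP] := fin_gen T X.
suff [k [u us]] : exists k (u : Defs.Hom j k), {in s, forall x, n _ _ u (f x) = 0}.
  exists k, u; apply: sP us; first by rewrite !linear0.
  by move=> a x y ex ey; rewrite !linearP ex ey scaler0 addr0.
elim: s {sP} => [|x s [k [u us]]]; first by exists j, (idm j).
have [k' [u' ux]] := fx x; have [l [a [b ab]]] := filtered_amalg filt u u'.
exists l, (a ∘ u) => y; rewrite inE => /predU1P [->|ys]; first by rewrite ab nM ux linear0.
by rewrite nM us ?linear0.
Qed.

Lemma kill_lin X j (f : {linear W X -> Dm j}) : (forall x, cl j (f x) = 0) ->
  exists k (u : Defs.Hom j k), forall x, dmap u (f x) = 0.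
Proof.
move=> cf; apply: (kill_gen (N := fun j => Dm j : lmodType R) (n := fun i j u => dmap u)).
  by move=> *; exact: dmapM.
by move=> x; exact/colim_ker/cf.
Qed.

(** Writing t as f (x) 1 applied to a coaction turns the hypothesis into the vanishing of a class,
    hence of [cl j] after f on some W P; there [kill_lin] applies. *)
Lemma tmap_ker j (t : tensor (Dm j) G) : tmap (cl j) (lid G) t = 0 ->
  exists k (u : Defs.Hom j k), tmap (dmap u) (lid G) t = 0.
Proof.
have [X [x [f [_ fE]]]] := cls_surj (theta _ t).
have tE : t = tmap f (lid G) (coact_lin x).
  by apply: (@theta_inj _ _ T); rewrite fE theta_coact_map.
rewrite tE tmap_lid => e.
have /cls_eq0 [P [v [p [_ xE cf]]]] : cls x (lcomp (cl j) f) = 0.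
  by rewrite -theta_coact_map [X in theta _ X]e linear0.
have [k [u uf]] := kill_lin (f := lcomp f (wm v)) cf; exists k, u.
rewrite tmap_lid xE coact_nat tmap_lid; apply: (@theta_inj _ _ T).
by rewrite theta_coact_map linear0 cls0.
Qed.

Lemma kill_tmap X j (f : {linear W X -> tensor (Dm j) G}) :
  (forall x, tmap (cl j) (lid G) (f x) = 0) ->
  exists k (u : Defs.Hom j k), forall x, tmap (dmap u) (lid G) (f x) = 0.
Proof.
move=> cf; apply: (kill_gen (N := fun j => tensor (Dm j) G)
  (n := fun i j u => tmap (dmap u) (lid G))).
  move=> i k l v u t; rewrite tmap_lid; congr (tmap _ _ _).
  by apply: linext => x; exact: dmapM.
by move=> x; exact/tmap_ker/cf.
Qed.

(** By dual bases f is a finite sum of functionals times the elements [f p.1], and finitely many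
    elements lift to one stage. *)
Lemma lift_dual P (d : wdual T P) (f : {linear W P -> (L : comodule H)}) :
  exists j (g : {linear W P -> Dm j}), forall x, cl j (g x) = f x.
Proof.
suff : forall s : seq (W P * W (wd_ob d)), exists j (g : {linear W P -> Dm j}),
    forall x, cl j (g x) = \sum_(p <- s) (wev p.2 x : R) *: f p.1.
  move=> /(_ (wd_basis d)) [j [g gE]]; exists j, g => x.
  rewrite gE -[in RHS](wd_expand d x) linear_sum; apply: eq_bigr => p _.
  by rewrite linearZ.
elim=> [|p s [j [g gE]]].
  have [[j] _ _] := filt; exists j, (hzero idfun _ _) => x.
  by rewrite big_nil /= linear0.
have [i [y yE]] := colim_surj (f p.1).
have [_ ub _] := filt; have [k [u [v _]]] := ub j i.
exists k, (hadd (lcomp (line (dmap v y)) (wevr p.2) : linhom idfun _ _) (lcomp (dmap u) g)) => x.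
rewrite big_cons -gE -yE -(cocone_dmap c u) -(cocone_dmap c v) -linearZ -linearD.
by [].
Qed.

(** Only covers with a dual admit linear lifts, so the stage is raised three times: to lift f on a
    cover q, to descend the lift along q, and to make it a comodule map. *)
Lemma wcom_lift X (f : comodule_map (wcom X) (L : comodule H)) :
  exists j (g : comodule_map (wcom X) (Dm j)), ccmp (c j) g = f.
Proof.
have [P [q [qe /(wdual_ex T) [d _]]]] := nt_dual T X.
pose fl : {linear W X -> (L : comodule H)} := cmap f.
have [j [g gE]] := lift_dual d (lcomp fl (wm q)).
have [K [k se]] := epic_short_exact (nt_abelian T) qe.
have [|j' [u gk0]] := @kill_lin K j (lcomp g (wm k)).
  move=> x; rewrite [LHS]gE lcompE -wmM.
  by have [[-> _] _] := se; rewrite wm0 linear0.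
have [h hE] := short_exact_coker (T := T) (h := lcomp (dmap u) g) se gk0.
have ch x : cl j' (h x) = fl x.
  have [y ->] := wm_surj (T := T) qe x.
  by rewrite hE lcompE cocone_dmap gE.
(* The failure of h to be a comodule map; it dies in L because f is one. *)
pose del : {linear W X -> tensor (Dm j') G} :=
  hadd (lcomp (coact (Dm j')) h : linhom idfun _ _)
    (hopp (lcomp (tmap h (lid G)) coact_lin : linhom idfun _ _)).
have delE x : del x = coact (Dm j') (h x) - tmap h (lid G) (coact_lin x) by [].
have [|l [v vE]] := @kill_tmap X j' del.
  move=> x; rewrite delE linearB -cmapE ch tmap_lid [coact L _](cmapE f).
  rewrite (_ : lcomp _ h = fl) ?subrr //; exact: linext.
have hM : lcomp (coact (Dm l)) (lcomp (dmap v) h) =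
    lcomp (tmap (lcomp (dmap v) h) (lid G)) (coact (wcom X)).
  apply: linext => x; apply/subr0_eq; rewrite -[RHS](vE x) delE [RHS]linearB.
  rewrite tmap_lid -[tmap (dmap v) _ _](cmapE (fmap D v)).
  by [].
exists l, (@mkcmap _ H (wcom X) (Dm l) _ hM).
by apply: cmap_inj; apply: linext => x; rewrite -[RHS]ch -(cocone_dmap c v).
Qed.

Lemma wcom_lift_uniq X i j (f : comodule_map (wcom X) (Dm i))
    (g : comodule_map (wcom X) (Dm j)) :
  ccmp (c i) f = ccmp (c j) g ->
  exists k (u : Defs.Hom i k) (v : Defs.Hom j k), ccmp (fmap D u) f = ccmp (fmap D v) g.
Proof.
move=> fg; have [_ ub _] := filt; have [k [u [v _]]] := ub i j.
pose h : comodule_map (wcom X) (Dm k) := ccmp (fmap D u) f - ccmp (fmap D v) g.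
have hE x : (cmap h : {linear _ -> _}) x =
    dmap u ((cmap f : {linear _ -> _}) x) - dmap v ((cmap g : {linear _ -> _}) x) by [].
have [|l [t tE]] := @kill_lin X k (cmap h).
  move=> x; rewrite hE linearB !cocone_dmap; apply/eqP; rewrite subr_eq0; apply/eqP.
  exact: (linapp (congr1 (fun h => cmap h) fg) x).
exists l, (t ∘ u), (t ∘ v); apply: cmap_inj; apply: linext => x.
apply/subr0_eq; rewrite -[RHS](tE x) hE [RHS]linearB.
by rewrite -!dmapM.
Qed.

End ImageIsFP.

Lemma image_fp (R : comPzRingType) (A : TensorCategory R) (T : neutral_tannakian A) (X : A) :
  finitely_presentable (C := Rep (hopf T)) (wcom T X).
Proof.
move=> J D L c small filt cc; apply: set_colimit => [f|i j f g].
  by have [j [g gE]] := wcom_lift small filt cc f; exists j, g.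
by move=> /(wcom_lift_uniq small filt cc).
Qed.

(** * Assembling the equivalence *)

Lemma functor_irr (C D : Category) (o : C -> D)
    (m : forall X Y : C, Defs.Hom X Y -> Defs.Hom (o X) (o Y)) p p' q q' :
  @Build_Functor C D o m p q = @Build_Functor C D o m p' q'.
Proof. by rewrite (Prop_irrelevance p p') (Prop_irrelevance q q'). Qed.

(** The inverse sends g to a preimage under F of its conjugate by e; faithfulness makes this
    functorial and gives the unit its naturality. *)
Lemma fully_faithful_equivalence (C D : Category) (F : Functor C D) (G0 : D -> C)
    (e : forall d, Defs.Hom (F (G0 d)) d) :
  faithful F -> (forall X Y (g : Defs.Hom (F X) (F Y)), exists f, fmap F f = g) ->
  (forall d, is_iso (e d)) -> is_equivalence F.
Proof.
move=> Ffaith Ffull eiso.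
pose eV d := sval (cid (eiso d)).
have eVK d : eV d ∘ e d = idm _ by have [] := svalP (cid (eiso d)).
have eK d : e d ∘ eV d = idm _ by have [] := svalP (cid (eiso d)).
pose Gm d d' (g : Defs.Hom d d') := sval (cid (Ffull _ _ (eV d' ∘ g ∘ e d))).
have GmE d d' (g : Defs.Hom d d') : fmap F (Gm d d' g) = eV d' ∘ g ∘ e d.
  exact: svalP (cid (Ffull _ _ (eV d' ∘ g ∘ e d))).
have Gm1 d : Gm d d (idm d) = idm (G0 d).
  by apply: Ffaith; rewrite GmE fmap1 ccompm1 eVK.
have GmD d d' d'' (g : Defs.Hom d' d'') (f : Defs.Hom d d') :
    Gm _ _ (g ∘ f) = Gm _ _ g ∘ Gm _ _ f.
  apply: Ffaith; rewrite fmapD !GmE !ccompA; congr (_ ∘ _ ∘ _).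
  by rewrite -[_ ∘ e d' ∘ _]ccompA eK ccompm1.
exists (Build_Functor Gm1 GmD); split.
  pose a X := sval (cid (Ffull _ _ (e (F X)))).
  have aE X : fmap F (a X) = e (F X) by exact: svalP (cid (Ffull _ _ (e (F X)))).
  exists a; split=> [X|X Y f].
    have [b bE] := Ffull _ _ (eV (F X)); exists b.
    by split; apply: Ffaith; rewrite fmapD aE bE ?eK ?eVK fmap1.
  by apply: Ffaith; rewrite !fmapD aE /= GmE aE !ccompA eK ccomp1m.
by exists e; split=> // d d' g /=; rewrite GmE !ccompA eK ccomp1m.
Qed.

Theorem theorem1p1p3 (R : comPzRingType) (A : TensorCategory R)
    (hA : weakly_Tannakian A) (hw : inhabited (NeutralFiberFunctor A)) :
  exists H : HopfAlgebra R,
    flat (hmod H) /\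
    equivalent_to_full_subcategory A (finitely_presentable (C := Rep H)).
Proof.
have [[I [s sP]] ab _ duals] := hA; have [w] := hw.
pose T : neutral_tannakian A :=
  {| nt_fun := w; nt_abelian := ab; nt_dual := duals; nt_skP := sP |}.
exists (hopf T); split; first exact: flat_hring.
pose B := full_subcategory (finitely_presentable (C := Rep (hopf T))).
unshelve eset (F := (@Build_Functor A B
  (fun X => exist _ (wcom T X : Rep (hopf T)) (@image_fp _ _ T X)) (fun X Y f => wcmap T f) _ _)).
- exact: (fmap1 (wrep T)).
- exact: (fmapD (wrep T)).
exists F; split; last first.
- have -> : compF (inclusion (finitely_presentable (C := Rep (hopf T)))) F = wrep T.
    exact: functor_irr.
  by constructor; exact: wrep_monoidal.
- exact: wrep_linear.
(* The inverse on objects takes its values among the representatives, so the X found by [fp_image]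
   is replaced by an isomorphic [s i]. *)
have im (M : B) : exists i, isomorphic (C := B) (F (s i)) M.
  have [X [f [f' [f'f ff']]]] := fp_image (svalP M).
  have [i [g [g' [g'g gg']]]] := sP X.
  suff [h [h' hh']] : isomorphic (C := Rep (hopf T)) (wrep T (s i)) (sval M).
    by exists i, h, h'.
  exists (f ∘ fmap (wrep T) g'), (fmap (wrep T) g ∘ f').
  have gF : fmap (wrep T) g ∘ fmap (wrep T) g' = idm _ by rewrite -fmapD gg' fmap1.
  have Fg : fmap (wrep T) g' ∘ fmap (wrep T) g = idm _ by rewrite -fmapD g'g fmap1.
  split.
    transitivity (fmap (wrep T) g ∘ (f' ∘ f) ∘ fmap (wrep T) g'); first by rewrite !ccompA.
    by rewrite f'f ccompm1.
  transitivity (f ∘ (fmap (wrep T) g' ∘ fmap (wrep T) g) ∘ f'); first by rewrite !ccompA.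
  by rewrite Fg ccompm1.
apply: (fully_faithful_equivalence (G0 := fun M => s (sval (cid (im M))))
  (e := fun M => sval (cid (svalP (cid (im M)))))).
- by move=> X Y; exact: wcmap_inj.
- by move=> X Y g; exact: wrep_full.
- by move=> M; exact: svalP (cid (svalP (cid (im M)))).
Qed.
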